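(* Assume that, as $N\to\infty$, $M\to\infty$, one has $n\to\infty$, $m\to\infty$, $p=n/N\to0$, $q=m/M\to0$, and that $$\frac{\log(p^{-1})}m+\frac{\log(q^{-1})}n\to0 .$$ Upper bounds. If $a=a_{NM}>0$ is such that one of the following conditions holds: $$\text{(i)}\quad a^2\sqrt{nmpq}\to\infty\qquad\text{or}\qquad\text{(ii)}\quad\liminf\frac{a^2\sqrt{nm}}{2\sqrt{n\log(p^{-1})+m\log(q^{-1})}}>1,$$ then the test $\psi^z=\max\{\psi^z_{\mathrm{lin}},\psi^z_{\max}\}$, where the constant $\delta>0$ in $\psi^z_{\max}$ is chosen small enough and $H=H_{NM}\to\infty$ is such that moreover $H\le c\,\frac{a^2}2\sqrt{nmpq}$ for some constant $0<c<1$ when (i) holds, satisfies $\gamma_{nm,a}(\psi^z)\to0$. Lower bounds. Assume, moreover, that $$\frac{\log\log(p^{-1})}{\log(q^{-1})}\to0,\qquad\frac{\log\log(q^{-1})}{\log(p^{-1})}\to0,\qquad n\log(p^{-1})\asymp m\log(q^{-1}).$$ If $a=a_{NM}>0$ is such that $$a^2\sqrt{nmpq}\to0\qquad\text{and}\qquad\limsup\frac{a^2\sqrt{nm}}{2\sqrt{n\log(p^{-1})+m\log(q^{-1})}}<1,$$ then $\gamma_{nm,a}\to1$ and $\beta_{nm,a,\alpha}\to1-\alpha$ for any $\alpha\in(0,1)$.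
   Context: Model: one observes an $N\times M$ matrix $\mathbf Y=\{Y_{ij}\}$, $Y_{ij}=s_{ij}+\xi_{ij}$, with $\xi_{ij}$ i.i.d. standard Gaussian and $s_{ij}\in\mathbb R$. $E_S$ denotes expectation when the mean matrix is $S=\{s_{ij}\}$; $E_0$ corresponds to $S=0$ (null hypothesis). The integers $n=n_{NM}\le N$, $m=m_{NM}\le M$ and $a=a_{NM}>0$ may depend on $N,M$; limits are as $N\to\infty$, $M\to\infty$; $p=n/N$, $q=m/M$; $u\asymp v$ means $0<\liminf u/v\le\limsup u/v<\infty$. $\mathcal C_{nm}$ is the collection of all sets $C=A\times B$ with $A\subset\{1,\dots,N\}$, $\#A=n$, $B\subset\{1,\dots,M\}$, $\#B=m$. Two-sided alternative: $\mathcal S_{nm,a}$ is the set of matrices $S$ for which there is $C\in\mathcal C_{nm}$ with $s_{ij}=0$ for $(i,j)\notin C$ and $|s_{ij}|\ge a$ for $(i,j)\in C$. A test is a measurable $\psi=\psi(\mathbf Y)\in[0,1]$; $\alpha(\psi)=E_0\psi$, $\beta_{nm,a}(\psi)=\sup_{S\in\mathcal S_{nm,a}}E_S(1-\psi)$, $\gamma_{nm,a}(\psi)=\alpha(\psi)+\beta_{nm,a}(\psi)$, $\gamma_{nm,a}=\inf_\psi\gamma_{nm,a}(\psi)$, $\beta_{nm,a,\alpha}=\inf_{\psi:\alpha(\psi)\le\alpha}\beta_{nm,a}(\psi)$. Tests: $z_{\mathrm{lin}}=\frac1{\sqrt{2NM}}\sum_{i,j}(Y_{ij}^2-1)$, $\psi^z_{\mathrm{lin}}=\mathbf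 1_{\{z_{\mathrm{lin}}>H\}}$; $Z_C=\frac1{\sqrt{2nm}}\sum_{(i,j)\in C}(Y_{ij}^2-1)$, $z_{\max}=\max_{C\in\mathcal C_{nm}}Z_C$, $\psi^z_{\max}=\mathbf 1_{\{z_{\max}>T_{nm,\delta}\}}$ with $T_{nm,\delta}=\sqrt{(2+\delta)\log\left(\binom Nn\binom Mm\right)}$. *)

(* Defs.v *)
From HB Require Import structures.
From mathcomp Require Import all_boot all_order all_algebra.
From mathcomp Require Import all_classical all_reals all_analysis.

Set Implicit Arguments.
Unset Strict Implicit.
Unset Printing Implicit Defensive.
Import Order.TTheory GRing.Theory Num.Theory.
Import numFieldNormedType.Exports.

Local Open Scope classical_set_scope.
Local Open Scope ring_scope.

Section iid_law.
Context d (T : measurableType d) (R : realType).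

Definition cons_pair n (x : T * n.-tuple T) : n.+1.-tuple T :=
  [the n.+1.-tuple T of x.1 :: x.2].

Lemma measurable_cons_pair n : measurable_fun setT (@cons_pair n).
Proof. exact: measurable_cons measurable_fst measurable_snd. Qed.

HB.instance Definition _ n :=
  @isMeasurableFun.Build _ _ _ _ (@cons_pair n) (@measurable_cons_pair n).

(* Law of an n-tuple of independent variables, each with law P. *)
Fixpoint iid (P : probability T R) n : probability (n.-tuple T) R :=
  match n with
  | 0 => \d_([tuple] : 0.-tuple T)
  | n'.+1 => distribution (P \x iid P n')%E (@cons_pair n')
  end.

End iid_law.

Section model.
Context (R : realType) (N M : nat).
Implicit Types (S : 'M[R]_(N, M)) (a H : R) (n m : nat).

(* An observation is the tuple of its rows rather than a matrix, because the
   library equips tuples, but not matrices, with the product sigma-algebra. *)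
Definition obs := N.-tuple (M.-tuple (measurableTypeR R)).

Implicit Types (y xi : obs) (psi : obs -> R).

Definition entry y (i : 'I_N) (j : 'I_M) : R := tnth (tnth y i) j.

Definition noise_law : probability obs R :=
  iid (iid (normal_prob 0 1) M) N.

Definition shift S xi : obs :=
  [tuple [tuple S i j + entry xi i j | j < M] | i < N].

Definition expect S psi : \bar R := \int[noise_law]_xi (psi (shift S xi))%:E.

Definition rects n m : {set {set 'I_N * 'I_M}} :=
  [set finset.setX A B | A in [set A : {set 'I_N} | #|A| == n],
                         B in [set B : {set 'I_M} | #|B| == m]]%SET.

Definition alternatives n m a : set 'M[R]_(N, M) :=
  [set S | exists2 C, C \in rects n m &
     forall i j, ((i, j) \notin C -> S i j = 0) /\
                 ((i, j) \in C -> a <= `|S i j|)].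

Definition is_test psi : Prop :=
  measurable_fun setT psi /\ (forall y, 0 <= psi y <= 1).

Definition alpha psi : \bar R := expect 0 psi.

Definition beta n m a psi : \bar R :=
  ereal_sup [set expect S (fun y => 1 - psi y) | S in alternatives n m a].

Definition gamma n m a psi : \bar R := (alpha psi + beta n m a psi)%E.

Definition gamma_min n m a : \bar R :=
  ereal_inf [set gamma n m a psi | psi in is_test].

Definition beta_min n m a (al : R) : \bar R :=
  ereal_inf [set beta n m a psi |
             psi in [set psi | is_test psi /\ (alpha psi <= al%:E)%E]].

Definition z_lin y : R :=
  (Num.sqrt (2 * N%:R * M%:R))^-1 *
    \sum_(i < N) \sum_(j < M) (entry y i j ^+ 2 - 1).

Definition z_rect n m (C : {set 'I_N * 'I_M}) y : R :=
  (Num.sqrt (2 * n%:R * m%:R))^-1 *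
    \sum_(c in C) (entry y c.1 c.2 ^+ 2 - 1).

(* Extended-real valued so that the maximum has -oo as its neutral element. *)
Definition z_max n m y : \bar R :=
  \big[maxe/-oo%E]_(C in rects n m) (z_rect n m C y)%:E.

Definition threshold n m (delta : R) : R :=
  Num.sqrt ((2 + delta) * ln ('C(N, n)%:R * 'C(M, m)%:R)).

Definition psi_lin H : obs -> R := \1_[set y | H < z_lin y].

Definition psi_max n m (delta : R) : obs -> R :=
  \1_[set y | ((threshold n m delta)%:E < z_max n m y)%E].

Definition psi_z n m H (delta : R) y : R :=
  Num.max (psi_lin H y) (psi_max n m delta y).

End model.

Definition asymp (R : realType) (F : set_system (nat * nat))
    (u v : nat * nat -> R) : Prop :=
  (0 < limf_einf (fun k => (u k / v k)%:E) F)%E /\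
  (limf_esup (fun k => (u k / v k)%:E) F < +oo)%E.

(* Main.v *)
(* Upper bounds: Gaussian moment generating functions give Chernoff bounds for
   centred sums of squares over a set of cells, both under the null hypothesis
   and under an alternative; the first error of the scan is a union bound over
   the rectangles.

   Lower bounds: the risk of any test is at least 1 minus half the L1 distance
   between the null law and the Bayesian mixture that draws the rectangle and the
   signs at random.  The plain second moment of the mixture blows up in the scan
   regime, so the likelihood ratio of a rectangle is cut off whenever some large
   subrectangle V has likelihood ratio above exp(cutoff V); moments of order 1 + t
   show that this loses a negligible mass.  In the truncated second moment, a pair
   of rectangles with a large overlap then contributes at most exp(cutoff), and one
   with an overlap that is small in one direction at most exp(a^4 X Z), where X and
   Z are the sizes of the overlaps of the two row sets and of the two column sets;
   both are averaged by domination of the hypergeometric law by the binomial one. *)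
From HB Require Import structures.
Require Import Defs.
From mathcomp Require Import all_boot all_order all_algebra.
From mathcomp Require Import all_classical all_reals all_analysis measurable_realfun.
From mathcomp Require Import zify ring lra.
Set Implicit Arguments.
Unset Strict Implicit.
Unset Printing Implicit Defensive.
Import Order.TTheory GRing.Theory Num.Theory.
Import numFieldNormedType.Exports.
Local Open Scope classical_set_scope.
Local Open Scope ring_scope.

(** The cutoff has to fit between two exponents. With p = exp (- [lnp]) and q = exp (- [lnq]), two
    random rectangles share x rows and z columns with probability about exp (- (x [lnp] + z [lnq])).
    Under the law of a rectangle the log likelihood ratio of an x by z part is typically a^4 x z /
    4, while the plain second moment costs a^4 x z / 2; when a^4 n m is close to 4 (n [lnp] + m
    [lnq]), full overlaps make the latter twice too large. As x <= n and z <= m, the scan condition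
    bounds a^4 x z / 4 by (1 - g) (x [lnp] + z [lnq]). The cutoff (1 - g / 4) (x [lnp] + z [lnq])
    thus lies above the typical value and below what the overlap probability pays for. Only parts
    with more than a fraction [al] of the rows and of the columns are tested: there are at most 2^(n
    + m) of them, and their tail exp (- const (n [lnp] + m [lnq])) beats this number because [lnp]
    and [lnq] tend to infinity. Thinner overlaps are harmless: n [lnp] and m [lnq] being comparable,
    a^4 times the short side is at most [lnp] / 2 or [lnq] / 2 once [al] is small. *)

(** * Gaussian integrals on the line *)

Section gaussian.
Context {R : realType}.
Local Notation mu := (@lebesgue_measure R).
Local Notation N01 := (@normal_prob R 0 1).
Local Open Scope ereal_scope.

Lemma ge0_integral_normal_prob (m s : R) (f : measurableTypeR R -> \bar R) :
  measurable_fun setT f -> (forall x, 0 <= f x) ->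
  \int[normal_prob m s]_x f x = \int[mu]_x (f x * (normal_pdf m s x)%:E).
Proof.
move=> mf f0; have dom := normal_prob_dominates m s.
rewrite -(Radon_Nikodym_SigmaFinite.change_of_variables dom f0)//.
have mpdf : measurable_fun setT (fun x => (normal_pdf m s x)%:E).
  by apply/measurable_EFinP; exact: measurable_normal_pdf.
have iRN := Radon_Nikodym_SigmaFinite.f_integrable dom.
apply: ae_eq_integral => //.
- by apply: emeasurable_funM => //; exact: measurable_int iRN.
- exact: emeasurable_funM.
(* The Radon-Nikodym derivative and the density have the same integral over every measurable set,
   hence agree almost everywhere. *)
apply: ae_eqe_mul2l; apply: integral_ae_eq => //.
by move=> E _ mE; rewrite -Radon_Nikodym_SigmaFinite.f_integral.
Qed.

Lemma lebesgue_measure_shift (s : R) (A : set (measurableTypeR R)) :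
  measurable A ->
  pushforward mu ((fun x => (s + x)%R) : measurableTypeR R -> measurableTypeR R)
    A = mu A.
Proof.
have ms : measurable_fun setT
    ((fun x => (s + x)%R) : measurableTypeR R -> measurableTypeR R).
  exact: measurable_funD.
pose f : {mfun measurableTypeR R >-> measurableTypeR R} :=
  HB.pack ((fun x => (s + x)%R) : measurableTypeR R -> measurableTypeR R)
    (isMeasurableFun.Build _ _ _ _ _ ms).
move=> mA; apply/esym.
apply: (@lebesgue_measure_unique _ (pushforward mu f : {measure set _ -> \bar R})) => //= _ [[a b]] _ <-.
rewrite /pushforward /=.
have -> : (fun x : R => (s + x)%R) @^-1` `]a, b]%classic = `](a - s)%R, (b - s)%R]%classic.
  by apply/seteqP; split => x /=; rewrite !in_itv/= ltrBlDl lerBrDl.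
rewrite !lebesgue_measure_itv/= !lte_fin ltrD2r; case: ifP => // _.
by rewrite -!EFinD; congr EFin; ring.
Qed.

Lemma ge0_integral_shift (s : R) (f : measurableTypeR R -> \bar R) :
  measurable_fun setT f -> (forall x, 0 <= f x) ->
  \int[mu]_x f (s + x)%R = \int[mu]_x f x.
Proof.
move=> mf f0.
have ms : measurable_fun setT
    ((fun x => (s + x)%R) : measurableTypeR R -> measurableTypeR R).
  exact: measurable_funD.
rewrite -[LHS](@ge0_integral_pushforward _ _ _ _ _ _ ms mu setT f)//.
by apply: eq_measure_integral => A mA _; exact: lebesgue_measure_shift.
Qed.

Lemma normal_pdf_shift (s x : R) :
  normal_pdf 0 1 x = (expR (s * (s + x) - s ^+ 2 / 2) * normal_pdf 0 1 (s + x))%R.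
Proof.
rewrite !normal_pdfE ?oner_neq0// mulrCA; congr (_ * _)%R.
rewrite /normal_fun -expRD; congr expR; rewrite expr1n !subr0; by field.
Qed.

(** The Cameron-Martin formula in dimension one: it moves an expectation under a shifted mean to the
    null law, at the price of an exponential weight. *)
Lemma integral_normal_shift (s : R) (f : measurableTypeR R -> \bar R) :
  measurable_fun setT f -> (forall x, 0 <= f x) ->
  \int[N01]_x f (s + x)%R =
  \int[N01]_x (f x * (expR (s * x - s ^+ 2 / 2))%:E).
Proof.
move=> mf f0.
have me : measurable_fun setT
    (fun x : measurableTypeR R => (expR (s * x - s ^+ 2 / 2))%:E).
  apply/measurable_EFinP; apply: measurableT_comp => //.
  by apply: measurable_funB => //; exact: measurable_funM.
have mpdf : measurable_fun setT (fun x => (normal_pdf (0:R) 1 x)%:E).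
  by apply/measurable_EFinP; exact: measurable_normal_pdf.
rewrite ge0_integral_normal_prob//; last first.
  by apply: (measurableT_comp mf); exact: measurable_funD.
rewrite [RHS]ge0_integral_normal_prob//; last 2 first.
- exact: emeasurable_funM.
- by move=> x; rewrite mule_ge0// lee_fin expR_ge0.
rewrite -(@ge0_integral_shift s (fun x => f x *
    (expR (s * x - s ^+ 2 / 2))%:E * (normal_pdf (0:R) 1 x)%:E)); last 2 first.
- by apply: emeasurable_funM => //; exact: emeasurable_funM.
- by move=> x; rewrite !mule_ge0// lee_fin ?expR_ge0// normal_pdf_ge0.
by apply: eq_integral => x _; rewrite -muleA -EFinM -normal_pdf_shift.
Qed.

Lemma integral_normal_expR (c : R) :
  \int[N01]_x (expR (c * x))%:E = (expR (c ^+ 2 / 2))%:E.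
Proof.
have me (e : R) : measurable_fun setT
    (fun x : measurableTypeR R => (expR (c * x - e))%:E).
  apply/measurable_EFinP; apply: measurableT_comp => //.
  by apply: measurable_funB => //; exact: measurable_funM.
(* Applied to the constant 1, the shift formula says that exp (c x - c^2 / 2) has mean 1. *)
have h := @integral_normal_shift c (cst 1) (measurable_cst _) (fun=> lee01).
transitivity (\int[N01]_x ((expR (c ^+ 2 / 2))%:E * (expR (c * x - c ^+ 2 / 2))%:E)).
  by apply: eq_integral => x _; rewrite -EFinM -expRD; congr (expR _)%:E; ring.
rewrite ge0_integralZl//.
under eq_integral do rewrite -(mul1e (expR _)%:E).
by rewrite -h integral_cst// mul1e [X in _ * X](@probability_setT _ _ _ N01) mule1.
Qed.

Lemma integral_normal_expR_sqr (l s : R) : (0 < 1 + 2 * l)%R ->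
  \int[N01]_x (expR (- l * ((s + x) ^+ 2 - 1)))%:E =
  (expR (l - l * s ^+ 2 / (1 + 2 * l)) / Num.sqrt (1 + 2 * l))%:E.
Proof.
move=> l0; set v := (1 + 2 * l)%R; have v0 : v != 0%R by rewrite gt_eqF.
have sv : (0 < Num.sqrt v)%R by rewrite sqrtr_gt0.
have ml : measurable_fun setT (fun x : measurableTypeR R =>
    (expR (- l * ((s + x) ^+ 2 - 1)))%:E).
  apply/measurable_EFinP; apply: measurableT_comp => //.
  apply: measurable_funM => //; apply: measurable_funB => //.
  by apply: measurable_funX; exact: measurable_funD.
rewrite ge0_integral_normal_prob//.
pose C := (expR (l - l * s ^+ 2 / v) / Num.sqrt v)%R.
(* Completing the square: up to the factor [C], the integrand is the density of the normal law with
   mean [m] and variance 1 / [v]. *)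
pose m := (- (2 * l * s / v))%R; pose sg := (Num.sqrt v)^-1%R.
have sg0 : sg != 0%R by rewrite invr_eq0 gt_eqF.
have sg2 : (sg ^+ 2 = v^-1)%R by rewrite /sg exprVn sqr_sqrtr// ltW.
have E x : (expR (- l * ((s + x) ^+ 2 - 1)) * normal_pdf 0 1 x =
    C * normal_pdf m sg x)%R.
  rewrite !normal_pdfE// ?oner_neq0// /normal_fun sg2 subr0.
  have -> : normal_peak sg = (Num.sqrt v * normal_peak 1)%R.
    rewrite /normal_peak expr1n sg2 mul1r -mulrnAr.
    by rewrite sqrtrM ?invr_ge0 ?ltW// sqrtrV ?ltW// invfM invrK.
  have ec : (expR (- l * ((s + x) ^+ 2 - 1)) * expR (- x ^+ 2 / (1 ^+ 2 *+ 2)) =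
      expR (l - l * s ^+ 2 / v) * expR (- (x - m) ^+ 2 / (v^-1 *+ 2)))%R.
    rewrite -!expRD; congr expR; rewrite /m; rewrite /v in v0 *.
    by field.
  rewrite mulrCA ec /C.
  have sv0 : Num.sqrt v != 0%R by rewrite gt_eqF.
  by field.
under eq_integral do rewrite -EFinM E EFinM.
rewrite ge0_integralZl//.
- by rewrite integral_normal_pdf mule1.
- by apply/measurable_EFinP; exact: measurable_normal_pdf.
- by move=> x _; rewrite lee_fin normal_pdf_ge0.
- by rewrite lee_fin divr_ge0// expR_ge0.
Qed.

End gaussian.

(** * Integrals under product laws *)

Section iid_integrals.
Context d (T : measurableType d) (R : realType) (P : probability T R).
Local Open Scope ereal_scope.

Lemma ge0_integral_iidS n (f : n.+1.-tuple T -> \bar R) :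
  measurable_fun setT f -> (forall x, 0 <= f x) ->
  \int[iid P n.+1]_x f x = \int[P]_x \int[iid P n]_y f [tuple of x :: y].
Proof.
move=> mf f0; rewrite /= ge0_integral_distribution//.
rewrite fubini_tonelli1//; last by move=> x; exact: f0.
by apply: (measurableT_comp mf); exact: measurable_cons_pair.
Qed.

Lemma measurable_prod_tnth n (f : 'I_n -> T -> R) :
  (forall i, measurable_fun setT (f i)) ->
  measurable_fun setT (fun x : n.-tuple T => \prod_(i < n) f i (tnth x i))%R.
Proof.
move=> mf; apply: measurable_prod => i _.
by apply: measurableT_comp => //; exact: measurable_tnth.
Qed.

Lemma integral_iid_prod n (f : 'I_n -> T -> R) (c : 'I_n -> R) :
  (forall i, measurable_fun setT (f i)) -> (forall i x, 0 <= f i x)%R ->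
  (forall i, \int[P]_x (f i x)%:E = (c i)%:E) ->
  \int[iid P n]_x (\prod_(i < n) f i (tnth x i))%:E = (\prod_(i < n) c i)%:E.
Proof.
elim: n f c => [|n IH] f c mf f0 fc.
  rewrite /= integral_dirac//.
    by rewrite diracT mul1e !big_ord0.
  by apply/measurable_EFinP; exact: measurable_prod_tnth.
rewrite ge0_integral_iidS; last 2 first.
- by apply/measurable_EFinP; exact: measurable_prod_tnth.
- by move=> x; rewrite lee_fin prodr_ge0.
have IHn := IH (fun i => f (lift ord0 i)) (fun i => c (lift ord0 i))
  (fun i => mf _) (fun i => f0 _) (fun i => fc _).
transitivity (\int[P]_x ((f ord0 x)%:E * (\prod_(i < n) c (lift ord0 i))%:E)).
  apply: eq_integral => x _.
  rewrite -IHn -ge0_integralZl//.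
  - apply: eq_integral => y _; rewrite big_ord_recl EFinM tnth0; congr (_ * _%:E).
    by apply: eq_bigr => i _; rewrite tnthS.
  - by apply/measurable_EFinP;
      exact: (measurable_prod_tnth (f := fun i => f (lift ord0 i))).
  - by move=> y _; rewrite lee_fin prodr_ge0.
  - by rewrite lee_fin.
rewrite ge0_integralZr//.
- by rewrite fc -EFinM big_ord_recl.
- exact/measurable_EFinP.
- by move=> y _; rewrite lee_fin.
- rewrite -IHn; apply: integral_ge0 => y _; by rewrite lee_fin prodr_ge0.
Qed.

(** Stated for abstract maps [g i] with weights [w i] because it is applied twice: to the entries
    inside a row, then to the rows themselves. *)
Lemma integral_iid_change n (g : 'I_n -> T -> T) (w : 'I_n -> T -> R) :
  (forall i, measurable_fun setT (g i)) ->
  (forall i, measurable_fun setT (w i)) -> (forall i x, 0 <= w i x)%R ->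
  (forall i (h : T -> \bar R), measurable_fun setT h -> (forall x, 0 <= h x) ->
     \int[P]_x h (g i x) = \int[P]_x (h x * (w i x)%:E)) ->
  forall h : n.-tuple T -> \bar R,
  measurable_fun setT h -> (forall x, 0 <= h x) ->
  \int[iid P n]_x h [tuple g i (tnth x i) | i < n] =
  \int[iid P n]_x (h x * (\prod_(i < n) w i (tnth x i))%:E).
Proof.
elim: n g w => [|n IH] g w mg mw w0 gw h mh h0.
  rewrite /= !integral_dirac//.
  - rewrite big_ord0 mule1; congr (_ * h _).
    by rewrite [RHS]tuple0; exact: tuple0.
  - apply: emeasurable_funM => //; apply/measurable_EFinP.
    exact: measurable_prod_tnth.
  - apply: (measurableT_comp mh); apply/measurable_fun_tnthP => -[].
    by [].
pose W y := (\prod_(i < n) w (lift ord0 i) (tnth y i))%R.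
have W0 y : (0 <= W y)%R by rewrite prodr_ge0.
have mW : measurable_fun setT W.
  exact: (measurable_prod_tnth (f := fun i => w (lift ord0 i))).
have mgs : measurable_fun setT (fun x : n.+1.-tuple T => [tuple g i (tnth x i) | i < n.+1]).
  apply/measurable_fun_tnthP => i.
  rewrite (_ : _ \o _ = g i \o (fun x : n.+1.-tuple T => tnth x i)).
    by apply: measurableT_comp => //; exact: measurable_tnth.
  by apply/funext => x /=; rewrite tnth_mktuple.
have mhW : measurable_fun setT (fun z : T * n.-tuple T =>
    h [tuple of z.1 :: z.2] * (W z.2)%:E).
  apply: emeasurable_funM.
    by apply: (measurableT_comp mh); exact: measurable_cons_pair.
  by apply/measurable_EFinP; apply: (measurableT_comp mW).
have mcons x : measurable_fun setT (fun y : n.-tuple T => [tuple of x :: y]).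
  exact: measurable_cons.
rewrite ge0_integral_iidS//; last exact: measurableT_comp.
transitivity (\int[P]_x \int[iid P n]_y
    (h [tuple of g ord0 x :: y] * (W y)%:E)).
  apply: eq_integral => x _.
  rewrite -(IH (fun i => g (lift ord0 i)) (fun i => w (lift ord0 i))
    (fun i => mg _) (fun i => mw _) (fun i => w0 _) (fun i => gw _)
    (fun y => h [tuple of g ord0 x :: y]))//; last exact: measurableT_comp.
  apply: eq_integral => y _; congr h; apply: eq_from_tnth => i.
  rewrite tnth_mktuple; case: (unliftP ord0 i) => [j|] ->.
    by rewrite !tnthS tnth_mktuple.
  by rewrite !tnth0.
have mF := @measurable_fun_fubini_tonelli_F _ _ _ _ _ (iid P n) _ mhW.
(* The change of variable in the first coordinate acts on the partial integral over the others,
   which is measurable by Tonelli's theorem. *)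
rewrite (gw ord0 (fun z => \int[iid P n]_y (h [tuple of z :: y] * (W y)%:E))).
- rewrite ge0_integral_iidS.
  + apply: eq_integral => x _; rewrite -ge0_integralZr//.
    * apply: eq_integral => y _; rewrite -muleA -EFinM; congr (_ * _%:E).
      rewrite big_ord_recl tnth0 mulrC; congr (_ * _)%R.
      by apply: eq_bigr => i _; rewrite tnthS.
    * apply: emeasurable_funM; first exact: measurableT_comp.
      exact/measurable_EFinP.
    * by move=> y _; rewrite mule_ge0// lee_fin.
    * by rewrite lee_fin.
  + apply: emeasurable_funM => //; apply/measurable_EFinP.
    exact: measurable_prod_tnth.
  + by move=> x; rewrite mule_ge0// lee_fin prodr_ge0.
- by apply: mF => x; rewrite mule_ge0// lee_fin.
- by move=> x; apply: integral_ge0 => y _; rewrite mule_ge0// lee_fin.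
Qed.

End iid_integrals.

(** * Products and shifts under the law of the noise matrix *)

Section noise_integrals.
Context {R : realType} {N M : nat}.
Local Notation N01 := (@normal_prob R 0 1).
Local Notation noise := (noise_law R N M).
Local Open Scope ereal_scope.

Lemma measurable_entry i j : measurable_fun setT (fun y : obs R N M => entry y i j).
Proof.
apply: (@measurableT_comp _ _ _ _ _ _ (fun x => tnth x j)).
  exact: measurable_tnth.
exact: measurable_tnth.
Qed.

Lemma measurable_prod_entry (f : 'I_N -> 'I_M -> measurableTypeR R -> R) :
  (forall i j, measurable_fun setT (f i j)) ->
  measurable_fun setT
    (fun y : obs R N M => \prod_(i < N) \prod_(j < M) f i j (entry y i j))%R.
Proof.
move=> mf; apply: measurable_prod => i _; apply: measurable_prod => j _.
exact: (measurableT_comp (mf i j) (measurable_entry i j)).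
Qed.

Lemma integral_noise_prod (f : 'I_N -> 'I_M -> measurableTypeR R -> R) c :
  (forall i j, measurable_fun setT (f i j)) ->
  (forall i j x, 0 <= f i j x)%R ->
  (forall i j, \int[N01]_x (f i j x)%:E = (c i j)%:E) ->
  \int[noise]_y (\prod_(i < N) \prod_(j < M) f i j (entry y i j))%:E =
  (\prod_(i < N) \prod_(j < M) c i j)%:E.
Proof.
move=> mf f0 fc.
apply: (@integral_iid_prod _ _ _ _ _ (fun i r => \prod_(j < M) f i j (tnth r j))%R).
- by move=> i; exact: measurable_prod_tnth.
- by move=> i x; rewrite prodr_ge0.
- by move=> i; exact: integral_iid_prod.
Qed.

Lemma measurable_shift (S : 'M[R]_(N, M)) : measurable_fun setT (@Defs.shift R N M S).
Proof.
apply/measurable_fun_tnthP => i; apply/measurable_fun_tnthP => j.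
rewrite (_ : _ \o _ = fun y => S i j + entry y i j)%R.
  by apply: measurable_funD => //; exact: measurable_entry.
by apply/funext => y /=; rewrite !tnth_mktuple.
Qed.

Lemma shift0_obs (y : obs R N M) : Defs.shift 0 y = y.
Proof.
apply: eq_from_tnth => i; apply: eq_from_tnth => j.
by rewrite !tnth_mktuple mxE add0r.
Qed.

Lemma integral_noise_shift (S : 'M[R]_(N, M)) (h : obs R N M -> \bar R) :
  measurable_fun setT h -> (forall y, 0 <= h y) ->
  \int[noise]_y h (Defs.shift S y) =
  \int[noise]_y (h y * (\prod_(i < N) \prod_(j < M)
     expR (S i j * entry y i j - S i j ^+ 2 / 2))%:E).
Proof.
move=> mh h0.
pose w i j (x : measurableTypeR R) := expR (S i j * x - S i j ^+ 2 / 2).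
have mw i j : measurable_fun setT (w i j).
  apply: measurableT_comp => //.
  by apply: measurable_funB => //; exact: measurable_funM.
apply: (@integral_iid_change _ _ _ _ _
  (fun i (r : M.-tuple (measurableTypeR R)) => [tuple S i j + tnth r j | j < M])%R
  (fun i r => \prod_(j < M) w i j (tnth r j))%R) => //.
- move=> i; apply/measurable_fun_tnthP => j.
  rewrite (_ : _ \o _ = fun y : M.-tuple (measurableTypeR R) => S i j + tnth y j)%R.
    by apply: measurable_funD => //; exact: measurable_tnth.
  by apply/funext => y /=; rewrite !tnth_mktuple.
- by move=> i; exact: measurable_prod_tnth.
- by move=> i x; rewrite prodr_ge0// => j _; exact: expR_ge0.
- move=> i k mk k0.
  apply: (@integral_iid_change _ _ _ _ _
    (fun j (x : measurableTypeR R) => (S i j + x)%R : measurableTypeR R) (w i)) => //.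
  + by move=> j; exact: measurable_funD.
  + by move=> j x; exact: expR_ge0.
  + by move=> j g mg g0; exact: integral_normal_shift.
Qed.

End noise_integrals.

(** * Real inequalities obtained from the mean value theorem *)

Section real_inequalities.
Context {R : realType}.
Implicit Types (x u t w : R).

Lemma derive_mvt (f df : R -> R) (a b : R) : a <= b ->
  (forall x, a <= x <= b -> is_derive x 1 f (df x)) ->
  exists2 c, a <= c <= b & f b - f a = df c * (b - a).
Proof.
move=> ab d.
have [|c] := @MVT_segment R f df a b ab
  (fun x xab => d x (subset_itv_oo_cc xab)).
  by apply: derivable_within_continuous => x /d dx; exact: ex_derive.
by rewrite in_itv/=; exists c.
Qed.

(** The function [f] vanishes at 1 and its derivative is minus half the square of 1 / y - 1, so
    [f w] is nonnegative. With [w = 1 - 2 * l] this controls the chi-square moment generating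
    function. *)
Lemma invr_le_expR w : 0 < w <= 1 -> w^-1 <= expR ((w^-1 - w) / 2).
Proof.
move=> /andP[w0 w1].
pose f (y : R) := ln y + 2^-1 * (y^-1 - y).
pose df (y : R) := y^-1 + 2^-1 * (- y ^- 2 - 1).
have fd y : w <= y <= 1 -> is_derive y 1 f (df y).
  move=> /andP[wy _]; have y0 : 0 < y by exact: lt_le_trans wy.
  have y1 : y != 0 by rewrite gt_eqF.
  have := is_derive1_ln y0; have := @is_deriveV R id y 1 1 y1 _ => /(_ _) dv dl.
  apply: is_derive_eq.
  by rewrite /df scaler1.
have [c /andP[wc c1]] := derive_mvt w1 fd.
have c0 : 0 < c by exact: lt_le_trans wc.
have -> : df c = - (c^-1 - 1) ^+ 2 / 2 by rewrite /df; field; rewrite gt_eqF.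
rewrite {1}/f ln1 invr1 subrr mulr0 add0r => fw.
have f0 : 0 <= f w.
  rewrite -oppr_le0 -sub0r fw mulNr mulNr oppr_le0.
  by rewrite mulr_ge0 ?subr_ge0// divr_ge0// sqr_ge0.
rewrite -[leLHS]lnK ?posrE ?invr_gt0// ler_expR lnV ?posrE//.
by move: f0; rewrite /f; lra.
Qed.

(** By the mean value theorem k is t c^(t - 1) with c between 1 and u; here c^(t - 1) is at most 1
    if c >= 1 and at most 1 / c <= 1 / u0 otherwise. *)
Lemma powR_sub1_slope u0 u t : 0 < u0 <= 1 -> u0 <= u -> 0 < t < 1 ->
  exists2 k, 0 <= k <= t / u0 & u `^ t - 1 = k * (u - 1).
Proof.
move=> /andP[u00 u01] u0u /andP[t0 t1].
have d x : u0 <= x -> is_derive x 1 (@powR R ^~ t) (t * x `^ (t - 1)).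
  by move=> u0x; apply: is_derive1_powR; exact: lt_le_trans u0x.
have slope c : u0 <= c -> 0 <= t * c `^ (t - 1) <= t / u0.
  move=> u0c; have c0 : 0 < c by exact: lt_le_trans u0c.
  apply/andP; split; first by rewrite mulr_ge0 ?powR_ge0// ltW.
  rewrite ler_pM2l//.
  have [c1|/ltW c1] := leP 1 c.
    rewrite (@le_trans _ _ 1)//; last by rewrite invf_ge1.
    by rewrite -[leRHS](powRr0 c); apply: ler_powR => //; lra.
  rewrite (@le_trans _ _ c^-1)//; last by rewrite lef_pV2.
  rewrite -(powR_inv1 (ltW c0)); apply: ger_powR; first by rewrite c0.
  lra.
have [u1|/ltW u1] := leP 1 u.
  have [c /andP[c1 _]] := derive_mvt u1 (fun x h => d x (le_trans u01 (elimTF andP h).1)).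
  rewrite powR1 => ->; exists (t * c `^ (t - 1)) => //.
  exact/slope/(le_trans u01).
have [c /andP[uc _]] := derive_mvt u1 (fun x h => d x (le_trans u0u (elimTF andP h).1)).
rewrite powR1 => h; exists (t * c `^ (t - 1)).
  exact/slope/(le_trans u0u).
by rewrite -opprB h -mulrN opprB.
Qed.

(** A Taylor bound at 1: beyond u0 the second derivative (1 + t) t u^(t - 1) is at most (1 + t) t /
    u0. It reduces the moment of order 1 + t of a likelihood ratio to its first two moments, which
    are explicit. *)
Lemma powR_le_quadratic u0 u t : 0 < u0 <= 1 -> u0 <= u -> 0 < t < 1 ->
  u `^ (1 + t) <= 1 + (1 + t) * (u - 1) + (1 + t) * t / 2 / u0 * (u - 1) ^+ 2.
Proof.
move=> /[dup] u0P /andP[u00 u01] u0u /[dup] tP /andP[t0 t1].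
pose g (x : R) := (1 + t) * x + (1 + t) * t / 2 / u0 * (x - 1) ^+ 2 - x `^ (1 + t).
pose dg (x : R) := (1 + t) * ((t / u0) * (x - 1) - (x `^ t - 1)).
have d x : u0 <= x -> is_derive x 1 g (dg x).
  move=> u0x; have x0 : 0 < x by exact: lt_le_trans u0x.
  have := is_derive1_powR (1 + t) x0.
  rewrite [1 + t - 1]addrC addKr => dp.
  apply: is_derive_eq.
  rewrite /dg /GRing.scale/=; lra.
(* The derivative of [g] has the sign of x - 1, so that [g] is minimal at 1. *)
have sg x : u0 <= x -> exists2 k, 0 <= k & dg x = k * (x - 1).
  move=> u0x; have [k /andP[k0 kt] e] := powR_sub1_slope u0P u0x tP.
  exists ((1 + t) * (t / u0 - k)); first by rewrite mulr_ge0 ?subr_ge0//; lra.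
  by rewrite /dg e; ring.
suff : g 1 <= g u by rewrite /g powR1 subrr; lra.
have [u1|/ltW u1] := leP 1 u.
  have [c /andP[c1 _]] := derive_mvt u1 (fun x h => d x (le_trans u01 (elimTF andP h).1)).
  have [k k0 ->] := sg c (le_trans u01 c1).
  by rewrite -subr_ge0 => ->; rewrite !mulr_ge0 ?subr_ge0.
have [c /andP[uc c1]] := derive_mvt u1 (fun x h => d x (le_trans u0u (elimTF andP h).1)).
have [k k0 ->] := sg c (le_trans u0u uc).
rewrite -subr_le0 => ->; rewrite -mulrA mulr_ge0_le0// mulr_le0_ge0 ?subr_ge0 ?subr_le0//.
Qed.

End real_inequalities.

(** * The likelihood ratio of a single cell *)

Section likelihood_pixel.
Context {R : realType}.
Local Notation N01 := (@normal_prob R 0 1).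
Implicit Types (a t : R).

Definition coshR (x : R) : R := (expR x + expR (- x)) / 2.

Lemma expR_addN_ge2 (x : R) : 2 <= expR x + expR (- x).
Proof.
have e0 := expR_gt0 x; rewrite expRN.
have : 0 <= (expR x - 1) ^+ 2 / expR x by rewrite divr_ge0 ?sqr_ge0// ltW.
have -> : (expR x - 1) ^+ 2 / expR x = expR x + (expR x)^-1 - 2.
  by field; rewrite gt_eqF.
by rewrite subr_ge0.
Qed.

Lemma coshR_ge1 x : 1 <= coshR x.
Proof. by rewrite /coshR ler_pdivlMr// mul1r expR_addN_ge2. Qed.

Lemma coshR_sub1_le x : 0 <= x -> coshR x - 1 <= x ^+ 2 / 2 * expR x.
Proof.
move=> x0; pose e := expR (x / 2); pose f := expR (- (x / 2)).
have ef : e * f = 1 by rewrite /e /f expRN divff// gt_eqF// expR_gt0.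
have e0 : 0 <= e by exact: expR_ge0.
have f0 : 0 <= f by exact: expR_ge0.
have -> : expR x = e ^+ 2 by rewrite -expRM_natl mulrC divfK.
have -> : coshR x - 1 = (e - f) ^+ 2 / 2.
  rewrite /coshR; have -> : expR x = e ^+ 2 by rewrite -expRM_natl mulrC divfK.
  have -> : expR (- x) = f ^+ 2 by rewrite -expRM_natl mulrN mulrC divfK.
  have -> : (e - f) ^+ 2 = e ^+ 2 + f ^+ 2 - 2 * (e * f) by ring.
  by rewrite ef; field.
(* Since f^2 = exp (- x) >= 1 - x and e f = 1, multiplying by e gives e (1 - x) <= f. *)
have h : e - f <= x * e.
  have : 1 - x <= f ^+ 2.
    have := expR_ge1Dx (- x).
    by rewrite (_ : expR (- x) = f ^+ 2)// -expRM_natl mulrN mulrC divfK.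
  move=> h; have : e * (1 - x) <= e * f ^+ 2 by rewrite ler_wpM2l.
  by rewrite expr2 mulrA ef mul1r; lra.
have h0 : 0 <= e - f by rewrite subr_ge0 ler_expR; lra.
by rewrite [leRHS]mulrAC ler_pM2r ?invr_gt0// -exprMn ler_sqr// nnegrE// mulr_ge0.
Qed.

(* Density, with respect to N(0,1), of the even mixture of N(a,1) and N(-a,1). *)
Definition pixel a (y : measurableTypeR R) : R :=
  expR (- (a ^+ 2 / 2)) * coshR (a * y).

(** This uniform lower bound plays the part of [u0] in [powR_le_quadratic]. *)
Lemma pixel_ge a y : expR (- (a ^+ 2 / 2)) <= pixel a y.
Proof. by rewrite ler_peMr ?expR_ge0 ?coshR_ge1. Qed.

Lemma pixel_gt0 a y : 0 < pixel a y.
Proof. exact: lt_le_trans (expR_gt0 _) (pixel_ge _ _). Qed.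

Lemma measurable_pixel a : measurable_fun setT (pixel a).
Proof.
have me (c : R) : measurable_fun setT (fun y : measurableTypeR R => expR (c * y)).
  by apply: measurableT_comp => //; exact: measurable_funM.
apply: measurable_funM => //; apply: measurable_funM => //.
apply: measurable_funD => //; under eq_fun do rewrite -mulNr; exact: me.
Qed.

Local Open Scope ereal_scope.

Lemma ge0_integral_lin2 d (T : measurableType d) (P : probability T R)
  (f g : T -> R) (x y b c : R) :
  measurable_fun setT f -> measurable_fun setT g ->
  (forall z, 0 <= f z)%R -> (forall z, 0 <= g z)%R -> (0 <= x)%R -> (0 <= y)%R ->
  \int[P]_z (f z)%:E = b%:E -> \int[P]_z (g z)%:E = c%:E ->
  \int[P]_z (x * f z + y * g z)%:E = (x * b + y * c)%:E.
Proof.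
move=> mf mg f0 g0 x0 y0 fb gc.
under eq_integral do rewrite EFinD.
rewrite ge0_integralD//; first last.
- by apply/measurable_EFinP; exact: measurable_funM.
- by move=> z _; rewrite lee_fin mulr_ge0.
- by apply/measurable_EFinP; exact: measurable_funM.
- by move=> z _; rewrite lee_fin mulr_ge0.
have Zl (h : T -> R) k e : measurable_fun setT h -> (forall z, 0 <= h z)%R ->
    (0 <= k)%R -> \int[P]_z (h z)%:E = e%:E -> \int[P]_z (k * h z)%:E = (k * e)%:E.
  move=> mh h0 k0 he; under eq_integral do rewrite EFinM.
  rewrite ge0_integralZl ?he//; first exact/measurable_EFinP.
  by move=> z _; rewrite lee_fin.
by rewrite (Zl f x b)// (Zl g y c).
Qed.

(** Subtracted terms are integrated by moving them to the other side, so that only nonnegative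
    integrands with known finite integrals occur. *)
Lemma ge0_integral_subr d (T : measurableType d) (P : probability T R)
  (f g h : T -> R) (b c : R) :
  measurable_fun setT f -> measurable_fun setT g ->
  (forall z, 0 <= f z)%R -> (forall z, 0 <= g z)%R ->
  (forall z, f z + g z = h z)%R ->
  \int[P]_z (g z)%:E = b%:E -> \int[P]_z (h z)%:E = c%:E ->
  \int[P]_z (f z)%:E = (c - b)%:E.
Proof.
move=> mf mg f0 g0 fgh gb hc.
have : \int[P]_z (f z)%:E + b%:E = c%:E.
  rewrite -gb -hc -ge0_integralD//.
  - by apply: eq_integral => z _; rewrite -EFinD fgh.
  - by move=> z _; rewrite lee_fin.
  - exact/measurable_EFinP.
  - by move=> z _; rewrite lee_fin.
  - exact/measurable_EFinP.
by rewrite EFinB => <-; rewrite addeK.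
Qed.

Lemma measurable_expR_lin (c : R) :
  measurable_fun setT (fun y : measurableTypeR R => expR (c * y)).
Proof. by apply: measurableT_comp => //; exact: measurable_funM. Qed.

Lemma integral_pixel a : \int[N01]_y (pixel a y)%:E = 1.
Proof.
pose k := (expR (- (a ^+ 2 / 2)) / 2)%R.
have k0 : (0 <= k)%R by rewrite divr_ge0 ?expR_ge0.
transitivity (\int[N01]_y (k * expR (a * y) + k * expR (- a * y))%:E).
  by apply: eq_integral => y _; congr EFin; rewrite /pixel /coshR /k mulNr; field.
rewrite (ge0_integral_lin2 (measurable_expR_lin _) (measurable_expR_lin _)
  _ _ k0 k0 (integral_normal_expR _) (integral_normal_expR _)).
- congr EFin; rewrite sqrrN /k; set e := (a ^+ 2 / 2)%R.
  by rewrite -[RHS](expRxMexpNx_1 e); field.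
- by move=> z; exact: expR_ge0.
- by move=> z; exact: expR_ge0.
Qed.

(** For signs e, e' the product of the likelihood ratios of N(e a, 1) and N(e' a, 1) has mean exp (e
    e' a^2); averaging over independent signs gives the hyperbolic cosine. The proof expands the
    square directly. *)
Lemma integral_pixel_sqr a :
  \int[N01]_y (pixel a y ^+ 2)%:E = (coshR (a ^+ 2))%:E.
Proof.
pose k := (expR (- a ^+ 2) / 4)%R.
have k0 : (0 <= k)%R by rewrite divr_ge0 ?expR_ge0.
transitivity (\int[N01]_y
   (1 * (k * expR (2 * a * y) + k * expR (- (2 * a) * y)) + (2 * k) * 1)%:E).
  apply: eq_integral => y _; congr EFin; rewrite /pixel /coshR /k.
  have -> : expR (- a ^+ 2) = (expR (- (a ^+ 2 / 2)) ^+ 2)%R.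
    by rewrite -expRM_natl; congr expR; field.
  have -> : expR (2 * a * y) = (expR (a * y) ^+ 2)%R by rewrite -expRM_natl mulrA.
  have -> : expR (- (2 * a) * y) = (expR (- (a * y)) ^+ 2)%R.
    by rewrite -expRM_natl; congr expR; ring.
  have := expRxMexpNx_1 (a * y); set A := expR _; set B := expR _ => AB.
  set E := expR _.
  rewrite (_ : 2 * _ * 1 = 2 * (E ^+ 2 / 4) * (A * B))%R; last by rewrite AB.
  by field.
rewrite (@ge0_integral_lin2 _ _ _ _ _ _ _ (k * expR ((2 * a) ^+ 2 / 2) + k * expR ((- (2 * a)) ^+ 2 / 2)) 1)%R => //.
- congr EFin; rewrite sqrrN /k /coshR.
  have -> : expR ((2 * a) ^+ 2 / 2) = (expR (a ^+ 2) ^+ 2)%R.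
    by rewrite -expRM_natl; congr expR; field.
  have e0 : expR (a ^+ 2) != 0%R by rewrite gt_eqF ?expR_gt0.
  by rewrite !expRN; field.
- by apply: measurable_funD; apply: measurable_funM => //; exact: measurable_expR_lin.
- by move=> z; rewrite addr_ge0// mulr_ge0// expR_ge0.
- by rewrite mulr_ge0.
- apply: (ge0_integral_lin2 (measurable_expR_lin _) (measurable_expR_lin _)
  _ _ k0 k0 (integral_normal_expR _) (integral_normal_expR _)).
  + by move=> z; exact: expR_ge0.
  + by move=> z; exact: expR_ge0.
- by rewrite integral_cst// mul1e [LHS](@probability_setT _ _ _ N01).
Qed.

(** The right-hand side of [powR_le_quadratic] at [u = pixel a y], with the bound of [pixel_ge] as
    [u0]. *)
Definition pixel_quad a t (y : measurableTypeR R) : R :=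
  1 + (1 + t) * (pixel a y - 1) +
  (1 + t) * t / 2 / expR (- (a ^+ 2 / 2)) * (pixel a y - 1) ^+ 2.

Lemma pixel_powR_le a t y : (0 < t < 1)%R ->
  (pixel a y `^ (1 + t) <= pixel_quad a t y)%R.
Proof.
move=> t01; apply: powR_le_quadratic => //; last exact: pixel_ge.
by rewrite expR_gt0/= expR_le1 oppr_le0 divr_ge0// sqr_ge0.
Qed.

Lemma pixel_quad_ge0 a t y : (0 < t < 1)%R -> (0 <= pixel_quad a t y)%R.
Proof. by move=> /(pixel_powR_le a y); apply: le_trans; exact: powR_ge0. Qed.

Lemma measurable_pixel_quad a t : measurable_fun setT (pixel_quad a t).
Proof.
have mp : measurable_fun setT (fun y => pixel a y - 1)%R.
  by apply: measurable_funB => //; exact: measurable_pixel.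
apply: measurable_funD; last first.
  by apply: measurable_funM => //; exact: measurable_funX.
by apply: measurable_funD => //; exact: measurable_funM.
Qed.

Lemma integral_pixel_quad a t : (0 < t < 1)%R ->
  \int[N01]_y (pixel_quad a t y)%:E =
  (1 + (1 + t) * t / 2 / expR (- (a ^+ 2 / 2)) * (coshR (a ^+ 2) - 1))%:E.
Proof.
move=> t01; set K := ((1 + t) * t / 2 / expR (- (a ^+ 2 / 2)))%R.
have /andP[t0 t1] := t01.
have K0 : (0 <= K)%R.
  by rewrite /K !divr_ge0 ?expR_ge0// mulr_ge0//; lra.
have mp := measurable_pixel a.
have mp1 : measurable_fun setT (fun y => pixel a y - 1)%R by exact: measurable_funB.
have mp2 : measurable_fun setT (fun y => pixel a y ^+ 2)%R by exact: measurable_funX.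
have m1 : measurable_fun setT (fun _ : measurableTypeR R => 1%R : R) by [].
have p0 y : (0 <= pixel a y)%R by exact/ltW/pixel_gt0.
have i1 (c : R) : (0 <= c)%R -> \int[N01]_y (c%:E) = c%:E.
  by move=> c0; rewrite integral_cst// [X in _ * X](@probability_setT _ _ _ N01) mule1.
have isq : \int[N01]_y ((pixel a y - 1) ^+ 2)%:E = (coshR (a ^+ 2) - 1)%:E.
  have -> : (coshR (a ^+ 2) - 1 = (1 * coshR (a ^+ 2) + 1 * 1) - (1 * 1 + 1 * 1))%R.
    by ring.
  apply: (@ge0_integral_subr _ _ _ _ (fun y => 1 * pixel a y + 1 * pixel a y)%R
    (fun y => 1 * pixel a y ^+ 2 + 1 * 1)%R).
  - exact: measurable_funX.
  - by apply: measurable_funD; exact: measurable_funM.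
  - by move=> z; rewrite sqr_ge0.
  - by move=> z; rewrite !mul1r addr_ge0.
  - by move=> z; ring.
  - by apply: ge0_integral_lin2 => //; exact: integral_pixel.
  - apply: ge0_integral_lin2 => //; [by move=> z; rewrite sqr_ge0| |exact: i1].
    exact: integral_pixel_sqr.
(* Adding the constant [t] to [pixel_quad] removes its negative part: the sum is (1 + t) [pixel] +
   [K] ([pixel] - 1)^2. *)
have -> : (1 + K * (coshR (a ^+ 2) - 1) =
    ((1 + t) * 1 + K * (coshR (a ^+ 2) - 1)) - t)%R by ring.
apply: (@ge0_integral_subr _ _ _ _ (fun y => t)
    (fun y => (1 + t) * pixel a y + K * (pixel a y - 1) ^+ 2)%R).
- exact: measurable_pixel_quad.
- by [].
- by move=> z; exact: pixel_quad_ge0.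
- by move=> z; exact: ltW.
- by move=> z; rewrite /pixel_quad -/K; ring.
- by apply: i1; exact: ltW.
- apply: ge0_integral_lin2 => //.
  + exact: measurable_funX.
  + by move=> z; rewrite sqr_ge0.
  + by lra.
  + exact: integral_pixel.
Qed.

(** The variance of [pixel] is a^4 / 2 to leading order, whence the coefficient t (1 + t) / 4. The
    factor exp (2 a^2) absorbs all corrections and is close to 1 when a is small. *)
Lemma pixel_quad_mean_le a t : (0 < t < 1)%R ->
  (1 + (1 + t) * t / 2 / expR (- (a ^+ 2 / 2)) * (coshR (a ^+ 2) - 1) <=
   expR (t * (1 + t) / 4 * a ^+ 4 * expR (2 * a ^+ 2)))%R.
Proof.
move=> /andP[t0 t1]; apply: le_trans (expR_ge1Dx _); rewrite lerD2l.
have a0 : (0 <= a ^+ 2)%R by exact: sqr_ge0.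
have h := coshR_sub1_le a0.
rewrite expRN invrK.
apply: (@le_trans _ _ ((1 + t) * t / 2 * expR (a ^+ 2) * ((a ^+ 2) ^+ 2 / 2 * expR (a ^+ 2)))%R).
  apply: ler_pM => //.
  - by rewrite mulr_ge0 ?expR_ge0// divr_ge0// mulr_ge0//; lra.
  - by rewrite subr_ge0 coshR_ge1.
  - rewrite ler_wpM2l//; first by rewrite divr_ge0// mulr_ge0//; lra.
    by rewrite ler_expR; lra.
have -> : expR (2 * a ^+ 2) = (expR (a ^+ 2) * expR (a ^+ 2))%R.
  by rewrite -expRD; congr expR; ring.
by rewrite le_eqVlt; apply/orP; left; apply/eqP; field.
Qed.

End likelihood_pixel.

Lemma measurable_natr_bool d (T : measurableType d) (R : realType) (b : T -> bool) :
  measurable_fun setT b -> measurable_fun setT (fun x => (b x)%:R : R).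
Proof.
move=> mb; rewrite (_ : (fun _ => _) = (fun x => if b x then 1 else 0 : R)).
  exact: measurable_fun_ifT.
by apply/funext => x; case: (b x).
Qed.

(** * Likelihood ratios of sets of cells *)

Section likelihood.
Context {R : realType} {N M : nat}.
Local Notation N01 := (@normal_prob R 0 1).
Local Notation noise := (noise_law R N M).
Local Notation cell := ('I_N * 'I_M)%type.
Implicit Types (V : {set cell}) (y : obs R N M) (a : R).
Local Open Scope ereal_scope.

Lemma prod_cellE (F : cell -> R) :
  (\prod_c F c = \prod_(i < N) \prod_(j < M) F (i, j))%R.
Proof. by rewrite pair_bigA /=; apply: eq_bigr => -[]. Qed.

Lemma measurable_prod_cell (f : cell -> measurableTypeR R -> R) :
  (forall c, measurable_fun setT (f c)) ->
  measurable_fun setT (fun y : obs R N M => \prod_c f c (entry y c.1 c.2))%R.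
Proof.
move=> mf; under eq_fun do rewrite prod_cellE.
exact: (measurable_prod_entry (fun i j => mf (i, j))).
Qed.

Lemma integral_prod_cell (f : cell -> measurableTypeR R -> R) (k : cell -> R) :
  (forall c, measurable_fun setT (f c)) -> (forall c x, 0 <= f c x)%R ->
  (forall c, \int[N01]_x (f c x)%:E = (k c)%:E) ->
  \int[noise]_y (\prod_c f c (entry y c.1 c.2))%:E = (\prod_c k c)%:E.
Proof.
move=> mf f0 fk; under eq_integral do rewrite prod_cellE.
rewrite [in RHS]prod_cellE.
exact: (integral_noise_prod (fun i j => mf (i, j)) (fun i j => f0 (i, j))
  (fun i j => fk (i, j))).
Qed.

Definition lik a V y : R := \prod_(c in V) pixel a (entry y c.1 c.2).

Lemma lik_gt0 a V y : (0 < lik a V y)%R.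
Proof. by apply: prodr_gt0 => c _; exact: pixel_gt0. Qed.

Lemma likE a V y :
  (lik a V y = \prod_c (if c \in V then pixel a (entry y c.1 c.2) else 1))%R.
Proof. exact: big_mkcond. Qed.

Lemma measurable_lik a V : measurable_fun setT (lik a V).
Proof.
have -> : lik a V = (fun y => \prod_c (if c \in V then pixel a (entry y c.1 c.2) else 1))%R.
  by apply/funext => y; exact: likE.
apply: (measurable_prod_cell (f := fun c x => if c \in V then pixel a x else 1%R)).
by move=> c; case: (c \in V) => //; exact: measurable_pixel.
Qed.

Lemma integral_normal1 : \int[N01]_y 1 = 1.
Proof. by rewrite integral_cst// mul1e [LHS](@probability_setT _ _ _ N01). Qed.

Lemma integral_lik a V : \int[noise]_y (lik a V y)%:E = 1.
Proof.
under eq_integral do rewrite likE.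
rewrite (integral_prod_cell (f := fun c x => if c \in V then pixel a x else 1%R)
  (k := fun=> 1%R)).
- by rewrite big1_eq.
- by move=> c; case: (c \in V) => //; exact: measurable_pixel.
- by move=> c x; case: ifP => // _; exact/ltW/pixel_gt0.
- by move=> c; case: (c \in V); [exact: integral_pixel|exact: integral_normal1].
Qed.

(** This isolates the likelihood ratio of the overlap, on which the truncation acts; the factor of
    the union integrates to 1. *)
Lemma lik_mulIU a V W y :
  (lik a V y * lik a W y = lik a (V :&: W) y * lik a (V :|: W) y)%R.
Proof.
rewrite !likE -!big_split/=; apply: eq_bigr => c _; rewrite !inE.
by case: (c \in V); case: (c \in W); rewrite /= ?mul1r ?mulr1.
Qed.

Lemma integral_lik_mul a V W :
  \int[noise]_y (lik a V y * lik a W y)%:E = (coshR (a ^+ 2) ^+ #|V :&: W|)%:E.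
Proof.
pose f (c : cell) (x : measurableTypeR R) : R :=
  if c \in V :&: W then (pixel a x ^+ 2)%R else
  if c \in V :|: W then pixel a x else 1%R.
transitivity (\int[noise]_y (\prod_c f c (entry y c.1 c.2))%:E).
  apply: eq_integral => y _; congr EFin.
  rewrite !likE -big_split/=; apply: eq_bigr => c _; rewrite /f !inE.
  by case: (c \in V); case: (c \in W); rewrite /= ?mul1r ?mulr1.
rewrite (integral_prod_cell
  (k := fun c => if c \in V :&: W then coshR (a ^+ 2) else 1%R)).
- by rewrite -big_mkcond/= prodr_const.
- move=> c; rewrite /f; case: (c \in V :&: W); last first.
    by case: (c \in V :|: W) => //; exact: measurable_pixel.
  by apply: measurable_funX; exact: measurable_pixel.
- by move=> c x; rewrite /f; case: ifP => _; rewrite ?sqr_ge0//; case: ifP => // _; exact/ltW/pixel_gt0.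
- move=> c; rewrite /f; case: (c \in V :&: W); first exact: integral_pixel_sqr.
  by case: (c \in V :|: W); [exact: integral_pixel|exact: integral_normal1].
Qed.

Lemma powR_prod (I : finType) (P : pred I) (F : I -> R) (t : R) :
  (forall i, 0 <= F i)%R ->
  ((\prod_(i | P i) F i) `^ t = \prod_(i | P i) (F i `^ t))%R.
Proof.
move=> F0.
suff [] : (0 <= \prod_(i | P i) F i /\
  (\prod_(i | P i) F i) `^ t = \prod_(i | P i) (F i `^ t))%R by [].
apply: (big_ind2 (fun x y : R => 0 <= x /\ x `^ t = y)%R) => //.
- by rewrite powR1.
- by move=> x1 x2 y1 y2 [x10 <-] [y10 <-]; rewrite mulr_ge0// powRM.
Qed.

(** Markov's inequality for the power t of [lik a V] under the law with density [lik a C]. As V lies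
    in C, this involves the null moment of order 1 + t of [lik a V], and the cells of C outside V
    integrate to 1. *)
Lemma integral_lik_gt a V (C : {set cell}) (t T : R) : (0 < t < 1)%R -> V \subset C ->
  \int[noise]_y (lik a C y * (expR T < lik a V y)%R%:R)%:E <=
  (expR (- (t * T)) * expR (t * (1 + t) / 4 * a ^+ 4 * expR (2 * a ^+ 2)) ^+ #|V|)%:E.
Proof.
move=> t01 VC; have /andP[t0 t1] := t01.
pose f (c : cell) (x : measurableTypeR R) : R :=
  if c \in V then pixel_quad a t x else
  if c \in C then pixel a x else 1%R.
pose K := (1 + (1 + t) * t / 2 / expR (- (a ^+ 2 / 2)) * (coshR (a ^+ 2) - 1))%R.
have mf c : measurable_fun setT (f c).
  rewrite /f; case: (c \in V); first exact: measurable_pixel_quad.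
  by case: (c \in C) => //; exact: measurable_pixel.
have f0 c x : (0 <= f c x)%R.
  rewrite /f; case: ifP => _; first exact: pixel_quad_ge0.
  by case: ifP => // _; exact/ltW/pixel_gt0.
have intf : \int[noise]_y (\prod_c f c (entry y c.1 c.2))%:E = (K ^+ #|V|)%:E.
  rewrite (integral_prod_cell (k := fun c => if c \in V then K else 1%R))//.
    by rewrite -big_mkcond/= prodr_const.
  move=> c; rewrite /f; case: (c \in V); first exact: integral_pixel_quad.
  by case: (c \in C); [exact: integral_pixel|exact: integral_normal1].
have ptw y : (lik a C y * (expR T < lik a V y)%R%:R <=
    expR (- (t * T)) * \prod_c f c (entry y c.1 c.2))%R.
  have fE : (\prod_c f c (entry y c.1 c.2) =
     lik a (C :\: V) y * \prod_(c in V) pixel_quad a t (entry y c.1 c.2))%R.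
    rewrite likE [X in (_ * X)%R]big_mkcond -big_split/=; apply: eq_bigr => c _.
    by rewrite /f !inE; case: (c \in V); rewrite /= ?mul1r ?mulr1.
  have CE : lik a C y = (lik a (C :\: V) y * lik a V y)%R.
    rewrite !likE -big_split/=; apply: eq_bigr => c _; rewrite !inE.
    have := fintype.subsetP VC c; case: (c \in V); rewrite /= ?mul1r ?mulr1// => -> //.
  rewrite fE CE; have l0 := lik_gt0 a (C :\: V) y.
  have q0 : (0 <= \prod_(c in V) pixel_quad a t (entry y c.1 c.2))%R.
    by apply: prodr_ge0 => c _; exact: pixel_quad_ge0.
  have [Tl|_] := ltP; last first.
    by rewrite mulr0 mulr_ge0 ?expR_ge0// mulr_ge0// ltW.
  rewrite mulr1 mulrCA ler_pM2l//.
  rewrite expRN mulrC ler_pdivlMr ?expR_gt0//.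
  apply: (@le_trans _ _ (lik a V y * lik a V y `^ t)%R).
    rewrite ler_pM2l ?lik_gt0//.
    rewrite mulrC expRM.
    by rewrite ge0_ler_powR ?ltW// nnegrE ?expR_ge0// ltW ?lik_gt0.
  rewrite -{1}(powRr1 (ltW (lik_gt0 a V y))) -powRD; last first.
    by rewrite gt_eqF// ltr_wpDl.
  rewrite powR_prod; last by move=> c; exact/ltW/pixel_gt0.
  by apply: ler_prod => c _; rewrite powR_ge0 pixel_powR_le.
apply: (@le_trans _ _ (\int[noise]_y (expR (- (t * T)) * \prod_c f c (entry y c.1 c.2))%:E)).
  apply: ge0_le_integral => //.
  - by move=> y _; rewrite lee_fin mulr_ge0// ltW ?lik_gt0.
  - apply/measurable_EFinP; apply: measurable_funM; first exact: measurable_lik.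
    apply: measurable_natr_bool; apply: measurable_fun_ltr => //.
    exact: measurable_lik.
  - apply/measurable_EFinP; apply: measurable_funM => //.
    exact: measurable_prod_cell.
  - by move=> y _; rewrite lee_fin.
under eq_integral do rewrite EFinM.
rewrite ge0_integralZl//.
- rewrite intf -EFinM lee_fin ler_pM2l ?expR_gt0// lerXn2r// ?nnegrE ?expR_ge0//.
    by rewrite addr_ge0// mulr_ge0 ?subr_ge0 ?coshR_ge1// !divr_ge0 ?expR_ge0// mulr_ge0//; lra.
  exact: pixel_quad_mean_le.
- by apply/measurable_EFinP; exact: measurable_prod_cell.
- by move=> y _; rewrite lee_fin prodr_ge0.
Qed.

End likelihood.

(** * Uniform averages over subsets of given size *)

Section subset_average.
Context {R : realType} {N : nat}.
Implicit Types (A B J : {set 'I_N}) (n : nat).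

Definition avg n (F : {set 'I_N} -> R) : R :=
  'C(N, n)%:R^-1 * \sum_(B : {set 'I_N} | #|B| == n) F B.

Lemma avg_cst n (c : R) : (n <= N)%N -> avg n (fun=> c) = c.
Proof.
move=> nN; rewrite /avg sumr_const -cardsE card_draws card_ord -[c *+ _]mulr_natl mulKf//.
by rewrite pnatr_eq0 -lt0n bin_gt0.
Qed.

Lemma avgD n F G : avg n (fun B => F B + G B) = avg n F + avg n G.
Proof. by rewrite /avg big_split mulrDr. Qed.

Lemma avgZ n c F : avg n (fun B => c * F B) = c * avg n F.
Proof. by rewrite /avg -mulr_sumr mulrCA. Qed.

Lemma le_avg n F G : (forall B, #|B| = n -> F B <= G B) -> avg n F <= avg n G.
Proof.
move=> FG; rewrite /avg ler_wpM2l ?invr_ge0//.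
by apply: ler_sum => B /eqP/FG.
Qed.

Lemma avg_ge0 n F : (forall B, 0 <= F B) -> 0 <= avg n F.
Proof. by move=> F0; rewrite mulr_ge0 ?invr_ge0// sumr_ge0. Qed.

(** A random n-subset contains a given j-set with a probability that is a product of factors (n - i)
    / (N - i), each at most n / N. *)
Lemma bin_sub_le j n : (j <= n)%N -> (n <= N)%N ->
  ('C(N - j, n - j) * N ^ j <= 'C(N, n) * n ^ j)%N.
Proof.
elim: j => [|j IH] jn nN; first by rewrite !subn0.
have {IH}IH := IH (ltnW jn) nN.
have jN := leq_trans jn nN.
have e : ((N - j) * 'C(N - j.+1, n - j.+1) = (n - j) * 'C(N - j, n - j))%N.
  have := mul_bin_diag (N - j) (n - j).-1.
  by rewrite !subnS prednK// subn_gt0.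
have h : (N * (n - j) <= n * (N - j))%N.
  by rewrite !mulnBr mulnC leq_sub2l// leq_mul.
rewrite -(leq_pmul2l (m := N - j)) ?subn_gt0//.
rewrite mulnA e expnS expnS.
apply: (@leq_trans (N * (n - j) * ('C(N - j, n - j) * N ^ j))%N).
  by apply: eq_leq; nia.
apply: (@leq_trans (n * (N - j) * ('C(N, n) * n ^ j))%N); first exact: leq_mul.
by apply: eq_leq; nia.
Qed.

Lemma card_supersets J n :
  #|[set B : {set 'I_N} | (#|B| == n) && (J \subset B)]%SET| =
  if (#|J| <= n)%N then 'C(N - #|J|, n - #|J|) else 0%N.
Proof.
case: leqP => [Jn|nJ]; last first.
  apply: eq_card0 => B; rewrite !inE; apply/negP => /andP[/eqP Bn JB].
  by move: (subset_leq_card JB); rewrite Bn leqNgt nJ.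
have -> : (N - #|J|)%N = #|~: J| by have := cardsC J; rewrite card_ord; lia.
rewrite -cards_draws.
(* Supersets of [J] correspond to subsets [D] of its complement through [J :|: D]. *)
rewrite -[RHS](card_in_imset (f := fun D => J :|: D)).
  apply: eq_card => B; rewrite !inE; apply/andP/imsetP=> [[/eqP Bn JB]|[D + ->]].
    exists (B :\: J); last by rewrite finset.setUC finset.setDE finset.setUIl [~: J :|: J]finset.setUC finset.setUCr finset.setIT; apply/esym/finset.setUidPl.
    by rewrite !inE cardsD (finset.setIidPr JB) Bn eqxx andbT finset.subsetDr.
  rewrite !inE => /andP[DJ /eqP Dn]; split; last exact: finset.subsetUl.
  rewrite cardsU Dn (_ : J :&: D = finset.set0).
    by rewrite cards0 subn0 subnKC.
  by apply/setP => x; rewrite !inE; apply/negP => /andP[xJ /(fintype.subsetP DJ)]; rewrite inE xJ.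
move=> D1 D2; rewrite !inE => /andP[D1J _] /andP[D2J _] e.
have k (D : {set 'I_N}) : D \subset ~: J -> (J :|: D) :\: J = D.
  by move=> DJ; rewrite finset.setDUl finset.setDv finset.set0U finset.setDE; apply/finset.setIidPl.
by rewrite -(k D1)// e k.
Qed.

Lemma expr1D_card (u : R) J :
  (1 + u) ^+ #|J| = \sum_(K : {set 'I_N} | K \subset J) u ^+ #|K|.
Proof.
transitivity (\prod_(i < N) ((if i \in J then u else 0) + 1)).
  rewrite -prodr_const big_mkcond/=; apply: eq_bigr => i _.
  by case: ifP => _; rewrite ?add0r// addrC.
rewrite bigA_distr [RHS]big_mkcond/=; apply: eq_bigr => K _.
case: ifPn => KJ.
  rewrite -prodr_const [RHS]big_mkcond/=; apply: eq_bigr => i _.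
  by case: ifP => // iK; rewrite (fintype.subsetP KJ).
move/fintype.subsetPn : KJ => [i iK iJ].
by rewrite (bigD1 i)//= iK (negbTE iJ) mul0r.
Qed.

(** The comparison of the hypergeometric law with the binomial one: (1 + u)^|A cap B| is expanded
    over the subsets K of A cap B, each K lies in the random B with probability at most (n / N)^|K|,
    and the sum over K in A is folded back. *)
Lemma avg_overlap_pow n A (u : R) : (n <= N)%N -> 0 <= u ->
  avg n (fun B => (1 + u) ^+ #|A :&: B|) <= (1 + u * (n%:R / N%:R)) ^+ #|A|.
Proof.
move=> nN u0; rewrite /avg.
have C0 : 0 < ('C(N, n)%:R : R) by rewrite ltr0n bin_gt0.
rewrite ler_pdivrMl// expr1D_card.
under eq_bigr do rewrite expr1D_card big_mkcond/=.
rewrite exchange_big/= mulr_sumr [leRHS]big_mkcond/=; apply: ler_sum => K _.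
case: ifPn => KA; last first.
  rewrite big1// => B _; case: ifPn => // KAB.
  by move: KA; rewrite (fintype.subset_trans KAB)// finset.subsetIl.
rewrite -big_mkcondr/=.
under eq_bigl do rewrite finset.subsetI KA/=.
rewrite sumr_const -cardsE card_supersets.
case: leqP => Kn; last by rewrite mulr0n mulr_ge0// ?exprn_ge0// mulr_ge0// divr_ge0.
rewrite -[leLHS]mulr_natl exprMn [leRHS]mulrCA [leLHS]mulrC.
rewrite ler_wpM2l ?exprn_ge0// expr_div_n mulrA.
have kN : (#|K| <= N)%N by exact: leq_trans Kn nN.
have N0 : (0 < N ^ #|K|)%N by rewrite expn_gt0; lia.
by rewrite ler_pdivlMr -!natrX ?ltr0n// -!natrM ler_nat bin_sub_le.
Qed.

Lemma avg_overlap_expR n A (s : R) : (n <= N)%N -> #|A| = n -> 0 <= s ->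
  avg n (fun B => expR (s * #|A :&: B|%:R)) <=
  expR (n%:R * (n%:R / N%:R) * (expR s - 1)).
Proof.
move=> nN An s0.
have e1 : 0 <= expR s - 1 by rewrite subr_ge0 -expR0 ler_expR.
apply: (@le_trans _ _ (avg n (fun B => (1 + (expR s - 1)) ^+ #|A :&: B|))).
  by apply: le_avg => B _; rewrite subrKC mulrC expRM_natl.
apply: (le_trans (avg_overlap_pow A nN e1)).
rewrite An -mulrA expRM_natl lerXn2r// ?nnegrE ?expR_ge0//.
  by rewrite addr_ge0// mulr_ge0// divr_ge0.
by rewrite mulrC expR_ge1Dx.
Qed.

Lemma invr_bin_le n : (n <= N)%N -> ('C(N, n)%:R)^-1 <= (n%:R / N%:R : R) ^+ n.
Proof.
move=> nN.
have C0 : 0 < ('C(N, n)%:R : R) by rewrite ltr0n bin_gt0.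
have [->|n0] := posnP n; first by rewrite bin0 invr1 expr0.
have := bin_sub_le (leqnn n) nN; rewrite subnn bin0 mul1n.
rewrite -div1r ler_pdivrMr// expr_div_n mulrAC ler_pdivlMr; last first.
  by rewrite exprn_gt0// ltr0n (leq_trans n0).
by rewrite mul1r -!natrX -natrM ler_nat mulnC.
Qed.

(** The term of degree n in the expansion of (1 + p)^N is at most the whole, which is at most exp (p
    N) = exp n. *)
Lemma bin_le_expR n : (0 < n)%N -> (n <= N)%N ->
  'C(N, n)%:R <= expR n%:R * ((n%:R / N%:R : R) ^- n).
Proof.
move=> n0 nN; have N0 := leq_trans n0 nN.
set p := n%:R / N%:R : R.
have p0 : 0 < p by rewrite divr_gt0// ltr0n.
rewrite ler_pdivlMr ?exprn_gt0//.
apply: (@le_trans _ _ ((1 + p) ^+ N)).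
  rewrite exprDn (bigD1 (Ordinal (n := N.+1) (m := n) nN))//= expr1n mul1r mulr_natl.
  rewrite lerDl sumr_ge0// => i _; rewrite expr1n mul1r mulrn_wge0// exprn_ge0//.
  exact: ltW.
have -> : expR n%:R = expR p ^+ N.
  by rewrite -expRM_natl; congr expR; rewrite mulrC divfK// pnatr_eq0 -lt0n.
by rewrite lerXn2r// ?nnegrE ?expR_ge0 ?expR_ge1Dx// addr_ge0// ltW.
Qed.

End subset_average.

Lemma measurable_sum_cond d (T : measurableType d) (R : realType) (I : Type)
    (s : seq I) (P : pred I) (h : I -> T -> R) :
  (forall i, measurable_fun setT (h i)) ->
  measurable_fun setT (fun x => \sum_(i <- s | P i) h i x).
Proof. by move=> mh; under eq_fun do rewrite -big_filter; exact: measurable_sum. Qed.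

(** * Chernoff bounds for centred sums of squares *)

Section chi_square.
Context {R : realType} {N M : nat}.
Local Notation N01 := (@normal_prob R 0 1).
Local Notation noise := (noise_law R N M).
Local Notation cell := ('I_N * 'I_M)%type.
Implicit Types (V : {set cell}) (y : obs R N M) (l h : R).

Lemma sqrtr_le_sqr (x b : R) : 0 <= b -> x <= b ^+ 2 -> Num.sqrt x <= b.
Proof. by move=> b0 xb; rewrite -[leRHS]ger0_norm// -sqrtr_sqr ler_wsqrtr. Qed.

Lemma chi_mgf_null l : 0 <= l < 1 / 2 ->
  expR (- l) / Num.sqrt (1 - 2 * l) <= expR (l ^+ 2 / (1 - 2 * l)).
Proof.
move=> /andP[l0 l1].
set w := 1 - 2 * l; have w0 : 0 < w by rewrite /w; lra.
have w1 : 0 < w <= 1 by rewrite w0 /w/=; lra.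
rewrite -sqrtrV ?(ltW w0)//.
apply: (@le_trans _ _ (expR (- l) * expR (l * (1 - l) / w))).
  rewrite ler_pM2l ?expR_gt0// sqrtr_le_sqr ?expR_ge0//.
  apply: (le_trans (invr_le_expR w1)); rewrite -expRM_natl ler_expR.
  rewrite le_eqVlt; apply/orP; left; apply/eqP; rewrite /w; field.
  by rewrite gt_eqF.
rewrite -expRD ler_expR le_eqVlt; apply/orP; left; apply/eqP; rewrite /w; field.
by rewrite gt_eqF.
Qed.

Lemma chi_mgf_shift l s : 0 <= l ->
  expR (l - l * s ^+ 2 / (1 + 2 * l)) / Num.sqrt (1 + 2 * l) <=
  expR (2 * l ^+ 2 - l / (1 + 2 * l) * s ^+ 2).
Proof.
move=> l0; set w := 1 + 2 * l; have w0 : 0 < w by rewrite /w; lra.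
rewrite -sqrtrV ?(ltW w0)//.
apply: (@le_trans _ _ (expR (l - l * s ^+ 2 / w) * expR (- l + 2 * l ^+ 2))).
  rewrite ler_pM2l ?expR_gt0// sqrtr_le_sqr ?expR_ge0//.
  rewrite -expRM_natl.
  (* This is at most exp (- 2 l / w), and 2 l / w >= 2 l - 4 l^2; the square root halves the
     exponent. *)
  have -> : w^-1 = 1 + - (2 * l / w) by rewrite /w; field; rewrite gt_eqF.
  apply: (le_trans (expR_ge1Dx _)); rewrite ler_expR -subr_ge0.
  have -> : 2 * (- l + 2 * l ^+ 2) - - (2 * l / w) = 8 * l ^+ 3 / w.
    by rewrite /w; field; rewrite gt_eqF.
  by rewrite divr_ge0 ?(ltW w0)// mulr_ge0// exprn_ge0.
rewrite -expRD ler_expR le_eqVlt; apply/orP; left; apply/eqP; field.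
by rewrite gt_eqF.
Qed.

Definition chi V y : R := \sum_(c in V) (entry y c.1 c.2 ^+ 2 - 1).

Lemma measurable_chi V : measurable_fun setT (chi V).
Proof.
apply: measurable_sum_cond => c; apply: measurable_funB => //.
by apply: measurable_funX; exact: measurable_entry.
Qed.

Lemma expR_chiE l V (S : 'M[R]_(N, M)) y :
  expR (l * chi V (Defs.shift S y)) =
  \prod_c (if c \in V then expR (l * ((S c.1 c.2 + entry y c.1 c.2) ^+ 2 - 1)) else 1).
Proof.
rewrite /chi mulr_sumr expR_sum -big_mkcond/=; apply: eq_bigr => c _.
by rewrite /entry !tnth_mktuple.
Qed.

Local Open Scope ereal_scope.

Lemma le_integral_expR_chi V (S : 'M[R]_(N, M)) l (k : cell -> R) :
  (forall c, c \in V ->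
     \int[N01]_x (expR (l * ((S c.1 c.2 + x) ^+ 2 - 1)))%:E <= (expR (k c))%:E) ->
  \int[noise]_y (expR (l * chi V (Defs.shift S y)))%:E <=
  (expR (\sum_(c in V) k c))%:E.
Proof.
move=> hk; under eq_integral do rewrite expR_chiE.
pose f (c : cell) (x : measurableTypeR R) : R :=
  if c \in V then expR (l * ((S c.1 c.2 + x) ^+ 2 - 1)) else 1%R.
pose J c := \int[N01]_x (f c x)%:E.
have J0 c : 0 <= J c.
  by apply: integral_ge0 => x _; rewrite lee_fin /f; case: ifP => // _; exact: expR_ge0.
have J1 c : c \notin V -> J c = 1.
  by move=> cV; rewrite /J /f (negbTE cV) integral_normal1.
have Jf c : J c \is a fin_num.
  have [cV|cV] := boolP (c \in V); last by rewrite J1.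
  rewrite ge0_fin_numE//; apply: (@le_lt_trans _ _ (expR (k c))%:E); last exact: ltry.
  by have := hk c cV; rewrite /J /f cV.
rewrite (integral_prod_cell (f := f) (k := fun c => fine (J c))).
- rewrite lee_fin expR_sum [leRHS]big_mkcond/=; apply: ler_prod => c _.
  rewrite fine_ge0//=; case: ifPn => cV; last by rewrite J1.
  by rewrite -lee_fin fineK//; have := hk c cV; rewrite /J /f cV.
- move=> c; rewrite /f; case: (c \in V) => //; apply: measurableT_comp => //.
  apply: measurable_funM => //; apply: measurable_funB => //.
  by apply: measurable_funX; exact: measurable_funD.
- by move=> c x; rewrite /f; case: ifP => // _; exact: expR_ge0.
- by move=> c; rewrite fineK.
Qed.

Lemma chi_tail_null V l h : (0 <= l < 1 / 2)%R ->
  \int[noise]_y ((h < chi V y)%R%:R)%:E <=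
  (expR (- (l * h) + #|V|%:R * (l ^+ 2 / (1 - 2 * l))))%:E.
Proof.
move=> /[dup] l01 /andP[l0 l1].
have m1 : measurable_fun setT (fun y => l * chi V y)%R.
  by apply: measurable_funM => //; exact: measurable_chi.
apply: (@le_trans _ _ (\int[noise]_y ((expR (- (l * h)))%:E * (expR (l * chi V (Defs.shift 0 y)))%:E))).
  apply: ge0_le_integral => //.
  - apply/measurable_EFinP; apply: measurable_natr_bool; apply: measurable_fun_ltr => //.
    exact: measurable_chi.
  - apply: emeasurable_funM => //; apply/measurable_EFinP.
    apply: measurableT_comp => //; apply: (measurableT_comp m1).
    exact: measurable_shift.
  - move=> y _; rewrite -EFinM lee_fin -expRD.
    rewrite shift0_obs; case: ltP => [hc|_]; last exact: expR_ge0.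
    rewrite -[leLHS]expR0 ler_expR addrC subr_ge0 ler_wpM2l// ltW//.
rewrite ge0_integralZl//; last first.
  apply/measurable_EFinP; apply: measurableT_comp => //; apply: (measurableT_comp m1).
  exact: measurable_shift.
rewrite expRD EFinM lee_pmul2l ?lte_fin ?expR_gt0//.
apply: (le_trans (le_integral_expR_chi (k := fun=> l ^+ 2 / (1 - 2 * l))%R _)).
  move=> c cV; rewrite mxE.
  (* The parameter is [- l], whence the restriction l < 1 / 2 for upper tails. *)
  have := @integral_normal_expR_sqr R (- l) 0; rewrite opprK mulrN => ->; last lra.
  by rewrite expr0n/= mulr0 mul0r subr0 lee_fin chi_mgf_null.
by rewrite sumr_const -[X in expR X]mulr_natl.
Qed.

Lemma chi_tail_shift (S : 'M[R]_(N, M)) V l h : (0 <= l)%R ->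
  \int[noise]_y ((chi V (Defs.shift S y) <= h)%R%:R)%:E <=
  (expR (l * h + #|V|%:R * (2 * l ^+ 2) -
         l / (1 + 2 * l) * \sum_(c in V) S c.1 c.2 ^+ 2))%:E.
Proof.
move=> l0.
have mc : measurable_fun setT (fun y => chi V (Defs.shift S y)).
  by apply: measurableT_comp; [exact: measurable_chi|exact: measurable_shift].
have m1 : measurable_fun setT (fun y => - l * chi V (Defs.shift S y))%R.
  exact: measurable_funM.
apply: (@le_trans _ _ (\int[noise]_y ((expR (l * h))%:E * (expR (- l * chi V (Defs.shift S y)))%:E))).
  apply: ge0_le_integral => //.
  - by apply/measurable_EFinP; apply: measurable_natr_bool; apply: measurable_fun_ler.
  - apply: emeasurable_funM => //; apply/measurable_EFinP.
    by apply: measurableT_comp.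
  - move=> y _; rewrite -EFinM lee_fin -expRD.
    have [hc|_] := leP (chi V (Defs.shift S y)) h; last exact: expR_ge0.
    by rewrite -[leLHS]expR0 ler_expR mulNr subr_ge0 ler_wpM2l.
rewrite ge0_integralZl//; last first.
  by apply/measurable_EFinP; apply: measurableT_comp.
rewrite -addrA expRD EFinM lee_pmul2l ?lte_fin ?expR_gt0//.
apply: (le_trans (le_integral_expR_chi (k := fun c => 2 * l ^+ 2 - l / (1 + 2 * l) * S c.1 c.2 ^+ 2)%R _)).
  move=> c cV; rewrite integral_normal_expR_sqr; last lra.
  by rewrite lee_fin chi_mgf_shift.
by rewrite sumrB sumr_const mulr_sumr -[(_ *+ _)%R]mulr_natl.
Qed.

End chi_square.

Lemma half_ratio (F : numFieldType) (x y : F) : x != 0 -> y != 0 ->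
  x * y / (2 * x * y) = 2^-1.
Proof. by move=> x0 y0; field; rewrite x0 y0. Qed.

(** * Errors of the combined test at fixed sizes *)

Section test_bounds.
Context {R : realType} {N M : nat}.
Local Notation noise := (noise_law R N M).
Implicit Types (y : obs R N M) (n m : nat) (H d a : R) (S : 'M[R]_(N, M)).

(** Counting the exceeded thresholds makes the union bound a pointwise inequality and the
    measurability of the test immediate. *)
Definition detections n m H d y : R :=
  (H < z_lin y)%R%:R +
  \sum_(C in rects N M n m) (threshold N M n m d < z_rect n m C y)%R%:R.

Lemma psi_zE n m H d y :
  psi_z n m H d y = (0 < detections n m H d y)%R%:R.
Proof.
rewrite /psi_z /psi_lin /psi_max !indicE.
have -> : (y \in [set y | H < z_lin y]) = (H < z_lin y) by apply/idP/idP; rewrite inE.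
set b := (_ \in _).
have bP : reflect (exists2 C, C \in rects N M n m &
    threshold N M n m d < z_rect n m C y) b.
  apply: (iffP idP); rewrite /b inE/=.
    by move=> /bigmax_gtP[//|[C Cr]]; rewrite lte_fin => h; exists C.
  by move=> [C Cr h]; apply/bigmax_gtP; right; exists C.
have s0 : 0 <= \sum_(C in rects N M n m)
    (threshold N M n m d < z_rect n m C y)%R%:R :> R by exact: sumr_ge0.
rewrite /detections; case: (H < z_lin y) => /=.
  by rewrite max_l ?ltr_wpDr// lern1 leq_b1.
rewrite add0r max_r//; case: bP => [[C Cr h]|nb].
  by rewrite (bigD1 C)//= h ltr_wpDr// sumr_ge0.
rewrite big1 ?ltxx// => C Cr; case: ltP => // h; case: nb; by exists C.
Qed.

Lemma measurable_z_lin : measurable_fun setT (@z_lin R N M).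
Proof.
apply: measurable_funM => //; apply: measurable_sum => i.
apply: measurable_sum => j; apply: measurable_funB => //.
by apply: measurable_funX; exact: measurable_entry.
Qed.

Lemma measurable_z_rect n m C : measurable_fun setT (@z_rect R N M n m C).
Proof. by apply: measurable_funM => //; exact: measurable_chi. Qed.

Lemma measurable_detections n m H d : measurable_fun setT (detections n m H d).
Proof.
apply: measurable_funD.
  apply: measurable_natr_bool; apply: measurable_fun_ltr => //.
  exact: measurable_z_lin.
apply: measurable_sum_cond => C.
apply: measurable_natr_bool; apply: measurable_fun_ltr => //.
exact: measurable_z_rect.
Qed.

Lemma measurable_psi_z n m H d : measurable_fun setT (@psi_z R N M n m H d).
Proof.
rewrite (_ : psi_z n m H d = fun y => (0 < detections n m H d y)%R%:R); last first.
  by apply/funext => y; rewrite psi_zE.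
apply: measurable_natr_bool; apply: measurable_fun_ltr => //.
exact: measurable_detections.
Qed.

Lemma psi_z_le n m H d y : psi_z n m H d y <= detections n m H d y.
Proof.
rewrite psi_zE.
have -> : detections n m H d y = ((H < z_lin y)%R +
    \sum_(C in rects N M n m) (threshold N M n m d < z_rect n m C y)%R)%N%:R.
  by rewrite natrD natr_sum.
by rewrite ltr0n; case: (_ + _)%N => // k; rewrite ler_nat.
Qed.

Lemma chi_setT y : chi [set: 'I_N * 'I_M]%SET y =
  \sum_(i < N) \sum_(j < M) (entry y i j ^+ 2 - 1).
Proof.
rewrite pair_bigA/= /chi; apply: eq_big => [c|[i j] _]//=; by rewrite !inE.
Qed.

Local Open Scope ereal_scope.

Lemma card_rect n m (C : {set 'I_N * 'I_M}) : C \in rects N M n m -> #|C| = (n * m)%N.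
Proof.
by move=> /imset2P[A B]; rewrite !inE => /eqP <- /eqP <- ->; rewrite cardsX.
Qed.

Lemma card_rects_le n m : (#|rects N M n m| <= 'C(N, n) * 'C(M, m))%N.
Proof.
by rewrite /rects curry_imset2X (leq_trans (leq_imset_card _ _))// cardsX !card_draws !card_ord.
Qed.

(** [k] and [r] are the null standard deviations of the sums over all cells and over a rectangle.
    The Chernoff exponent 1 / k gives exp (- H + O(1)), enough for H tending to infinity. The
    exponent T / r minimises - l T r + l^2 r^2 / 2 and so yields the Gaussian tail exp (- T^2 / 2),
    up to the correction 1 / (1 - 2 T / r) of the quadratic term. *)
Lemma alpha_psi_z_le n m H d : (0 < n)%N -> (0 < m)%N -> (0 < N)%N -> (0 < M)%N ->
  let k := (Num.sqrt (2 * N%:R * M%:R) : R)%R in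
  let r := (Num.sqrt (2 * n%:R * m%:R) : R)%R in
  let T := threshold N M n m d in
  (2 < k)%R -> (0 <= T)%R -> (2 * T < r)%R ->
  alpha (@psi_z R N M n m H d) <=
  (expR (- H + 2^-1 / (1 - 2 / k)) +
   'C(N, n)%:R * 'C(M, m)%:R * expR (- T ^+ 2 + T ^+ 2 / 2 / (1 - 2 * (T / r))))%:E.
Proof.
move=> n0 m0 N0 M0 k r T k2 T0 Tr.
have k0 : (0 < k)%R by lra.
have r0 : (0 < r)%R by lra.
have k2E : (k ^+ 2 = 2 * N%:R * M%:R)%R by rewrite sqr_sqrtr// !mulr_ge0.
have r2E : (r ^+ 2 = 2 * n%:R * m%:R)%R by rewrite sqr_sqrtr// !mulr_ge0.
have linE y : ((H < z_lin y) = (H * k < chi [set: 'I_N * 'I_M]%SET y))%R.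
  by rewrite /z_lin -chi_setT -/k ltr_pdivlMl// mulrC.
have rectE C y : ((T < z_rect n m C y) = (T * r < chi C y))%R.
  by rewrite /z_rect -/r ltr_pdivlMl// mulrC.
apply: (@le_trans _ _ (\int[noise]_y (detections n m H d y)%:E)).
  rewrite /alpha /expect; under eq_integral do rewrite shift0_obs.
  apply: ge0_le_integral => //.
  - by move=> y _; rewrite lee_fin psi_zE.
  - by apply/measurable_EFinP; exact: measurable_psi_z.
  - by apply/measurable_EFinP; exact: measurable_detections.
  - by move=> y _; rewrite lee_fin psi_z_le.
rewrite /detections.
have mdet C : measurable_fun setT
    (fun y => ((T < z_rect n m C y)%R%:R)%:E : \bar R).
  apply/measurable_EFinP; apply: measurable_natr_bool; apply: measurable_fun_ltr => //.
  exact: measurable_z_rect.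
have mlin : measurable_fun setT (fun y => ((H < z_lin y)%R%:R)%:E : \bar R).
  apply/measurable_EFinP; apply: measurable_natr_bool; apply: measurable_fun_ltr => //.
  exact: measurable_z_lin.
under eq_integral do rewrite EFinD -sumEFin -big_filter.
rewrite ge0_integralD//; last 2 first.
- by move=> y _; exact: sume_ge0.
- by apply: emeasurable_sum => C; exact: mdet.
rewrite ge0_integral_sum// big_filter EFinD; apply: leeD.
  under eq_integral do rewrite linE.
  have -> : (- H + 2^-1 / (1 - 2 / k) = - (k^-1 * (H * k)) +
     #|[set: 'I_N * 'I_M]%SET|%:R * (k^-1 ^+ 2 / (1 - 2 * k^-1)))%R.
    rewrite cardsT card_prod !card_ord natrM exprVn k2E.
    have N1 : (N%:R != 0 :> R)%R by rewrite pnatr_eq0 -lt0n.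
    have M1 : (M%:R != 0 :> R)%R by rewrite pnatr_eq0 -lt0n.
    have half : (N%:R * M%:R / (2 * N%:R * M%:R) = 2^-1 :> R)%R.
      exact: half_ratio.
    by rewrite [(N%:R * M%:R * _)%R]mulrA half mulrCA mulVf ?gt_eqF// mulr1.
  apply: chi_tail_null.
  by rewrite invr_ge0 (ltW k0)/= mul1r ltf_pV2 ?posrE.
set e := expR _; have e0 : (0 <= e)%R by exact: expR_ge0.
apply: (@le_trans _ _ (\sum_(C in rects N M n m) e%:E)).
  apply: lee_sum => C Cr; under eq_integral do rewrite -/T rectE.
  have -> : e = expR (- (T / r * (T * r)) + #|C|%:R * ((T / r) ^+ 2 / (1 - 2 * (T / r))))%R.
    rewrite /e (card_rect Cr) natrM; congr expR.
    have n1 : (n%:R != 0 :> R)%R by rewrite pnatr_eq0 -lt0n.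
    have m1 : (m%:R != 0 :> R)%R by rewrite pnatr_eq0 -lt0n.
    have half : (n%:R * m%:R / (2 * n%:R * m%:R) = 2^-1 :> R)%R.
      exact: half_ratio.
    have -> : (T / r * (T * r) = T ^+ 2)%R.
      by have rn0 : r != 0%R; [rewrite gt_eqF|field].
    have h2 : (n%:R * m%:R * (T / r) ^+ 2 = T ^+ 2 / 2)%R.
      by rewrite expr_div_n r2E mulrCA half.
    by rewrite [X in _ = (_ + X)%R]mulrA h2.
  apply: chi_tail_null; rewrite divr_ge0 ?(ltW r0)//=.
  rewrite ltr_pdivrMr//; move: Tr; lra.
rewrite sumEFin lee_fin sumr_const -[leLHS]mulr_natl ler_wpM2r//.
by rewrite -natrM ler_nat card_rects_le.
Qed.

Lemma le_beta n m a (psi : obs R N M -> R) (b : \bar R) :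
  (forall S, alternatives n m a S -> expect S (fun y => 1 - psi y)%R <= b) ->
  beta n m a psi <= b.
Proof. by move=> h; apply: ge_ereal_sup => _ [S /h ? <-]. Qed.

(** To miss is, in particular, to miss by one chosen statistic: V will be the whole grid or the true
    rectangle. *)
Lemma expect_miss_le n m H d (V : {set 'I_N * 'I_M}) h S :
  (forall y, h < chi V y -> 0 < detections n m H d y)%R ->
  expect S (fun y => 1 - psi_z n m H d y)%R <=
  \int[noise]_y ((chi V (Defs.shift S y) <= h)%R%:R)%:E.
Proof.
move=> hd; apply: ge0_le_integral => //.
- by move=> y _; rewrite lee_fin psi_zE subr_ge0; case: (0 < _)%R.
- apply/measurable_EFinP; apply: measurable_funB => //.
  by apply: measurableT_comp; [exact: measurable_psi_z|exact: measurable_shift].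
- apply/measurable_EFinP; apply: measurable_natr_bool; apply: measurable_fun_ler => //.
  by apply: measurableT_comp; [exact: measurable_chi|exact: measurable_shift].
- move=> y _; rewrite lee_fin psi_zE.
  have [_|hc] := leP (chi V (Defs.shift S y)) h.
    by rewrite gerBl.
  by rewrite (hd _ hc) subrr.
Qed.

(* The exponential Chebyshev inequality is applied with the fixed exponent
   1 / sqrt v, v being the number of cells in the sum. *)
Lemma chi_miss_le (V : {set 'I_N * 'I_M}) h S (s : R) : (0 < #|V|)%N ->
  (s <= \sum_(c in V) S c.1 c.2 ^+ 2)%R ->
  \int[noise]_y ((chi V (Defs.shift S y) <= h)%R%:R)%:E <=
  (expR (h / Num.sqrt #|V|%:R + 2 - s / (Num.sqrt #|V|%:R + 2)))%:E.
Proof.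
move=> V0 hs; set r : R := Num.sqrt _; have r2 : (r ^+ 2 = #|V|%:R)%R by rewrite sqr_sqrtr.
have r0 : (0 < r)%R by rewrite sqrtr_gt0 ltr0n.
have ri : (0 <= r^-1)%R by rewrite invr_ge0 ltW.
apply: (le_trans (chi_tail_shift S V h ri)); rewrite lee_fin ler_expR.
have r00 : r != 0%R by rewrite gt_eqF.
have -> : (#|V|%:R * (2 * r^-1 ^+ 2) = 2)%R.
  by rewrite -r2; field.
rewrite [(r^-1 * h)%R]mulrC lerD2l lerN2.
have -> : (r^-1 / (1 + 2 * r^-1) = (r + 2)^-1)%R.
  by field; rewrite r00 gt_eqF// addr_gt0.
by rewrite mulrC ler_wpM2l// invr_ge0 addr_ge0// ltW.
Qed.

Lemma beta_psi_z_le_lin n m H d a : (0 < N)%N -> (0 < M)%N -> (0 <= a)%R ->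
  beta n m a (@psi_z R N M n m H d) <=
  (expR (Num.sqrt 2 * H + 2 - a ^+ 2 * (n * m)%:R / (Num.sqrt (N * M)%:R + 2)))%:E.
Proof.
move=> N0 M0 a0; set k : R := Num.sqrt (N * M)%:R; apply: le_beta => S [C Cr hS].
have cT : #|[set: 'I_N * 'I_M]%SET| = (N * M)%N by rewrite cardsT card_prod !card_ord.
have k0 : (0 < k)%R by rewrite sqrtr_gt0 ltr0n muln_gt0 N0.
pose h := (H * Num.sqrt 2 * k)%R.
have kE : (Num.sqrt (2 * N%:R * M%:R) = Num.sqrt 2 * k :> R)%R.
  by rewrite -sqrtrM// natrM mulrA.
have s2 : (0 < Num.sqrt 2 :> R)%R by rewrite sqrtr_gt0.
apply: le_trans (expect_miss_le (V := [set: 'I_N * 'I_M]%SET) (h := h) _ _) _.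
  move=> y hy; rewrite /detections (_ : (H < z_lin y)%R = true).
    by rewrite ltr_wpDr// sumr_ge0.
  by rewrite /z_lin -chi_setT ltr_pdivlMl kE ?mulr_gt0// mulrC mulrA.
apply: le_trans (chi_miss_le (s := a ^+ 2 * (n * m)%:R) _ _ _) _.
- by rewrite cT muln_gt0 N0.
- rewrite -(card_rect Cr) mulr_natr -sumr_const.
  rewrite [leRHS](bigID (fun c => c \in C))/=.
  rewrite [X in (_ <= X + _)%R](eq_bigl (fun c => c \in C)); last first.
    by move=> c; rewrite !inE.
  rewrite -[leLHS]addr0 lerD ?sumr_ge0// => [|c _]; last exact: sqr_ge0.
  apply: ler_sum => -[i j] Cij /=.
  have [_ /(_ Cij) aS] := hS i j; rewrite -[leRHS]real_normK ?num_real//.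
  by rewrite lerXn2r// nnegrE (le_trans a0).
- rewrite cT -/k lee_fin ler_expR /h mulfK ?gt_eqF//.
  by rewrite mulrC.
Qed.

Lemma beta_psi_z_le_max n m H d a : (0 < n)%N -> (0 < m)%N -> (0 <= a)%R ->
  beta n m a (@psi_z R N M n m H d) <=
  (expR (Num.sqrt 2 * threshold N M n m d + 2 - a ^+ 2 * (n * m)%:R / (Num.sqrt (n * m)%:R + 2)))%:E.
Proof.
move=> n0 m0 a0; set k : R := Num.sqrt (n * m)%:R; apply: le_beta => S [C Cr hS].
have cC := card_rect Cr.
have k0 : (0 < k)%R by rewrite sqrtr_gt0 ltr0n muln_gt0 n0.
set T := threshold N M n m d.
pose h := (T * Num.sqrt 2 * k)%R.
have kE : (Num.sqrt (2 * n%:R * m%:R) = Num.sqrt 2 * k :> R)%R.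
  by rewrite -sqrtrM// natrM mulrA.
have s2 : (0 < Num.sqrt 2 :> R)%R by rewrite sqrtr_gt0.
apply: le_trans (expect_miss_le (V := C) (h := h) _ _) _.
  move=> y hy; rewrite /detections (bigD1 C)//= (_ : (_ < z_rect n m C y)%R = true).
    by rewrite addrCA ltr_wpDr// addr_ge0// sumr_ge0.
  by rewrite /z_rect ltr_pdivlMl kE ?mulr_gt0// mulrC mulrA.
apply: le_trans (chi_miss_le (s := a ^+ 2 * (n * m)%:R) _ _ _) _.
- by rewrite cC muln_gt0 n0.
- rewrite -(card_rect Cr) mulr_natr -sumr_const.
  apply: ler_sum => -[i j] Cij /=.
  have [_ /(_ Cij) aS] := hS i j; rewrite -[leRHS]real_normK ?num_real//.
  by rewrite lerXn2r// nnegrE (le_trans a0).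
- rewrite cC -/k lee_fin ler_expR /h mulfK ?gt_eqF//.
  by rewrite mulrC.
Qed.

End test_bounds.

(** * Limits along a filter *)

Section filter_facts.
Context {R : realType} {T : choiceType} {X : filteredType T} {F : set_system X} {FF : ProperFilter F}.

Lemma cvg_EFin_near (f : X -> \bar R) (l : R) :
  (forall e : R, 0 < e -> \forall k \near F, ((l - e)%:E <= f k <= (l + e)%:E)%E) ->
  f @ F --> l%:E.
Proof.
move=> h; apply/fine_cvgP; split.
  apply: filterS (h 1 ltr01) => k /andP[lk ku].
  by rewrite fin_real// (lt_le_trans _ lk) ?ltNyr//= (le_lt_trans ku)// ltry.
apply/cvgrPdist_le => e e0; apply: filterS (h e e0) => k /= /andP[lk ku].
have fk : f k \is a fin_num.
  by rewrite fin_real// (lt_le_trans _ lk) ?ltNyr//= (le_lt_trans ku)// ltry.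
by rewrite distrC ler_distl -!lee_fin fineK// lk ku.
Qed.

Lemma limf_einf_gt_near (f : X -> \bar R) (c : \bar R) :
  (c < limf_einf f F)%E -> \forall k \near F, (c < f k)%E.
Proof.
rewrite limf_einfE => /ereal_sup_gt[_ [V FV <-]] cV.
apply: filterS FV => k Vk; apply: (lt_le_trans cV).
by apply: ereal_inf_lbound; exists k.
Qed.

Lemma limf_esup_lt_near (f : X -> \bar R) (c : \bar R) :
  (limf_esup f F < c)%E -> \forall k \near F, (f k < c)%E.
Proof.
rewrite limf_esupE => /ereal_inf_lt[_ [V FV <-]] cV.
apply: filterS FV => k Vk; apply: le_lt_trans cV.
by apply: ereal_sup_ubound; exists k.
Qed.

(** Turns a strict inequality for a lower limit, possibly infinite, into a fixed real margin. *)
Lemma ereal_between (c : R) (x : \bar R) : (c%:E < x)%E ->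
  exists2 e : R, 0 < e & ((c + e)%:E < x)%E.
Proof.
case: x => [x| |]//.
  rewrite lte_fin => cx; exists ((x - c) / 2); first by rewrite divr_gt0// subr_gt0.
  by rewrite lte_fin; lra.
by move=> _; exists 1; rewrite ?ltry.
Qed.

Lemma ereal_between_lt (c : R) (x : \bar R) : (x < c%:E)%E ->
  exists2 e : R, 0 < e & (x < (c - e)%:E)%E.
Proof.
case: x => [x| |]//.
  rewrite lte_fin => cx; exists ((c - x) / 2); first by rewrite divr_gt0// subr_gt0.
  by rewrite lte_fin; lra.
by move=> _; exists 1; rewrite ?ltNyr.
Qed.

End filter_facts.

Lemma exists_rect {N M n m : nat} : (n <= N)%N -> (m <= M)%N ->
  exists C : {set 'I_N * 'I_M}, C \in rects N M n m.
Proof.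
have ex N0 n0 : (n0 <= N0)%N -> exists A : {set 'I_N0}, A \in [set A : {set 'I_N0} | #|A| == n0]%SET.
  move=> nN; apply/existsP; rewrite -(rwP existsP); apply/card_gt0P.
  by rewrite card_draws card_ord bin_gt0.
move=> /ex[A hA] /ex[B hB]; exists (finset.setX A B); exact: imset2_f.
Qed.

Lemma alternatives_neq0 {R : realType} {N M n m : nat} (a : R) :
  (n <= N)%N -> (m <= M)%N -> exists S : 'M[R]_(N, M), alternatives n m a S.
Proof.
move=> nN mM; have [C Cr] := exists_rect nN mM.
exists (\matrix_(i, j) if (i, j) \in C then a else 0).
by exists C => // i j; rewrite mxE; case: ifP => //= _; split=> // _; exact: ler_norm.
Qed.

Lemma expect_ge0 {R : realType} {N M : nat} (S : 'M[R]_(N, M)) psi :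
  (forall y, 0 <= psi y) -> (0 <= expect S psi)%E.
Proof. by move=> h; apply: integral_ge0 => y _; rewrite lee_fin. Qed.

Lemma beta_ge0 {R : realType} {N M n m : nat} (a : R) (psi : obs R N M -> R) :
  (n <= N)%N -> (m <= M)%N -> (forall y, psi y <= 1) ->
  (0 <= beta n m a psi)%E.
Proof.
move=> nN mM h; have [S aS] := alternatives_neq0 a nN mM.
apply: le_trans (expect_ge0 S (psi := fun y => 1 - psi y) _) _.
  by move=> y; rewrite subr_ge0.
by apply: ereal_sup_ubound; exists S.
Qed.

(** * Exponents of the first error *)

Section exponents.
Context {R : realType}.
Implicit Types (c d T r : R).

(** In squares, T^2 <= 2 (2 + d) G <= 2 c^2 x = c^2 r^2; [1 + 1] is the factor [1 + e] of
    [near_log_rects] for e = 1. *)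
Lemma threshold_le c d T r (L G x : R) : 0 <= c -> 0 < d -> T ^+ 2 = (2 + d) * L ->
  L <= (1 + 1) * G -> G <= c ^+ 2 / (2 + d) * x -> r ^+ 2 = 2 * x ->
  0 <= T -> 0 < r -> T <= c * r.
Proof.
move=> c0 d0 T2 LG Gx r2 T0 r0; rewrite -ler_sqr ?nnegrE ?(mulr_ge0 c0 (ltW r0))//.
rewrite exprMn T2 r2; apply: (@le_trans _ _ ((2 + d) * ((1 + 1) * G))).
  by rewrite ler_wpM2l//; lra.
move: Gx; rewrite mulrAC ler_pdivlMr; lra.
Qed.

Lemma far_threshold (K T r c : R) : 4 <= K -> 0 < r -> c <= 1 / 8 -> T <= c * r ->
  2 < K /\ 2 * T < r.
Proof.
move=> K4 r0 c1 Tr; split; first lra.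
have : c * r <= 1 / 8 * r by rewrite ler_wpM2r// ltW.
lra.
Qed.

Lemma lin_exponent_le (K H b : R) : 4 <= K -> 1 - b <= H ->
  - H + 2^-1 / (1 - 2 / K) <= b.
Proof.
move=> K4 bH; have K0 : 0 < K by lra.
have h : 2 / K <= 1 / 2 by rewrite ler_pdivrMr//; lra.
have : 2^-1 / (1 - 2 / K) <= 1 by rewrite ler_pdivrMr; lra.
lra.
Qed.

(** The union bound costs L and the Gaussian tail saves T^2 / 2 = (1 + d / 2) L, a net gain of d L /
    2. The correction 1 / (1 - 2 T / r) <= 1 + 4 c takes back d L / 4, so - d L / 4 remains. *)
Lemma scan_exponent_le c d T r (L G b : R) : 0 < c -> c <= 1 / 8 -> 0 < d ->
  (2 + d) * (2 * c) = d / 4 -> 1 <= L -> 0 <= T -> 0 < r -> T ^+ 2 = (2 + d) * L ->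
  T <= c * r -> G <= L -> - b * (4 / d) <= G ->
  L + (- T ^+ 2 + T ^+ 2 / 2 / (1 - 2 * (T / r))) <= b.
Proof.
move=> c0 c1 d0 cd L1 T0 r0 -> Tr GL bG.
have x0 : 0 <= T / r by rewrite divr_ge0// ltW.
have : T / r <= c by rewrite ler_pdivrMr.
move: (T / r) x0 => x x0 xc.
have inv : (1 - 2 * x)^-1 <= 1 + 4 * c.
  rewrite -[leLHS]mul1r ler_pdivrMr; last lra.
  have h4 : 0 <= c * (1 - 4 * x) by rewrite mulr_ge0 ?ltW//; lra.
  lra.
have : (2 + d) * L / 2 / (1 - 2 * x) <= (2 + d) * L / 2 * (1 + 4 * c).
  by rewrite ler_wpM2l// divr_ge0// mulr_ge0//; lra.
have -> : (2 + d) * L / 2 * (1 + 4 * c) = (2 + d) * L / 2 + d / 4 * L.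
  by rewrite -cd; field.
have h : - b <= G * (d / 4) by rewrite -ler_pdivrMr ?divr_gt0// invf_div.
have : G * (d / 4) <= L * (d / 4) by rewrite ler_wpM2r// divr_ge0// ltW.
clear -h; lra.
Qed.

End exponents.

(** * Asymptotics of the upper bounds *)

Section rates.
Context {R : realType} {F : set_system (nat * nat)} {FF : ProperFilter F}
  {n m : nat * nat -> nat}.
Let p := fun k => (n k)%:R / k.1%:R : R.
Let q := fun k => (m k)%:R / k.2%:R : R.
Let lnp := fun k => ln (p k)^-1.
Let lnq := fun k => ln (q k)^-1.
Context (nN : forall k, (n k <= k.1)%N) (mM : forall k, (m k <= k.2)%N)
  (N_oo : fst @ F --> \oo)
  (n_oo : n @ F --> \oo) (m_oo : m @ F --> \oo)
  (p0 : p @ F --> (0 : R)) (q0 : q @ F --> (0 : R))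
  (pq0 : (fun k => lnp k / (m k)%:R + lnq k / (n k)%:R) @ F --> (0 : R)).

Lemma near_natr (u : nat * nat -> nat) (A : R) : u @ F --> \oo ->
  \forall k \near F, A <= (u k)%:R.
Proof.
move=> /cvgnyPge /(_ (Num.truncn `|A|).+1); apply: filterS => k uk.
apply: (le_trans (ler_norm A)); apply: ltW.
by apply: lt_le_trans (truncnS_gt _) _; rewrite ler_nat.
Qed.

Lemma near_n_gt0 : \forall k \near F, (0 < n k)%N.
Proof. by move/cvgnyPge : n_oo => /(_ 1%N). Qed.

Lemma near_m_gt0 : \forall k \near F, (0 < m k)%N.
Proof. by move/cvgnyPge : m_oo => /(_ 1%N). Qed.

Lemma near_p_gt0 : \forall k \near F, 0 < p k.
Proof.
apply: filterS near_n_gt0 => k n0.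
by rewrite /p divr_gt0// ltr0n// (leq_trans n0).
Qed.

Lemma near_q_gt0 : \forall k \near F, 0 < q k.
Proof.
apply: filterS near_m_gt0 => k n0.
by rewrite /q divr_gt0// ltr0n// (leq_trans n0).
Qed.

Lemma near_ln_inv (u : nat * nat -> R) (A : R) : (\forall k \near F, 0 < u k) ->
  u @ F --> (0 : R) -> \forall k \near F, A <= ln (u k)^-1.
Proof.
move=> up /cvgr0Pnorm_lt /(_ _ (expR_gt0 (- A))); move: up.
apply: filterS2 => k u0; rewrite gtr0_norm// => uA.
rewrite -[A]expRK ler_ln ?posrE ?expR_gt0 ?invr_gt0//.
by rewrite -[expR A]invrK -expRN lef_pV2 ?posrE ?expR_gt0// ltW.
Qed.

Lemma near_lnp A : \forall k \near F, A <= lnp k.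
Proof. exact: near_ln_inv near_p_gt0 p0. Qed.

Lemma near_lnq A : \forall k \near F, A <= lnq k.
Proof. exact: near_ln_inv near_q_gt0 q0. Qed.

Lemma ln_bin_bounds (N0 n0 : nat) : (0 < n0)%N -> (n0 <= N0)%N ->
  n0%:R * ln (n0%:R / N0%:R)^-1 <= ln ('C(N0, n0)%:R : R) <=
  n0%:R + n0%:R * ln (n0%:R / N0%:R)^-1.
Proof.
move=> n00 nN0; set r := n0%:R / N0%:R : R.
have r0 : 0 < r by rewrite divr_gt0// ltr0n// (leq_trans n00).
have C0 : 0 < ('C(N0, n0)%:R : R) by rewrite ltr0n bin_gt0.
have -> : n0%:R * ln r^-1 = ln (r ^- n0).
  by rewrite -exprVn lnXn ?invr_gt0// mulr_natl.
apply/andP; split.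
  rewrite ler_ln ?posrE ?invr_gt0 ?exprn_gt0//.
  by rewrite -[leRHS]invrK lef_pV2 ?posrE ?invr_gt0 ?exprn_gt0// invr_bin_le.
rewrite -[X in X + _](@expRK R) -lnM ?posrE ?expR_gt0 ?invr_gt0 ?exprn_gt0//.
rewrite ler_ln ?posrE ?mulr_gt0 ?expR_gt0 ?invr_gt0 ?exprn_gt0//.
exact: bin_le_expR.
Qed.

(** The leading term of [log_rects], and also the quantity under the square root in the scan
    condition. *)
Definition log_count k : R := (n k)%:R * lnp k + (m k)%:R * lnq k.

Lemma near_log_count A : \forall k \near F, A <= log_count k.
Proof.
near=> k.
have lp1 : 1 <= lnp k by near: k; exact: near_lnp.
have lq1 : 0 <= lnq k by near: k; exact: near_lnq.
have nA : A <= (n k)%:R by near: k; exact: near_natr.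
have n0 : 0 <= (n k)%:R :> R by [].
rewrite /log_count (le_trans nA)// -[leLHS]addr0 lerD ?mulr_ge0//.
by rewrite ler_peMr.
Unshelve. all: by end_near. Qed.

(** Divided by n m, [log_count] is exactly the sum log (1 / p) / m + log (1 / q) / n that is assumed
    to vanish. *)
Lemma near_ratio e : 0 < e ->
  \forall k \near F, log_count k <= e * ((n k)%:R * (m k)%:R).
Proof.
move=> e0; near=> k.
have h : `|lnp k / (m k)%:R + lnq k / (n k)%:R| < e.
  by near: k; move/cvgr0Pnorm_lt: pq0 => /(_ _ e0).
have n0 : (0 < (n k)%:R :> R) by rewrite ltr0n; near: k; exact: near_n_gt0.
have m0 : (0 < (m k)%:R :> R) by rewrite ltr0n; near: k; exact: near_m_gt0.
have -> : log_count k = (lnp k / (m k)%:R + lnq k / (n k)%:R) * ((n k)%:R * (m k)%:R).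
  by rewrite /log_count; field; rewrite !gt_eqF.
rewrite ler_wpM2r ?mulr_ge0 ?(ltW n0) ?(ltW m0)//.
exact: le_trans (ler_norm _) (ltW h).
Unshelve. all: by end_near. Qed.

Definition log_rects k : R := ln ('C(k.1, n k)%:R * 'C(k.2, m k)%:R).

Lemma near_log_rects e : 0 < e ->
  \forall k \near F, log_count k <= log_rects k <= (1 + e) * log_count k.
Proof.
move=> e0; near=> k.
have n0 : (0 < n k)%N by near: k; exact: near_n_gt0.
have m0 : (0 < m k)%N by near: k; exact: near_m_gt0.
have lp1 : e^-1 <= lnp k by near: k; exact: near_lnp.
have lq1 : e^-1 <= lnq k by near: k; exact: near_lnq.
have /andP[nl nu] := ln_bin_bounds n0 (nN k).
have /andP[ml mu] := ln_bin_bounds m0 (mM k).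
rewrite /log_rects lnM ?posrE ?ltr0n ?bin_gt0//.
rewrite lerD//=; apply: (le_trans (lerD nu mu)).
rewrite -/(p k) -/(q k) -/(lnp k) -/(lnq k) /log_count.
(* The remainder n left by [ln_bin_bounds] is absorbed because [lnp] >= 1 / e; likewise for m. *)
have : (n k)%:R <= e * ((n k)%:R * lnp k).
  by rewrite mulrCA ler_peMr// mulrC -ler_pdivrMr// div1r.
have : (m k)%:R <= e * ((m k)%:R * lnq k).
  by rewrite mulrCA ler_peMr// mulrC -ler_pdivrMr// div1r.
lra.
Unshelve. all: by end_near. Qed.

Lemma near_alpha_psi_z d (H : nat * nat -> R) e : 0 < d -> H @ F --> +oo -> 0 < e ->
  \forall k \near F,
    (alpha (@psi_z R k.1 k.2 (n k) (m k) (H k) d) <= e%:E)%E.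
Proof.
move=> d0 Hoo e0.
have e20 : 0 < e / 2 by rewrite divr_gt0.
(* Chosen so that the tail correction is d / 4, half of the gain d / 2 provided by the threshold. *)
pose c := d / (8 * (2 + d)).
have c0 : 0 < c by rewrite divr_gt0// mulr_gt0//; lra.
have cd : (2 + d) * (2 * c) = d / 4 by rewrite /c; field; rewrite gt_eqF//; lra.
have c1 : c <= 1 / 8.
  by rewrite /c ler_pdivrMr ?mulr_gt0//; lra.
near=> k.
have n0 : (0 < n k)%N by near: k; exact: near_n_gt0.
have m0 : (0 < m k)%N by near: k; exact: near_m_gt0.
have N0 : (0 < k.1)%N by exact: leq_trans (nN k).
have M0 : (0 < k.2)%N by exact: leq_trans (mM k).
have N16 : 16 <= k.1%:R :> R by near: k; exact: near_natr.
have M1 : 1 <= k.2%:R :> R by rewrite ler1n.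
have /andP[G0 G1] : log_count k <= log_rects k <= (1 + 1) * log_count k.
  by near: k; exact: near_log_rects.
have Gpos : 1 <= log_count k by near: k; exact: near_log_count.
have GL : - ln (e / 2) * (4 / d) <= log_count k by near: k; exact: near_log_count.
have Gr : log_count k <= (c ^+ 2 / (2 + d)) * ((n k)%:R * (m k)%:R).
  near: k; apply: near_ratio; rewrite divr_gt0 ?exprn_gt0//; lra.
have HA : 1 - ln (e / 2) <= H k by near: k; move/cvgryPge: Hoo; exact.
set L := log_rects k in G0 G1 *.
have L1 : 1 <= L by exact: le_trans G0.
have d2 : 0 <= 2 + d by rewrite addr_ge0// ltW.
have TE : threshold k.1 k.2 (n k) (m k) d = Num.sqrt ((2 + d) * L) by [].
set T := threshold _ _ _ _ _ in TE *.
have T2 : T ^+ 2 = (2 + d) * L by rewrite TE sqr_sqrtr// mulr_ge0// (le_trans _ L1).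
have T0 : 0 <= T by rewrite TE sqrtr_ge0.
set K := Num.sqrt (2 * k.1%:R * k.2%:R) : R.
set r := Num.sqrt (2 * (n k)%:R * (m k)%:R) : R.
have K4 : 4 <= K.
  rewrite /K -(@ger0_norm _ (4:R))// -sqrtr_sqr ler_sqrt ?mulr_ge0//.
  have : 16 * 1 <= k.1%:R * k.2%:R :> R by rewrite ler_pM.
  by rewrite mulr1 -mulrA => h; rewrite (le_trans _ (le_trans h _)) ?ler_peMl ?mulr_ge0 ?ler1n// -natrX ler_nat.
have r2 : r ^+ 2 = 2 * (n k)%:R * (m k)%:R by rewrite sqr_sqrtr// !mulr_ge0.
have r0 : 0 < r by rewrite sqrtr_gt0 !mulr_gt0 ?ltr0n.
have Tr : T <= c * r.
  by apply: (threshold_le (ltW c0) d0 T2 G1 Gr _ T0 r0); rewrite r2 mulrA.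
have [K2 Tr2] : 2 < K /\ 2 * T < r := far_threshold K4 r0 c1 Tr.
apply: le_trans (@alpha_psi_z_le R k.1 k.2 (n k) (m k) (H k) d n0 m0 N0 M0 K2 T0 Tr2) _.
rewrite lee_fin -/K -/T -/r.
have -> : e = e / 2 + e / 2 by field.
apply: lerD; first by rewrite -[leRHS]lnK ?posrE// ler_expR lin_exponent_le.
have C0 : (0 < 'C(k.1, n k)%:R * 'C(k.2, m k)%:R :> R).
  by rewrite mulr_gt0 ?ltr0n ?bin_gt0.
rewrite -[X in X * _]lnK ?posrE// -expRD -[leRHS]lnK ?posrE// ler_expR.
rewrite -/(log_rects k) -/L.
exact: scan_exponent_le c0 c1 d0 cd L1 T0 r0 T2 Tr G0 GL.
Unshelve. all: by end_near. Qed.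

Lemma near_beta_lin (a H : nat * nat -> R) d c e : (forall k, 0 < a k) ->
  (fun k => a k ^+ 2 * Num.sqrt ((n k)%:R * (m k)%:R * p k * q k)) @ F --> +oo ->
  0 < c < 1 ->
  (\forall k \near F, H k <=
    c * (a k ^+ 2 * Num.sqrt ((n k)%:R * (m k)%:R * p k * q k) / 2)) ->
  0 < e ->
  \forall k \near F,
    (beta (n k) (m k) (a k) (@psi_z R k.1 k.2 (n k) (m k) (H k) d) <= e%:E)%E.
Proof.
move=> a0 Soo /andP[c0 c1] HS e0; near=> k.
have n0 : (0 < n k)%N by near: k; exact: near_n_gt0.
have m0 : (0 < m k)%N by near: k; exact: near_m_gt0.
have N0 : (0 < k.1)%N by exact: leq_trans (nN k).
have M0 : (0 < k.2)%N by exact: leq_trans (mM k).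
have N20 : 20 ^+ 2 <= k.1%:R :> R by near: k; exact: near_natr.
have Hk : H k <= c * (a k ^+ 2 * Num.sqrt ((n k)%:R * (m k)%:R * p k * q k) / 2).
  by near: k.
have Sk : (2 - ln e) * 10 <= a k ^+ 2 * Num.sqrt ((n k)%:R * (m k)%:R * p k * q k).
  by near: k; move/cvgryPge: Soo; exact.
apply: le_trans (beta_psi_z_le_lin (n k) (m k) (H k) d N0 M0 (ltW (a0 k))) _.
rewrite lee_fin -[leRHS]lnK ?posrE// ler_expR natrM.
set K := Num.sqrt (k.1 * k.2)%:R : R.
have K20 : 20 <= K.
  rewrite /K -(@ger0_norm _ (20:R))// -sqrtr_sqr ler_sqrt// natrM.
  have M1 : 1 <= k.2%:R :> R by rewrite ler1n.
  by apply: (le_trans N20); rewrite ler_peMr.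
have K0 : 0 < K by lra.
have E : Num.sqrt ((n k)%:R * (m k)%:R * p k * q k) = (n k)%:R * (m k)%:R / K.
  rewrite /K natrM -[RHS]ger0_norm ?divr_ge0 ?mulr_ge0 ?sqrtr_ge0//.
  rewrite -sqrtr_sqr; congr Num.sqrt.
  rewrite exprMn exprVn sqr_sqrtr ?mulr_ge0// /p /q.
  have N1 : k.1%:R != 0 :> R by rewrite pnatr_eq0 -lt0n.
  have M1 : k.2%:R != 0 :> R by rewrite pnatr_eq0 -lt0n.
  by field; rewrite N1 M1.
rewrite E in Hk Sk; set x := (n k)%:R * (m k)%:R in Hk Sk *.
set s := a k ^+ 2 * (x / K) in Hk Sk *.
have s0 : 0 <= s by rewrite mulr_ge0 ?sqr_ge0// divr_ge0 ?mulr_ge0// ltW.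
(* [K >= 20] costs the factor 10 / 11, and sqrt 2 <= 3 / 2 makes the threshold term at most 3 s / 4.
   The gap exceeds s / 10, whence the factor 10 in [Sk]. *)
have h1 : s * (10 / 11) <= a k ^+ 2 * x / (K + 2).
  have -> : a k ^+ 2 * x / (K + 2) = s * (K / (K + 2)).
    by rewrite /s; field; rewrite !gt_eqF//; lra.
  rewrite ler_wpM2l// ler_pdivlMr; last lra.
  by lra.
have s32 : Num.sqrt 2 <= 3 / 2 :> R.
  rewrite -[leRHS]ger0_norm// -sqrtr_sqr ler_sqrt ?sqr_ge0//; lra.
have h2 : Num.sqrt 2 * H k <= 3 / 4 * s.
  apply: (@le_trans _ _ (Num.sqrt 2 * (c * (s / 2)))).
    by rewrite ler_wpM2l ?sqrtr_ge0.
  have h3 : c * (s / 2) <= s / 2 by rewrite ler_piMl ?divr_ge0// ltW.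
  apply: (@le_trans _ _ (Num.sqrt 2 * (s / 2))).
    by rewrite ler_wpM2l ?sqrtr_ge0.
  apply: (@le_trans _ _ (3 / 2 * (s / 2))).
    by rewrite ler_wpM2r// divr_ge0.
  by lra.
lra.
Unshelve. all: by end_near. Qed.

Lemma near_beta_max (a H : nat * nat -> R) d g e : (forall k, 0 < a k) ->
  0 < g <= 1 -> 0 < d < g / 4 ->
  (\forall k \near F, 1 + g <= a k ^+ 2 * Num.sqrt ((n k)%:R * (m k)%:R) /
    (2 * Num.sqrt ((n k)%:R * lnp k + (m k)%:R * lnq k))) ->
  0 < e ->
  \forall k \near F,
    (beta (n k) (m k) (a k) (@psi_z R k.1 k.2 (n k) (m k) (H k) d) <= e%:E)%E.
Proof.
move=> a0 /andP[g0 g1] /andP[d0 dg] sr e0.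
have g80 : 0 < g / 8 by lra.
near=> k.
have n0 : (0 < n k)%N by near: k; exact: near_n_gt0.
have m0 : (0 < m k)%N by near: k; exact: near_m_gt0.
have /andP[_ G1] : log_count k <= log_rects k <= (1 + g / 8) * log_count k.
  by near: k; exact: near_log_rects.
have G16 : ((2 - ln e) * (2 / g)) ^+ 2 <= log_count k.
  by near: k; exact: near_log_count.
have Gpos : 1 <= log_count k by near: k; exact: near_log_count.
have nb : (16 / g) ^+ 2 <= (n k)%:R :> R by near: k; exact: near_natr.
have srk : 1 + g <= a k ^+ 2 * Num.sqrt ((n k)%:R * (m k)%:R) /
    (2 * Num.sqrt (log_count k)) by near: k.
apply: le_trans (@beta_psi_z_le_max R k.1 k.2 (n k) (m k) (H k) d (a k) n0 m0 (ltW (a0 k))) _.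
rewrite lee_fin -[leRHS]lnK ?posrE// ler_expR natrM.
set K := Num.sqrt ((n k)%:R * (m k)%:R) : R.
rewrite -/K in srk.
have gi0 : 0 < 16 / g by rewrite divr_gt0.
have Kg : 16 / g <= K.
  rewrite /K -(ger0_norm (ltW gi0)) -sqrtr_sqr ler_sqrt ?mulr_ge0//.
  have M1 : 1 <= (m k)%:R :> R by rewrite ler1n.
  by apply: (le_trans nb); rewrite ler_peMr.
have K0 : 0 < K by exact: lt_le_trans Kg.
have K2 : K ^+ 2 = (n k)%:R * (m k)%:R by rewrite sqr_sqrtr// mulr_ge0.
set s := Num.sqrt (log_count k) in srk.
have s1 : (2 - ln e) * (2 / g) <= s.
  apply: (le_trans (ler_norm _)).
  by rewrite -sqrtr_sqr ler_wsqrtr.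
have s0 : 0 < s by rewrite sqrtr_gt0; lra.
have s2 : s ^+ 2 = log_count k by rewrite sqr_sqrtr//; lra.
(* The margin g is shared out: the drift keeps 1 + 3 g / 4 because K g >= 16, the threshold takes 1
   + g / 2, and the remaining g / 4, times 2 s, covers 2 - ln e. *)
have h1 : (1 + g / 2 + g / 4) * (2 * s) <= a k ^+ 2 * ((n k)%:R * (m k)%:R) / (K + 2).
  rewrite -K2.
  have -> : a k ^+ 2 * K ^+ 2 / (K + 2) = a k ^+ 2 * K / (2 * s) * (K / (K + 2)) * (2 * s).
    by field; rewrite !gt_eqF//; lra.
  rewrite ler_wpM2r ?mulr_ge0 ?(ltW s0)//.
  apply: (@le_trans _ _ ((1 + g) * (K / (K + 2)))); last first.
    by rewrite ler_wpM2r// divr_ge0//; lra.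
  rewrite mulrA ler_pdivlMr; last lra.
  have : 16 <= K * g by rewrite -ler_pdivrMr.
  nra.
have h2 : Num.sqrt 2 * threshold k.1 k.2 (n k) (m k) d <= (1 + g / 2) * (2 * s).
  rewrite /threshold -/(log_rects k) -sqrtrM//.
  apply: sqrtr_le_sqr; first by rewrite mulr_ge0 ?mulr_ge0 ?(ltW s0)//; lra.
  rewrite exprMn [X in _ <= _ * X]exprMn s2.
  apply: (@le_trans _ _ (2 * ((2 + d) * ((1 + g / 8) * log_count k)))).
    by rewrite ler_wpM2l// ler_wpM2l//; lra.
  have -> : 2 * ((2 + d) * ((1 + g / 8) * log_count k)) =
    2 * (2 + d) * (1 + g / 8) * log_count k by ring.
  rewrite mulrA ler_wpM2r//; first lra.
  nra.
have h3 : 2 - ln e <= g / 2 * s.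
  by rewrite -ler_pdivrMl ?divr_gt0// invf_div mulrC.
nra.
Unshelve. all: by end_near. Qed.

Lemma upper_bound (a : nat * nat -> R) : (forall k, 0 < a k) ->
  let signal := fun k => a k ^+ 2 * Num.sqrt ((n k)%:R * (m k)%:R * p k * q k) in
  signal @ F --> +oo \/
  (1 < limf_einf (fun k => (a k ^+ 2 * Num.sqrt ((n k)%:R * (m k)%:R) /
    (2 * Num.sqrt ((n k)%:R * lnp k + (m k)%:R * lnq k)))%:E) F)%E ->
  exists2 delta0 : R, 0 < delta0 &
    forall delta : R, 0 < delta < delta0 ->
    forall H : nat * nat -> R, H @ F --> +oo ->
      (signal @ F --> +oo -> exists2 c : R, 0 < c < 1 &
         \forall k \near F, H k <= c * (signal k / 2)) ->
      (fun k => gamma (n k) (m k) (a k)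
         (@psi_z R k.1 k.2 (n k) (m k) (H k) delta)) @ F --> 0%E.
Proof.
move=> a0 signal hyp.
(* The first error vanishes for every positive delta, so [delta0] is dictated by the second error
   alone. *)
suff [d0 d00 hb] : exists2 delta0 : R, 0 < delta0 &
    forall delta : R, 0 < delta < delta0 ->
    forall H : nat * nat -> R,
      (signal @ F --> +oo -> exists2 c : R, 0 < c < 1 &
         \forall k \near F, H k <= c * (signal k / 2)) ->
      forall e, 0 < e -> \forall k \near F,
    (beta (n k) (m k) (a k) (@psi_z R k.1 k.2 (n k) (m k) (H k) delta) <= e%:E)%E.
  exists d0 => // d dd0 H Hoo Hc; have /andP[dpos _] := dd0.
  apply: cvg_EFin_near => e e0; have e20 : 0 < e / 2 by rewrite divr_gt0.
  have A := near_alpha_psi_z dpos Hoo e20.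
  have B := hb d dd0 H Hc _ e20.
  near=> k.
  have Ak : (alpha (@psi_z R k.1 k.2 (n k) (m k) (H k) d) <= (e / 2)%:E)%E by near: k.
  have Bk : (beta (n k) (m k) (a k) (@psi_z R k.1 k.2 (n k) (m k) (H k) d) <=
     (e / 2)%:E)%E by near: k.
  have p01 y : 0 <= @psi_z R k.1 k.2 (n k) (m k) (H k) d y <= 1.
    by rewrite psi_zE ler0n lern1 leq_b1.
  apply/andP; split.
    apply: (@le_trans _ _ 0%E); first by rewrite lee_fin; lra.
    rewrite adde_ge0// ?beta_ge0// => [|y].
      by apply: expect_ge0 => y; have /andP[] := p01 y.
    by have /andP[] := p01 y.
  have -> : 0 + e = e / 2 + e / 2 by field.
  by rewrite EFinD leeD.
case: hyp => [Soo|/ereal_between[g g0 gl]].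
  (* Under (i) the linear test detects by itself, whatever delta; the value 1 is arbitrary. *)
  exists 1 => // d /andP[d0 _] H Hc e e0.
  have [c c01 Hk] := Hc Soo.
  exact: near_beta_lin Soo c01 Hk e0.
pose g' := Num.min g 1.
have g'0 : 0 < g' <= 1 by rewrite lt_min g0 ltr01 ge_min lexx orbT.
exists (g' / 4); first by have /andP[? _] := g'0; rewrite divr_gt0.
move=> d dg H _ e e0; apply: near_beta_max g'0 dg _ e0 => //.
apply: filterS (limf_einf_gt_near gl) => k; rewrite lte_fin => /ltW; apply: le_trans.
by rewrite lerD2l ge_min lexx.
Unshelve. all: by end_near. Qed.

End rates.

(** * Exchange of integrals and subset averages *)

Section integral_average.
Context {d : measure_display} {T : measurableType d} {R : realType}
  {P : probability T R} {N n : nat}.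
Implicit Types (F : {set 'I_N} -> T -> R) (c : {set 'I_N} -> R) (A : {set 'I_N}).
Local Open Scope ereal_scope.

Lemma measurable_avg F : (forall A, measurable_fun setT (F A)) ->
  measurable_fun setT (fun y => avg n (F ^~ y)).
Proof. by move=> mF; apply: measurable_funM => //; exact: measurable_sum_cond. Qed.

Lemma integral_avg F : (forall A, measurable_fun setT (F A)) ->
  (forall A y, 0 <= F A y)%R ->
  \int[P]_y (avg n (F ^~ y))%:E =
  ('C(N, n)%:R^-1)%:E * \sum_(A : {set 'I_N} | #|A| == n) \int[P]_y (F A y)%:E.
Proof.
move=> mF F0; rewrite /avg.
have mFE A : measurable_fun setT (fun y => (F A y)%:E) by exact/measurable_EFinP.
under eq_integral do rewrite EFinM -sumEFin -big_filter.
rewrite ge0_integralZl//.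
- by rewrite ge0_integral_sum// ?big_filter// => A y _; rewrite lee_fin.
- exact: emeasurable_sum.
- by move=> y _; apply: sume_ge0 => A _; rewrite lee_fin.
Qed.

Lemma le_integral_avg F c : (forall A, measurable_fun setT (F A)) ->
  (forall A y, 0 <= F A y)%R ->
  (forall A, #|A| = n -> \int[P]_y (F A y)%:E <= (c A)%:E) ->
  \int[P]_y (avg n (F ^~ y))%:E <= (avg n c)%:E.
Proof.
move=> mF F0 Fc; rewrite integral_avg// /avg EFinM lee_wpmul2l ?lee_fin ?invr_ge0//.
by rewrite -sumEFin; apply: lee_sum => A /eqP/Fc.
Qed.

Lemma ge_integral_avg F c : (forall A, measurable_fun setT (F A)) ->
  (forall A y, 0 <= F A y)%R ->
  (forall A, #|A| = n -> (c A)%:E <= \int[P]_y (F A y)%:E) ->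
  (avg n c)%:E <= \int[P]_y (avg n (F ^~ y))%:E.
Proof.
move=> mF F0 Fc; rewrite integral_avg// /avg EFinM lee_wpmul2l ?lee_fin ?invr_ge0//.
by rewrite -sumEFin; apply: lee_sum => A /eqP/Fc.
Qed.

End integral_average.

(** * The Bayesian mixture over rectangles and signs *)

Section bayes.
Context {R : realType} {N M : nat}.
Local Notation noise := (noise_law R N M).
Local Notation cell := ('I_N * 'I_M)%type.
Implicit Types (y : obs R N M) (n m : nat) (a b : R) (S : 'M[R]_(N, M))
  (A : {set 'I_N}) (B : {set 'I_M}) (C : {set cell}).

(** Signs are attached to all cells, even outside [C] where they have no effect, so that the number
    2^(N M) of patterns is the same for every rectangle. *)
Definition signed_alt a C (e : {ffun cell -> bool}) : 'M[R]_(N, M) :=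
  \matrix_(i, j) if (i, j) \in C then (if e (i, j) then a else - a) else 0.

(** The sum over sign patterns of a product over cells is a product of sums over one sign; in [C]
    such a sum is twice [pixel], elsewhere it is 2. *)
Lemma sum_signed_alt a C y :
  \sum_(e : {ffun cell -> bool}) \prod_(i < N) \prod_(j < M)
    expR (signed_alt a C e i j * entry y i j - signed_alt a C e i j ^+ 2 / 2) =
  2 ^+ (N * M) * lik a C y.
Proof.
pose F (c : cell) (b : bool) : R := if c \in C then
  expR ((if b then a else - a) * entry y c.1 c.2 - a ^+ 2 / 2) else 1.
transitivity (\prod_(c : cell) \sum_(b : bool) F c b).
  rewrite bigA_distr_bigA/=; apply: eq_bigr => e _.
  rewrite [RHS]prod_cellE; apply: eq_bigr => i _; apply: eq_bigr => j _ /=.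
  rewrite /F mxE; case: ifP => _; last by rewrite mul0r expr0n/= mul0r subr0 expR0.
  by case: (e (i, j)); rewrite ?sqrrN.
have -> : 2 ^+ (N * M) = \prod_(c : cell) 2 :> R.
  by rewrite prodr_const card_prod !card_ord.
rewrite likE -big_split/=.
apply: eq_bigr => c _; rewrite big_bool/= /F; case: ifP => _; last by rewrite mulr1.
by rewrite /pixel /coshR !expRD mulNr; field.
Qed.

Local Open Scope ereal_scope.

(** Every sign pattern gives a matrix of the alternative, with error at most b. By the
    Cameron-Martin formula the mean of these errors over the patterns is the left-hand side. *)
Lemma lik_miss_le n m a b (g : obs R N M -> R) A B : (0 <= a)%R ->
  measurable_fun setT g -> (forall y, 0 <= g y)%R ->
  #|A| = n -> #|B| = m ->
  (forall S, alternatives n m a S -> expect S g <= b%:E) ->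
  \int[noise]_y (g y * lik a (finset.setX A B) y)%:E <= b%:E.
Proof.
move=> a0 mg g0 An Bm hS; set C := finset.setX A B.
pose w e y := (\prod_(i < N) \prod_(j < M)
    expR (signed_alt a C e i j * entry y i j - signed_alt a C e i j ^+ 2 / 2))%R.
have mw e : measurable_fun setT (w e).
  apply: (measurable_prod_entry (f := fun i j x =>
    expR (signed_alt a C e i j * x - signed_alt a C e i j ^+ 2 / 2))) => i j.
  apply: measurableT_comp => //.
  by apply: measurable_funB => //; exact: measurable_funM.
have w0 e y : (0 <= w e y)%R.
  by apply: prodr_ge0 => i _; apply: prodr_ge0 => j _; exact: expR_ge0.
have we e : \int[noise]_y (g y * w e y)%:E <= b%:E.
  apply: le_trans (hS (signed_alt a C e) _); last first.
    exists C; first by apply: imset2_f; rewrite inE ?An ?Bm.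
    move=> i j; rewrite mxE; case: ifP => //= _; split=> // _.
    by case: (e _); rewrite ?normrN ler_norm.
  rewrite /expect (@integral_noise_shift _ _ _ _ (fun y => (g y)%:E))//; last first.
    exact/measurable_EFinP.
have k0 : (0 < 2 ^+ (N * M) :> R)%R by rewrite exprn_gt0.
rewrite -(@lee_pmul2l _ (2 ^+ (N * M))%:E)//.
rewrite -ge0_integralZl//; last 2 first.
- apply/measurable_EFinP; apply: measurable_funM => //; exact: measurable_lik.
- by move=> y _; rewrite lee_fin mulr_ge0// ltW// lik_gt0.
rewrite (_ : integral _ _ _ = \int[noise]_y (\sum_(e : {ffun cell -> bool}) (g y * w e y)%:E)).
  rewrite ge0_integral_sum//.
    apply: (@le_trans _ _ (\sum_(e : {ffun cell -> bool}) b%:E)); first exact: lee_sum.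
    rewrite sumEFin -EFinM lee_fin sumr_const card_ffun card_bool card_prod !card_ord.
    by rewrite -[leLHS]mulr_natl natrX.
  by move=> e; apply/measurable_EFinP; exact: measurable_funM.
  by move=> e y _; rewrite lee_fin mulr_ge0.
apply: eq_integral => y _; rewrite sumEFin -EFinM; congr EFin.
by rewrite -mulr_sumr sum_signed_alt mulrCA.
Qed.

Definition mix n m a y : R := avg n (fun A => avg m (fun B => lik a (finset.setX A B) y)).

Lemma mix_miss_le n m a b (g : obs R N M -> R) : (0 <= a)%R ->
  (n <= N)%N -> (m <= M)%N ->
  measurable_fun setT g -> (forall y, 0 <= g y)%R ->
  (forall S, alternatives n m a S -> expect S g <= b%:E) ->
  \int[noise]_y (g y * mix n m a y)%:E <= b%:E.
Proof.
move=> a0 nN mM mg g0 hS.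
have E y : (g y * mix n m a y = avg n (fun A => avg m (fun B => g y * lik a (finset.setX A B) y)))%R.
  by rewrite /mix -avgZ; congr avg; apply/funext => A; rewrite avgZ.
under eq_integral do rewrite E.
have mgl A B : measurable_fun setT (fun y => g y * lik a (finset.setX A B) y)%R.
  by apply: measurable_funM => //; exact: measurable_lik.
have gl0 A B y : (0 <= g y * lik a (finset.setX A B) y)%R.
  by rewrite mulr_ge0// ltW// lik_gt0.
rewrite -(avg_cst b nN).
apply: (le_integral_avg (F := fun A y => avg m (fun B => g y * lik a (finset.setX A B) y)%R)).
- move=> A; exact: (measurable_avg (F := fun B y => g y * lik a (finset.setX A B) y)%R).
- by move=> A y; exact: avg_ge0.
- move=> A An; rewrite -(avg_cst b mM).
  apply: (le_integral_avg (F := fun B y => g y * lik a (finset.setX A B) y)%R) => //.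
  by move=> B Bm; exact: lik_miss_le An Bm hS.
Qed.

End bayes.

(** * Truncated likelihood ratios *)

Section truncation.
Context {R : realType} {N M : nat} (a : R) (Tr : nat -> nat -> R)
  (big : nat -> nat -> bool).
Local Notation noise := (noise_law R N M).
Local Notation cell := ('I_N * 'I_M)%type.
Local Notation rect := ({set 'I_N} * {set 'I_M})%type.
Implicit Types (y : obs R N M) (A : {set 'I_N}) (B : {set 'I_M}) (V : rect).

Let likV V y := lik a (finset.setX V.1 V.2) y.

Definition big_subrect A B V := [&& V.1 \subset A, V.2 \subset B & big #|V.1| #|V.2|].

(* The likelihood ratio of a rectangle is truncated where that of one of its
   large subrectangles exceeds its threshold. *)
Definition trunc A B y : R :=
  \prod_(V | big_subrect A B V) (likV V y <= expR (Tr #|V.1| #|V.2|))%R%:R.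

Lemma trunc_ge0 A B y : 0 <= trunc A B y.
Proof. exact: prodr_ge0. Qed.

Lemma trunc_le1 A B y : trunc A B y <= 1.
Proof.
suff /andP[] : 0 <= trunc A B y <= 1 by [].
apply: (big_ind (fun x : R => 0 <= x <= 1)) => [|x z|V _].
- by rewrite ler01 lexx.
- by move=> /andP[x0 x1] /andP[z0 z1]; rewrite mulr_ge0// mulr_ile1.
- by rewrite ler0n lern1 leq_b1.
Qed.

Lemma trunc_miss_le A B y :
  1 - trunc A B y <=
  \sum_(V | big_subrect A B V) (expR (Tr #|V.1| #|V.2|) < likV V y)%R%:R.
Proof.
have [h|/forallPn[V]] := boolP [forall V, big_subrect A B V ==> (likV V y <= expR (Tr #|V.1| #|V.2|))].
  rewrite /trunc big1 ?subrr ?sumr_ge0// => V bV.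
  by move/forallP: h => /(_ V); rewrite bV /= => ->.
rewrite negb_imply -ltNge => /andP[bV lV].
rewrite (bigD1 V)//= lV; have := trunc_ge0 A B y.
have : 0 <= \sum_(i | big_subrect A B i && (i != V)) (expR (Tr #|i.1| #|i.2|) < likV i y)%R%:R :> R.
  exact: sumr_ge0.
set x := \sum_(_ | _) _; set z := trunc _ _ _ => x0 z0.
have -> : true%:R = 1 :> R by [].
lra.
Qed.

Lemma trunc_le_big A B V y : big_subrect A B V ->
  trunc A B y <= (likV V y <= expR (Tr #|V.1| #|V.2|))%R%:R.
Proof.
move=> bV; have [_|h] := leP (likV V y); first exact: trunc_le1.
by rewrite /trunc (bigD1 V)//= (lt_geF h) mul0r.
Qed.

Lemma measurable_trunc A B : measurable_fun setT (trunc A B).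
Proof.
rewrite /trunc; under eq_fun do rewrite -big_filter.
apply: measurable_prod => V _; apply: measurable_natr_bool.
by apply: measurable_fun_ler => //; exact: measurable_lik.
Qed.

Definition tlik A B y : R := lik a (finset.setX A B) y * trunc A B y.

Lemma tlik_ge0 A B y : 0 <= tlik A B y.
Proof. by rewrite mulr_ge0 ?trunc_ge0// ltW// lik_gt0. Qed.

Lemma tlik_le A B y : tlik A B y <= lik a (finset.setX A B) y.
Proof. by rewrite ler_piMr ?trunc_le1// ltW// lik_gt0. Qed.

Lemma measurable_tlik A B : measurable_fun setT (tlik A B).
Proof. by apply: measurable_funM; [exact: measurable_lik|exact: measurable_trunc]. Qed.

Local Open Scope ereal_scope.

(** The bound of [integral_lik_gt] at level [Tr x z] for a subrectangle of x rows and z columns. *)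
Definition overflow t (x z : nat) : R :=
  expR (- (t * Tr x z)) *
  expR (t * (1 + t) / 4 * a ^+ 4 * expR (2 * a ^+ 2)) ^+ (x * z).

(** The mass removed is at most the sum, over the large subrectangles, of the probability under the
    law of the rectangle that the cutoff is exceeded. *)
Lemma integral_tlik_ge A B t : (0 < t < 1)%R ->
  (1 - \sum_(V | big_subrect A B V) overflow t #|V.1| #|V.2|)%:E <=
  \int[noise]_y (tlik A B y)%:E.
Proof.
move=> t01; set C := finset.setX A B.
pose O V y := (lik a C y * (expR (Tr #|V.1| #|V.2|) < likV V y)%R%:R)%R.
have mO V : measurable_fun setT (O V).
  apply: measurable_funM; first exact: measurable_lik.
  apply: measurable_natr_bool.
  by apply: measurable_fun_ltr => //; exact: measurable_lik.
have O0 V y : (0 <= O V y)%R by rewrite mulr_ge0// ltW// lik_gt0.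
have h : 1 <= \int[noise]_y (tlik A B y)%:E +
    \sum_(V | big_subrect A B V) \int[noise]_y (O V y)%:E.
  rewrite -[leLHS](integral_lik a C) -big_filter -ge0_integral_sum//; last 2 first.
  - by move=> V; exact/measurable_EFinP.
  - by move=> V y _; rewrite lee_fin.
  rewrite -ge0_integralD//; last 4 first.
  - by move=> y _; rewrite lee_fin tlik_ge0.
  - by apply/measurable_EFinP; exact: measurable_tlik.
  - by move=> y _; apply: sume_ge0 => V _; rewrite lee_fin.
  - by apply: emeasurable_sum => V; exact/measurable_EFinP.
  apply: ge0_le_integral => //.
  - by move=> y _; rewrite lee_fin ltW// lik_gt0.
  - by apply/measurable_EFinP; exact: measurable_lik.
  - apply: emeasurable_funD; first by apply/measurable_EFinP; exact: measurable_tlik.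
    by apply: emeasurable_sum => V; exact/measurable_EFinP.
  - move=> y _; rewrite sumEFin -EFinD lee_fin big_filter -mulr_sumr /tlik -mulrDr.
    rewrite ler_peMr ?(ltW (lik_gt0 _ _ _))// addrC -lerBlDr.
    exact: trunc_miss_le.
have : \sum_(V | big_subrect A B V) \int[noise]_y (O V y)%:E <=
    (\sum_(V | big_subrect A B V) overflow t #|V.1| #|V.2|)%:E.
  rewrite -sumEFin; apply: lee_sum => V /and3P[VA VB bV].
  rewrite /overflow -cardsX; apply: integral_lik_gt => //.
  by apply/fintype.subsetP => -[i j]; rewrite !inE => /andP[/(fintype.subsetP VA) -> /(fintype.subsetP VB) ->].
move=> h2; rewrite EFinB leeBlDr//.
by apply: (le_trans h); rewrite leeD2l.
Qed.

Definition overlap_bound (x z : nat) : R :=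
  (if big x z then expR (Tr x z) else coshR (a ^+ 2) ^+ (x * z))%R.

(** The product of the two ratios is that of the overlap times that of the union. A large overlap is
    itself a tested subrectangle, so truncation bounds its ratio by the cutoff and the union
    integrates to 1. For other overlaps the truncation is dropped and the plain second moment
    remains. *)
Lemma integral_tlik_mul A B A' B' :
  \int[noise]_y (tlik A B y * tlik A' B' y)%:E <=
  (overlap_bound #|A :&: A'| #|B :&: B'|)%:E.
Proof.
set C := finset.setX A B; set C' := finset.setX A' B'.
have CC : C :&: C' = finset.setX (A :&: A') (B :&: B').
  by apply/setP => -[i j]; rewrite !inE; case: (i \in A); case: (j \in B);
    case: (i \in A'); case: (j \in B').
have mt : measurable_fun setT (fun y => (tlik A B y * tlik A' B' y)%:E).
  by apply/measurable_EFinP; apply: measurable_funM; exact: measurable_tlik.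
have t0 y : [set: obs R N M] y -> 0 <= (tlik A B y * tlik A' B' y)%:E.
  by move=> _; rewrite lee_fin mulr_ge0// tlik_ge0.
rewrite /overlap_bound; case: ifPn => [bg|_].
  rewrite -[X in X%:E]mulr1 EFinM -[X in _ * X](integral_lik a (C :|: C')).
  rewrite -ge0_integralZl//; last 2 first.
  - by apply/measurable_EFinP; exact: measurable_lik.
  - by move=> y _; rewrite lee_fin ltW// lik_gt0.
  apply: ge0_le_integral => //.
  - apply: emeasurable_funM => //; apply/measurable_EFinP; exact: measurable_lik.
  move=> y _; rewrite -EFinM lee_fin.
  pose V := (A :&: A', B :&: B').
  have bV : big_subrect A B V by rewrite /big_subrect/= !finset.subsetIl.
  have bV' : big_subrect A' B' V by rewrite /big_subrect/= !finset.subsetIr.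
  have := trunc_le_big y bV; rewrite /likV/= -CC.
  have -> : (tlik A B y * tlik A' B' y =
     lik a (C :|: C') y * (lik a (C :&: C') y * (trunc A B y * trunc A' B' y)))%R.
    by rewrite /tlik mulrACA lik_mulIU -[LHS]mulrA mulrCA.
  move=> tb; rewrite [leRHS]mulrC ler_pM2l ?lik_gt0//.
  have [le|lt] := leP (lik a (C :&: C') y) (expR (Tr #|A :&: A'| #|B :&: B'|)); last first.
    move: tb; rewrite (lt_geF lt) => tb.
    have -> : trunc A B y = 0%R by apply/eqP; rewrite eq_le tb trunc_ge0.
    by rewrite mul0r mulr0 expR_ge0.
  apply: le_trans le; rewrite ler_piMr ?(ltW (lik_gt0 _ _ _))//.
  by rewrite mulr_ile1 ?trunc_ge0 ?trunc_le1.
rewrite -cardsX -CC -integral_lik_mul; apply: ge0_le_integral => //.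
- by apply/measurable_EFinP; apply: measurable_funM; exact: measurable_lik.
- by move=> y _; rewrite lee_fin ler_pM ?tlik_ge0 ?tlik_le.
Qed.

End truncation.

(** * From two moments of the truncated mixture to the risk *)

Section reduction.
Context {R : realType} {N M : nat} (n m : nat) (a : R) (Tr : nat -> nat -> R)
  (big : nat -> nat -> bool).
Local Notation noise := (noise_law R N M).
Implicit Types (y : obs R N M) (A : {set 'I_N}) (B : {set 'I_M}).
Context (nN : (n <= N)%N) (mM : (m <= M)%N).

Let tl A B y := tlik a Tr big A B y.

Definition tmix y : R := avg n (fun A => avg m (fun B => tl A B y)).

Lemma tmix_ge0 y : 0 <= tmix y.
Proof. by apply: avg_ge0 => A; apply: avg_ge0 => B; exact: tlik_ge0. Qed.

Lemma tmix_le y : tmix y <= mix n m a y.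
Proof. by apply: le_avg => A _; apply: le_avg => B _; exact: tlik_le. Qed.

Lemma measurable_tmix : measurable_fun setT tmix.
Proof.
apply: (measurable_avg (F := fun A y => avg m (fun B => tl A B y))) => A.
by apply: (measurable_avg (F := fun B y => tl A B y)) => B; exact: measurable_tlik.
Qed.

Lemma measurable_mix : measurable_fun setT (@mix R N M n m a).
Proof.
apply: (measurable_avg (F := fun A y => avg m (fun B => lik a (finset.setX A B) y))) => A.
by apply: (measurable_avg (F := fun B y => lik a (finset.setX A B) y)) => B; exact: measurable_lik.
Qed.

Lemma mix_ge0 y : 0 <= mix n m a y.
Proof. exact: le_trans (tmix_ge0 y) (tmix_le y). Qed.

Local Open Scope ereal_scope.

Lemma integral_tmix_ge t (d1 : R) : (0 < t < 1)%R ->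
  (forall A B, #|A| = n -> #|B| = m ->
     \sum_(V | big_subrect big A B V) overflow a Tr t #|V.1| #|V.2| <= d1)%R ->
  (1 - d1)%:E <= \int[noise]_y (tmix y)%:E.
Proof.
move=> t01 hd; rewrite -(avg_cst (1 - d1)%R nN).
apply: (ge_integral_avg (F := fun A y => avg m (fun B => tl A B y))).
- by move=> A; apply: (measurable_avg (F := fun B y => tl A B y)) => B; exact: measurable_tlik.
- by move=> A y; apply: avg_ge0 => B; exact: tlik_ge0.
move=> A An; rewrite -(avg_cst (1 - d1)%R mM).
apply: (ge_integral_avg (F := fun B y => tl A B y)).
- by move=> B; exact: measurable_tlik.
- by move=> B y; exact: tlik_ge0.
move=> B Bm; apply: le_trans (integral_tlik_ge _ _ _ _ _ t01).
by rewrite lee_fin lerD2l lerN2 hd.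
Qed.

Lemma integral_tmix_sqr_le (d2 : R) :
  (forall A B, #|A| = n -> #|B| = m ->
     avg n (fun A' => avg m (fun B' =>
       overlap_bound a Tr big #|A :&: A'| #|B :&: B'|)) <= 1 + d2)%R ->
  \int[noise]_y (tmix y ^+ 2)%:E <= (1 + d2)%:E.
Proof.
move=> hd.
have mtl A B : measurable_fun setT (tl A B) by exact: measurable_tlik.
have tl0 A B y : (0 <= tl A B y)%R by exact: tlik_ge0.
have E y : (tmix y ^+ 2 = avg n (fun A => avg m (fun B =>
    avg n (fun A' => avg m (fun B' => tl A B y * tl A' B' y)))))%R.
  rewrite expr2 {1}/tmix mulrC -avgZ; congr avg; apply/funext => A.
  rewrite -avgZ; congr avg; apply/funext => B.
  rewrite mulrC -avgZ; congr avg; apply/funext => A'.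
  by rewrite -avgZ.
under eq_integral do rewrite E.
have mp A B A' B' : measurable_fun setT (fun y => tl A B y * tl A' B' y)%R.
  exact: measurable_funM.
have mp1 A B A' : measurable_fun setT (fun y => avg m (fun B' => tl A B y * tl A' B' y))%R.
  by apply: (measurable_avg (F := fun B' y => tl A B y * tl A' B' y)%R) => B'.
have mp2 A B : measurable_fun setT (fun y => avg n (fun A' => avg m (fun B' => tl A B y * tl A' B' y)))%R.
  by apply: (measurable_avg (F := fun A' y => avg m (fun B' => tl A B y * tl A' B' y))%R) => A'.
have mp3 A : measurable_fun setT (fun y => avg m (fun B => avg n (fun A' => avg m (fun B' => tl A B y * tl A' B' y))))%R.
  by apply: (measurable_avg (F := fun B y => avg n (fun A' => avg m (fun B' => tl A B y * tl A' B' y)))%R) => B.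
have p0 A B A' B' y : (0 <= tl A B y * tl A' B' y)%R by rewrite mulr_ge0.
rewrite -(avg_cst (1 + d2)%R nN).
apply: (le_integral_avg (F := fun A y => avg m (fun B =>
    avg n (fun A' => avg m (fun B' => tl A B y * tl A' B' y))))%R) => //.
  by move=> A y; do 3 (apply: avg_ge0 => ?).
move=> A An; rewrite -(avg_cst (1 + d2)%R mM).
apply: (le_integral_avg (F := fun B y =>
    avg n (fun A' => avg m (fun B' => tl A B y * tl A' B' y)))%R) => //.
  by move=> B y; do 2 (apply: avg_ge0 => ?).
move=> B Bm; have := hd A B An Bm; rewrite -lee_fin; apply: le_trans.
apply: (le_integral_avg (F := fun A' y => avg m (fun B' => tl A B y * tl A' B' y))%R) => //.
  by move=> A' y; apply: avg_ge0 => ?.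
move=> A' _.
apply: (le_integral_avg (F := fun B' y => tl A B y * tl A' B' y)%R) => //.
by move=> B' _; exact: integral_tlik_mul.
Qed.

(** For [psi] in [0, 1], [psi] + (1 - [psi]) [mix] is at least min (1, [mix]), hence at least min
    (1, [tmix]). With c = 1 / (2 e) the concave parabola 1 + c x - e - c (1 + x^2) / 2 lies below
    min (1, x), touching the line x at 1 - 2 e. Its mean needs only two moments of [tmix] and is at
    least 1 - e - c (d2 + 2 d1) / 2. *)
Lemma risk_ge (psi : obs R N M -> R) t (d1 d2 e : R) : (0 <= a)%R -> is_test psi -> (0 < t < 1)%R ->
  (forall A B, #|A| = n -> #|B| = m ->
     \sum_(V | big_subrect big A B V) overflow a Tr t #|V.1| #|V.2| <= d1)%R ->
  (forall A B, #|A| = n -> #|B| = m ->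
     avg n (fun A' => avg m (fun B' =>
       overlap_bound a Tr big #|A :&: A'| #|B :&: B'|)) <= 1 + d2)%R ->
  (0 < e)%R -> (d2 + 2 * d1 <= 4 * e ^+ 2)%R ->
  (1 - 2 * e)%:E <= alpha psi + beta n m a psi.
Proof.
move=> a0 [mpsi psi01] t01 h1 h2 e0 d12.
have psi0 y : (0 <= psi y)%R by have /andP[] := psi01 y.
have psi1 y : (psi y <= 1)%R by have /andP[] := psi01 y.
have b1 : beta n m a psi <= 1.
  apply: le_beta => S _; rewrite -(@probability_setT _ _ _ noise) -[leRHS]mul1e.
  rewrite -integral_cst//; apply: ge0_le_integral => //.
  - by move=> y _; rewrite lee_fin subr_ge0.
  - apply/measurable_EFinP; apply: measurable_funB => //.
    by apply: measurableT_comp => //; exact: measurable_shift.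
  - by move=> y _; rewrite lee_fin gerBl.
have b0 : 0 <= beta n m a psi by exact: beta_ge0.
have bfin : beta n m a psi \is a fin_num.
  by rewrite ge0_fin_numE// (le_lt_trans b1)// ltry.
have alphaE : alpha psi = \int[noise]_y (psi y)%:E.
  by rewrite /alpha /expect; under eq_integral do rewrite shift0_obs.
have mix_b : \int[noise]_y ((1 - psi y) * mix n m a y)%:E <= beta n m a psi.
  rewrite -[leRHS]fineK//; apply: mix_miss_le => //.
  - exact: measurable_funB.
  - by move=> y; rewrite subr_ge0.
  - by move=> S aS; rewrite fineK//; apply: ereal_sup_ubound; exists S.
have mtm := measurable_tmix.
have mmx := measurable_mix.
pose c := (2 * e)^-1%R; have c0 : (0 < c)%R by rewrite invr_gt0 mulr_gt0.
have int1 (k : R) : \int[noise]_y k%:E = k%:E.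
  by rewrite integral_cst// [X in _ * X](@probability_setT _ _ _ noise) mule1.
have L : (1 + c * (1 - d1))%:E <= \int[noise]_y (1 + c * tmix y)%:E.
  under eq_integral do rewrite EFinD EFinM.
  rewrite ge0_integralD//; last 2 first.
  - by move=> y _; rewrite -EFinM lee_fin mulr_ge0 ?tmix_ge0// ltW.
  - by apply: emeasurable_funM => //; exact/measurable_EFinP.
  rewrite int1 EFinD leeD2l// ge0_integralZl//; last 3 first.
  - exact/measurable_EFinP.
  - by move=> y _; rewrite lee_fin tmix_ge0.
  - by rewrite lee_fin ltW.
  by rewrite EFinM lee_pmul2l// (integral_tmix_ge t01 h1).
(* The negative part of the parabola stands on the right, so that both integrands are
   nonnegative. *)
have U : \int[noise]_y (1 + c * tmix y)%:E <=
    \int[noise]_y (psi y + (1 - psi y) * mix n m a y + (e + c / 2 * (1 + tmix y ^+ 2)))%:E.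
  apply: ge0_le_integral => //.
  - by move=> y _; rewrite lee_fin addr_ge0// mulr_ge0 ?tmix_ge0// ltW.
  - apply/measurable_EFinP; apply: measurable_funD => //; exact: measurable_funM.
  - apply/measurable_EFinP; apply: measurable_funD.
      apply: measurable_funD => //; apply: measurable_funM => //; exact: measurable_funB.
    apply: measurable_funD => //; apply: measurable_funM => //.
    by apply: measurable_funD => //; exact: measurable_funX.
  move=> y _; rewrite lee_fin.
  (* AM-GM: [1 - x <= e + (1 - x)^2 / (4 e)] *)
  have am : (1 + c * tmix y - (e + c / 2 * (1 + tmix y ^+ 2)) <= tmix y)%R.
    have -> : (1 + c * tmix y - (e + c / 2 * (1 + tmix y ^+ 2)) =
       tmix y - (1 - tmix y - 2 * e) ^+ 2 * (c / 2))%R.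
      by rewrite /c; field; rewrite gt_eqF.
    by rewrite gerBl mulr_ge0 ?sqr_ge0// divr_ge0// ltW.
  have tm := tmix_le y; have m0 := mix_ge0 y; have p0 := psi0 y; have p1 := psi1 y.
  have am1 : (1 + c * tmix y - (e + c / 2 * (1 + tmix y ^+ 2)) <= 1)%R.
    have -> : (1 + c * tmix y - (e + c / 2 * (1 + tmix y ^+ 2)) =
       1 - (e + c / 2 * (1 - tmix y) ^+ 2))%R by field.
    by rewrite gerBl addr_ge0// ?(ltW e0)// mulr_ge0 ?sqr_ge0// divr_ge0// ltW.
  rewrite -lerBlDr; set z := (_ - _)%R in am am1 *.
  have : (z * psi y <= psi y)%R by rewrite ler_piMl.
  have : (z * (1 - psi y) <= (1 - psi y) * mix n m a y)%R.
    by rewrite mulrC ler_wpM2l ?subr_ge0// (le_trans am).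
  by lra.
have V : \int[noise]_y (psi y + (1 - psi y) * mix n m a y + (e + c / 2 * (1 + tmix y ^+ 2)))%:E <=
    alpha psi + beta n m a psi + (e + c / 2 * (1 + (1 + d2)))%:E.
  under eq_integral do rewrite EFinD.
  rewrite ge0_integralD//; last 4 first.
  - by move=> y _; rewrite lee_fin addr_ge0// mulr_ge0 ?subr_ge0 ?mix_ge0.
  - apply/measurable_EFinP; apply: measurable_funD => //; apply: measurable_funM => //.
    exact: measurable_funB.
  - move=> y _; rewrite lee_fin addr_ge0// ?(ltW e0)// mulr_ge0//.
      by rewrite divr_ge0// ltW.
    by rewrite addr_ge0// sqr_ge0.
  - apply/measurable_EFinP; apply: measurable_funD => //; apply: measurable_funM => //.
    by apply: measurable_funD => //; exact: measurable_funX.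
  apply: leeD.
    under eq_integral do rewrite EFinD.
    rewrite ge0_integralD//; last 4 first.
    - by move=> y _; rewrite lee_fin.
    - exact/measurable_EFinP.
    - by move=> y _; rewrite lee_fin mulr_ge0 ?subr_ge0 ?mix_ge0.
    - by apply/measurable_EFinP; apply: measurable_funM => //; exact: measurable_funB.
    by rewrite alphaE leeD2l.
  under eq_integral do rewrite EFinD EFinM EFinD.
  have m2 : measurable_fun setT (fun y => (tmix y ^+ 2)%:E).
    by apply/measurable_EFinP; exact: measurable_funX.
  rewrite ge0_integralD//; last 3 first.
  - by move=> y _; rewrite lee_fin ltW.
  - by move=> y _; rewrite -EFinD -EFinM lee_fin mulr_ge0 ?divr_ge0 ?(ltW c0)// addr_ge0// sqr_ge0.
  - by apply: emeasurable_funM => //; exact: emeasurable_funD.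
  rewrite int1 EFinD leeD2l// ge0_integralZl//; last 3 first.
  - exact: emeasurable_funD.
  - by move=> y _; rewrite -EFinD lee_fin addr_ge0// sqr_ge0.
  - by rewrite lee_fin divr_ge0// ltW.
  rewrite [in leRHS]EFinM lee_pmul2l//; last by rewrite lte_fin divr_gt0.
  rewrite ge0_integralD//; last by move=> y _; rewrite lee_fin sqr_ge0.
  by rewrite int1 EFinD leeD2l// (integral_tmix_sqr_le h2).
have := le_trans L (le_trans U V).
rewrite -leeBlDr// -EFinB; apply: le_trans; rewrite lee_fin.
have -> : (1 + c * (1 - d1) - (e + c / 2 * (1 + (1 + d2))) =
    1 - e - c / 2 * (d2 + 2 * d1))%R by field.
have : (c / 2 * (d2 + 2 * d1) <= c / 2 * (4 * e ^+ 2))%R.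
  by rewrite ler_wpM2l// divr_ge0// ltW.
have -> : (c / 2 * (4 * e ^+ 2) = e)%R by rewrite /c; field; rewrite gt_eqF.
lra.
Qed.

End reduction.

(** * Averages over large and thin overlaps *)

Section avg_pairs.
Context {R : realType} {N M : nat}.
Implicit Types (n m : nat) (A : {set 'I_N}) (B : {set 'I_M}).

Lemma avg_exchange n m (F : {set 'I_N} -> {set 'I_M} -> R) :
  avg n (fun A => avg m (F A)) = avg m (fun B => avg n (fun A => F A B)).
Proof.
rewrite /avg; under eq_bigr do rewrite mulr_sumr.
rewrite exchange_big/= mulr_sumr [RHS]mulr_sumr; apply: eq_bigr => B _.
rewrite !mulr_sumr; apply: eq_bigr => A _; exact: mulrCA.
Qed.

(** On overlaps beyond al n, passing from [lnp] to ta [lnp] in the exponent saves exp (- (1 - ta) al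
    [lnp] n) <= exp (- 2 n). At [lnp] itself the binomial bound has exponent n p (1 / p - 1) <=
    n. *)
Lemma avg_large_overlap n (al ta lnp : R) A : (n <= N)%N -> #|A| = n ->
  0 <= lnp -> n%:R / N%:R = expR (- lnp) :> R -> ta <= 1 ->
  2 <= (1 - ta) * al * lnp ->
  avg n (fun A' => if al * n%:R < #|A :&: A'|%:R
                   then expR (ta * lnp * #|A :&: A'|%:R) else 0) <=
  expR (- n%:R) :> R.
Proof.
move=> nN An lp0 pE ta1 h.
set c := expR (- ((1 - ta) * al * lnp * n%:R)).
apply: (@le_trans _ _ (avg n (fun A' => c * expR (lnp * #|A :&: A'|%:R)))).
  apply: le_avg => A' _; case: ifPn => [l|_]; last by rewrite mulr_ge0 ?expR_ge0.
  rewrite /c -expRD ler_expR -subr_ge0.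
  have -> : - ((1 - ta) * al * lnp * n%:R) + lnp * #|A :&: A'|%:R -
    ta * lnp * #|A :&: A'|%:R = (1 - ta) * lnp * (#|A :&: A'|%:R - al * n%:R) by ring.
  by rewrite !mulr_ge0// subr_ge0// ltW.
rewrite avgZ; apply: (@le_trans _ _ (c * expR n%:R)).
  rewrite ler_wpM2l ?expR_ge0//; apply: (le_trans (avg_overlap_expR nN An lp0)).
  rewrite ler_expR pE -mulrA mulrBr -expRD addNr expR0 mulr1 ler_piMr// gerBl.
rewrite /c -expRD ler_expR.
have : 2 * n%:R <= (1 - ta) * al * lnp * n%:R by rewrite ler_wpM2r.
lra.
Qed.

Lemma expR_sub1_le (x : R) : 0 <= x <= 1 / 2 -> expR x - 1 <= 2 * x.
Proof.
move=> /andP[x0 x1]; have h := expR_ge1Dx (- x).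
have : expR x * expR (- x) = 1 by rewrite -expRD subrr expR0.
have := expR_gt0 x; nra.
Qed.

(** The average over A' leaves P (exp (s z) - 1) in the exponent, where z is the overlap of the
    columns and P = n^2 / N. If s z <= 1 / 2 this is at most 2 P s z, and the average over B' gives
    the first term. Otherwise s z <= [lnp] / 2 makes it at most [lnq] / (8 s), and z > 1 / (2 s) is
    paid for by a Chernoff bound with exponent [lnq] / 2. *)
Lemma avg_small_overlap n m (s al K lnp lnq : R) A B :
  (0 < n <= N)%N -> (0 < m <= M)%N -> #|A| = n -> #|B| = m ->
  0 < s -> 0 <= lnq ->
  n%:R / N%:R = expR (- lnp) :> R ->
  s * (al * m%:R) <= lnp / 2 -> n%:R * s <= K * lnq ->
  K * expR (- lnp / 2) <= 1 / 8 ->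
  n%:R * (n%:R / N%:R) * s <= 1 / 4 ->
  avg n (fun A' => avg m (fun B' =>
    if #|B :&: B'|%:R <= al * m%:R
    then expR (s * (#|A :&: A'|%:R * #|B :&: B'|%:R)) - 1 else 0)) <=
  expR (4 * (m%:R * (m%:R / M%:R)) * (n%:R * (n%:R / N%:R) * s)) - 1 +
  expR (m%:R * (m%:R / M%:R) * expR (lnq / 2) - lnq / (8 * s)).
Proof.
move=> /andP[n0 nN] /andP[m0 mM] An Bm s0 lq0 pE sm ns Kp nps.
set P := n%:R * (n%:R / N%:R) in nps *; set Q := m%:R * (m%:R / M%:R).
have P0 : 0 <= P by rewrite mulr_ge0// divr_ge0.
have Q0 : 0 <= Q by rewrite mulr_ge0// divr_ge0.
rewrite avg_exchange.
pose F B' := expR (2 * P * s * #|B :&: B'|%:R) + (-1) +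
   expR (- (lnq / (8 * s))) * expR (lnq / 2 * #|B :&: B'|%:R) : R.
apply: (@le_trans _ _ (avg m F)); last first.
  rewrite /F avgD avgD avgZ avg_cst//; apply: lerD.
    apply: lerB => //; apply: (le_trans (avg_overlap_expR _ _ _)) => //.
      by rewrite !mulr_ge0// ltW.
    rewrite ler_expR -/Q [4 * Q]mulrC -[leRHS]mulrA ler_wpM2l//.
    apply: (le_trans (expR_sub1_le _)); last lra.
    by rewrite !mulr_ge0 ?(ltW s0)//=; lra.
  rewrite [Q * _ - _]addrC expRD ler_wpM2l ?expR_ge0//.
  apply: (le_trans (avg_overlap_expR _ _ _)) => //; first by rewrite divr_ge0.
  by rewrite ler_expR ler_wpM2l// gerBl.
apply: le_avg => B' _; rewrite /F; set z := #|B :&: B'|%:R : R.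
have z0 : 0 <= z by [].
have [zs|_] := leP z (al * m%:R); last first.
  rewrite avg_cst// addr_ge0 ?mulr_ge0 ?expR_ge0// subr_ge0.
  by rewrite -expR0 ler_expR !mulr_ge0// ltW.
rewrite avgD avg_cst//.
have sz0 : 0 <= s * z by rewrite mulr_ge0// ltW.
have h : avg n (fun A' => expR (s * (#|A :&: A'|%:R * z))) <=
    expR (P * (expR (s * z) - 1)).
  apply: le_trans (avg_overlap_expR nN An sz0).
  by apply: le_avg => A' _; rewrite ler_expR mulrA [s * z * _]mulrAC.
have [l|l] := leP (s * z) (1 / 2).
  apply: (@le_trans _ _ (expR (2 * P * s * z) + (-1))); last first.
    by rewrite lerDl mulr_ge0 ?expR_ge0.
  rewrite lerD2r (le_trans h)// ler_expR.
  have -> : 2 * P * s * z = P * (2 * (s * z)) by ring.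
  by rewrite ler_wpM2l// expR_sub1_le// sz0 l.
apply: (@le_trans _ _ (expR (- (lnq / (8 * s))) * expR (lnq / 2 * z))); last first.
  by rewrite lerDr subr_ge0 -expR0 ler_expR !mulr_ge0// ltW.
apply: (@le_trans _ _ (expR (P * expR (s * z)))).
  rewrite -[leRHS]addr0 lerD// (le_trans h)// ler_expR ler_wpM2l// gerBl//.
rewrite -expRD ler_expR.
have szp : s * z <= lnp / 2 by apply: le_trans sm; rewrite ler_wpM2l// ltW.
apply: (@le_trans _ _ (n%:R * expR (- lnp / 2))).
  rewrite /P pE -mulrA -expRD ler_wpM2l// ler_expR; lra.
have ln : n%:R <= K * lnq / s by rewrite ler_pdivlMr.
apply: (@le_trans _ _ (1 / 8 * lnq / s)).
  apply: (@le_trans _ _ (K * lnq / s * expR (- lnp / 2))).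
    by rewrite ler_wpM2r ?expR_ge0.
  have -> : K * lnq / s * expR (- lnp / 2) = K * expR (- lnp / 2) * lnq / s.
    by field; rewrite gt_eqF.
  by rewrite !ler_wpM2r// invr_ge0 ltW.
rewrite -subr_ge0.
have -> : - (lnq / (8 * s)) + lnq / 2 * z - 1 / 8 * lnq / s = lnq / s * (s * z / 2 - 1 / 4).
  by field; rewrite gt_eqF.
by rewrite mulr_ge0 ?divr_ge0 ?(ltW s0)//; lra.
Qed.

End avg_pairs.

(** * Moments of the truncated mixture with the explicit cutoff *)

Section truncated_moments.
Context {R : realType} {N M : nat} {n m : nat} {a al ta lnp lnq : R}
  {A : {set 'I_N}} {B : {set 'I_M}}.
Context (n0 : (0 < n)%N) (m0 : (0 < m)%N) (An : #|A| = n) (Bm : #|B| = m)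
  (lnp0 : 0 <= lnp) (lnq0 : 0 <= lnq).

Definition cutoff (x z : nat) : R := ta * (x%:R * lnp + z%:R * lnq).

Definition large (x z : nat) := (al * n%:R < x%:R) && (al * m%:R < z%:R).

(** At most 2^(n + m) <= exp (n + m) subrectangles occur. With k = x [lnp] + z [lnq], x <= n and z
    <= m give a^4 x z <= 4 r k; after division by t, the cutoff ta k exceeds the exponent of the
    moment of order 1 + t by c k, and k >= al G for a large subrectangle. *)
Lemma sum_overflow_le t r c : 0 < t -> 0 <= c -> 0 <= r ->
  a ^+ 4 * (n%:R * m%:R) <= 4 * r * (n%:R * lnp + m%:R * lnq) ->
  (1 + t) * expR (2 * a ^+ 2) * r + c <= ta ->
  \sum_(V | big_subrect large A B V) overflow a cutoff t #|V.1| #|V.2| <=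
  expR (n%:R + m%:R - t * c * al * (n%:R * lnp + m%:R * lnq)).
Proof.
move=> t0 c0 r0 ar rta.
set G := n%:R * lnp + m%:R * lnq in ar *.
have ov (x z : nat) : (x <= n)%N -> (z <= m)%N -> large x z ->
    overflow a cutoff t x z <= expR (- (t * c * al * G)).
  move=> xn zm /andP[lx lz]; rewrite /overflow -expRM_natl -expRD ler_expR.
  set e := expR _ in rta *.
  set k : R := x%:R * lnp + z%:R * lnq.
  have X0 : 0 <= x%:R :> R by [].
  have Z0 : 0 <= z%:R :> R by [].
  have Xn : x%:R <= n%:R :> R by rewrite ler_nat.
  have Zm : z%:R <= m%:R :> R by rewrite ler_nat.
  have nm0 : 0 < n%:R * m%:R :> R by rewrite mulr_gt0 ?ltr0n.
  have kG : al * G <= k.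
    rewrite /G /k mulrDr !mulrA lerD// ler_wpM2r// ltW//.
  have ak : a ^+ 4 * (x%:R * z%:R) <= 4 * r * k.
    have -> : a ^+ 4 * (x%:R * z%:R) = a ^+ 4 * (n%:R * m%:R) * (x%:R * z%:R / (n%:R * m%:R)).
      by field; rewrite !gt_eqF ?ltr0n.
    apply: (@le_trans _ _ (4 * r * G * (x%:R * z%:R / (n%:R * m%:R)))).
      by rewrite ler_wpM2r// divr_ge0 ?mulr_ge0.
    rewrite -[leLHS]mulrA ler_wpM2l ?mulr_ge0// mulrA ler_pdivrMr// /G /k.
    have : x%:R * z%:R * (n%:R * lnp) <= x%:R * lnp * (n%:R * m%:R).
      have -> : x%:R * z%:R * (n%:R * lnp) = x%:R * lnp * (n%:R * z%:R) by ring.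
      by rewrite !ler_wpM2l ?mulr_ge0.
    have : x%:R * z%:R * (m%:R * lnq) <= z%:R * lnq * (n%:R * m%:R).
      have -> : x%:R * z%:R * (m%:R * lnq) = z%:R * lnq * (x%:R * m%:R) by ring.
      by rewrite ler_wpM2l ?mulr_ge0// ler_wpM2r.
    lra.
  have k0 : 0 <= k by rewrite addr_ge0 ?mulr_ge0.
  have ck : c * (al * G) <= c * k by rewrite ler_wpM2l.
  have tk : ((1 + t) * e * r + c) * k <= ta * k by rewrite ler_wpM2r.
  have ek : (1 + t) / 4 * e * (a ^+ 4 * (x%:R * z%:R)) <= (1 + t) / 4 * e * (4 * r * k).
    by rewrite ler_wpM2l// mulr_ge0 ?expR_ge0// divr_ge0// addr_ge0// ltW.
  have : t * ((1 + t) / 4 * e * (a ^+ 4 * (x%:R * z%:R))) <= t * (ta * k - c * (al * G)).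
    rewrite ler_wpM2l ?(ltW t0)//; lra.
  rewrite natrM /cutoff -/k.
  have -> : x%:R * z%:R * (t * (1 + t) / 4 * a ^+ 4 * e) =
     t * ((1 + t) / 4 * e * (a ^+ 4 * (x%:R * z%:R))) by ring.
  lra.
apply: (@le_trans _ _ (\sum_(V in finset.setX (powerset A) (powerset B))
    expR (- (t * c * al * G)))).
  rewrite [leRHS]big_mkcond [leLHS]big_mkcond/=; apply: ler_sum => -[U V] _ /=.
  rewrite !inE/= /big_subrect/=.
  case: (boolP (U \subset A)) => //= UA; case: (boolP (V \subset B)) => //= VB.
  case: ifPn => [l|_]; last exact: expR_ge0.
  by apply: ov => //; [rewrite -An|rewrite -Bm]; exact: subset_leq_card.
rewrite sumr_const cardsX !card_powerset An Bm -[leLHS]mulr_natl expRD.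
rewrite ler_wpM2r ?expR_ge0// natrM expRD; apply: ler_pM => //.
  by rewrite -[n%:R]mulr1 expRM_natl natrX lerXn2r ?nnegrE ?expR_ge0// (le_trans _ (expR_ge1Dx 1)).
by rewrite -[m%:R]mulr1 expRM_natl natrX lerXn2r ?nnegrE ?expR_ge0// (le_trans _ (expR_ge1Dx 1)).
Qed.

(** Pointwise the bound is at most 1 + [T1] + [T2] + [f g]: few common columns, few common rows, or
    many of both. The cutoff being additive in rows and columns, the last term is a product and its
    average factorises. *)
Lemma avg_overlap_bound_le K : (n <= N)%N -> (m <= M)%N ->
  0 < a -> expR (a ^+ 2) <= 2 -> 0 <= al -> ta <= 1 ->
  n%:R / N%:R = expR (- lnp) :> R -> m%:R / M%:R = expR (- lnq) :> R ->
  2 <= (1 - ta) * al * lnp -> 2 <= (1 - ta) * al * lnq ->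
  m%:R * a ^+ 4 <= K * lnp -> n%:R * a ^+ 4 <= K * lnq -> al * K <= 1 / 2 ->
  K * expR (- lnp / 2) <= 1 / 8 -> K * expR (- lnq / 2) <= 1 / 8 ->
  n%:R * (n%:R / N%:R) * a ^+ 4 <= 1 / 4 ->
  m%:R * (m%:R / M%:R) * a ^+ 4 <= 1 / 4 ->
  avg n (fun A' => avg m (fun B' =>
    overlap_bound a cutoff large #|A :&: A'| #|B :&: B'|)) <=
  1 + (2 * (expR (4 * (n%:R * (n%:R / N%:R) * (m%:R * (m%:R / M%:R)) * a ^+ 4)) - 1) +
    (expR (n%:R * (n%:R / N%:R) * expR (lnp / 2) - lnp / (8 * a ^+ 4)) +
     expR (m%:R * (m%:R / M%:R) * expR (lnq / 2) - lnq / (8 * a ^+ 4))) +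
    expR (- n%:R)).
Proof.
move=> nN mM a0 a2 al0 ta1 pE qE lp lq ms ns alK Kp Kq nps mqs.
have s0 : 0 < a ^+ 4 by rewrite exprn_gt0.
pose T1 A' B' : R := if #|B :&: B'|%:R <= al * m%:R
    then expR (a ^+ 4 * (#|A :&: A'|%:R * #|B :&: B'|%:R)) - 1 else 0.
pose T2 A' B' : R := if #|A :&: A'|%:R <= al * n%:R
    then expR (a ^+ 4 * (#|B :&: B'|%:R * #|A :&: A'|%:R)) - 1 else 0.
pose f A' : R := if al * n%:R < #|A :&: A'|%:R
                   then expR (ta * lnp * #|A :&: A'|%:R) else 0.
pose g B' : R := if al * m%:R < #|B :&: B'|%:R
                   then expR (ta * lnq * #|B :&: B'|%:R) else 0.
(* Since exp (a^2) <= 2, the plain second moment costs at most exp (a^4) per common cell. *)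
have c2 : coshR (a ^+ 2) <= expR (a ^+ 4).
  have h := coshR_sub1_le (sqr_ge0 a).
  have : a ^+ 2 ^+ 2 / 2 * expR (a ^+ 2) <= a ^+ 2 ^+ 2 / 2 * 2.
    by rewrite ler_wpM2l// divr_ge0// sqr_ge0.
  have := expR_ge1Dx (a ^+ 4); rewrite -exprM; lra.
have T10 A' B' : 0 <= T1 A' B'.
  rewrite /T1; case: ifP => // _; rewrite subr_ge0 -expR0 ler_expR.
  by rewrite mulr_ge0 ?mulr_ge0// ltW.
have T20 A' B' : 0 <= T2 A' B'.
  rewrite /T2; case: ifP => // _; rewrite subr_ge0 -expR0 ler_expR.
  by rewrite mulr_ge0 ?mulr_ge0// ltW.
have f0 A' : 0 <= f A' by rewrite /f; case: ifP => // _; exact: expR_ge0.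
have g0 B' : 0 <= g B' by rewrite /g; case: ifP => // _; exact: expR_ge0.
have pt A' B' : overlap_bound a cutoff large #|A :&: A'| #|B :&: B'| <=
    1 + (T1 A' B' + T2 A' B' + f A' * g B').
  have t1 := T10 A' B'; have t2 := T20 A' B'.
  rewrite /overlap_bound; case: ifPn => [/andP[lx lz]|].
    rewrite /f /g lx lz -expRD.
    have -> : cutoff #|A :&: A'| #|B :&: B'| =
      ta * lnp * #|A :&: A'|%:R + ta * lnq * #|B :&: B'|%:R by rewrite /cutoff; ring.
    lra.
  have fg0 : 0 <= f A' * g B' by rewrite mulr_ge0.
  have cX : coshR (a ^+ 2) ^+ (#|A :&: A'| * #|B :&: B'|) <=
      expR (a ^+ 4 * (#|A :&: A'|%:R * #|B :&: B'|%:R)).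
    rewrite -natrM mulrC expRM_natl lerXn2r ?nnegrE ?expR_ge0//.
    by rewrite (le_trans _ (coshR_ge1 _)).
  rewrite negb_and -!leNgt => /orP[lx|lz].
    have : T2 A' B' = expR (a ^+ 4 * (#|A :&: A'|%:R * #|B :&: B'|%:R)) - 1.
      by rewrite /T2 lx [#|B :&: _|%:R * _]mulrC.
    lra.
  have : T1 A' B' = expR (a ^+ 4 * (#|A :&: A'|%:R * #|B :&: B'|%:R)) - 1.
    by rewrite /T1 lz.
  lra.
apply: (@le_trans _ _ (avg n (fun A' => avg m (fun B' =>
    1 + (T1 A' B' + T2 A' B' + f A' * g B'))))).
  by apply: le_avg => A' _; apply: le_avg => B' _; exact: pt.
have -> : avg n (fun A' => avg m (fun B' => 1 + (T1 A' B' + T2 A' B' + f A' * g B'))) =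
   1 + (avg n (fun A' => avg m (T1 A')) + avg m (fun B' => avg n (T2^~ B')) + avg n f * avg m g).
  rewrite -[avg m _ in RHS]avg_exchange.
  rewrite [avg n f * _]mulrC -avgZ -[X in _ = X + _](avg_cst _ nN) -!avgD.
  congr avg; apply/funext => A'.
  by rewrite [avg m g * _]mulrC -avgZ -[X in _ = X + _](avg_cst _ mM) -!avgD.
rewrite lerD2l; apply: lerD; last first.
  rewrite -[leRHS]mulr1; apply: ler_pM; rewrite ?avg_ge0//.
    exact: avg_large_overlap.
  apply: (@le_trans _ _ (expR (- m%:R))); first exact: avg_large_overlap.
  by rewrite -expR0 ler_expR oppr_le0.
have nN1 : (0 < n <= N)%N by rewrite n0.
have mM1 : (0 < m <= M)%N by rewrite m0.
have sm : a ^+ 4 * (al * m%:R) <= lnp / 2.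
  have : al * (m%:R * a ^+ 4) <= al * (K * lnp) by rewrite ler_wpM2l.
  have : al * K * lnp <= 1 / 2 * lnp by rewrite ler_wpM2r.
  by lra.
have sn : a ^+ 4 * (al * n%:R) <= lnq / 2.
  have : al * (n%:R * a ^+ 4) <= al * (K * lnq) by rewrite ler_wpM2l.
  have : al * K * lnq <= 1 / 2 * lnq by rewrite ler_wpM2r.
  by lra.
have h1 := avg_small_overlap nN1 mM1 An Bm s0 lnq0 pE sm ns Kp nps.
have h2 := avg_small_overlap mM1 nN1 Bm An s0 lnp0 qE sn ms Kq mqs.
apply: (le_trans (lerD h1 h2)).
set P := n%:R * (n%:R / N%:R); set Q := m%:R * (m%:R / M%:R).
have -> : 4 * Q * (P * a ^+ 4) = 4 * (P * Q * a ^+ 4) by ring.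
have -> : 4 * P * (Q * a ^+ 4) = 4 * (P * Q * a ^+ 4) by ring.
lra.
Qed.

End truncated_moments.

(** * A risk bound with explicit constants *)

Section risk_rates.
Context {R : realType}.

(** The first term n0 exp (- l / 2) is at most half of the second: l' <= exp (l / 4) and exp (- l /
    4) <= 1 / (16 K) bound it by n0 l / (16 K l'), whereas s <= K l' / n0 makes l / (8 s) at least
    twice that. What is left is compared with m0 through [K1]. *)
Lemma small_exponent_le (n0 m0 s K K1 l l' : R) :
  0 < n0 -> 0 < s -> 1 <= K -> 1 <= K1 -> 1 <= l -> 1 <= l' ->
  n0 * s <= K * l' -> l' <= expR (l / 4) -> expR (- (l / 4)) <= 1 / (16 * K) ->
  m0 * l' <= K1 * (n0 * l) ->
  n0 * expR (- l) * expR (l / 2) - l / (8 * s) <= - (m0 / (16 * K * K1)).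
Proof.
move=> n00 s0 K1' K11 l1 l1' ns ll el mn.
have K0 : 0 < K by lra.
have K10 : 0 < K1 by lra.
have l0 : 0 < l by lra.
have l0' : 0 < l' by lra.
have e1 : n0 * l / (8 * K * l') <= l / (8 * s).
  rewrite ler_pdivlMr ?mulr_gt0// mulrAC ler_pdivrMr ?mulr_gt0//.
  have : l * 8 * (n0 * s) <= l * 8 * (K * l') by rewrite ler_wpM2l ?mulr_ge0 ?(ltW l0).
  lra.
have e2 : n0 * expR (- l) * expR (l / 2) <= n0 * l / (16 * K * l').
  rewrite -mulrA -expRD ler_pdivlMr ?mulr_gt0// -[leLHS]mulrA ler_wpM2l ?(ltW n00)//.
  apply: (@le_trans _ _ (expR (- l + l / 2) * (16 * K * expR (l / 4)))).
    by rewrite ler_wpM2l ?expR_ge0// ler_wpM2l// mulr_ge0 ?(ltW K0).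
  rewrite mulrCA -expRD.
  have -> : - l + l / 2 + l / 4 = - (l / 4) by field.
  apply: (@le_trans _ _ (16 * K * (1 / (16 * K)))).
    by rewrite ler_wpM2l// mulr_ge0 ?(ltW K0).
  by rewrite mulrC divfK// gt_eqF// mulr_gt0.
have e3 : m0 / (16 * K * K1) <= n0 * l / (16 * K * l').
  rewrite ler_pdivrMr ?mulr_gt0// mulrAC ler_pdivlMr ?mulr_gt0//.
  have : 16 * K * (m0 * l') <= 16 * K * (K1 * (n0 * l)).
    by rewrite ler_wpM2l// mulr_ge0 ?(ltW K0).
  lra.
have e4 : n0 * l / (8 * K * l') = n0 * l / (16 * K * l') + n0 * l / (16 * K * l').
  by field; rewrite !gt_eqF.
lra.
Qed.

Lemma scan_ratio_le (b x G g : R) : 0 <= g <= 1 -> 0 <= x -> 0 < G ->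
  b ^+ 2 * Num.sqrt x / (2 * Num.sqrt G) <= 1 - g -> b ^+ 4 * x <= 4 * (1 - g) * G.
Proof.
move=> /andP[g0 g1] x0 G0; set z := b ^+ 2 * _; set y := Num.sqrt G.
have y0 : 0 < y by rewrite sqrtr_gt0.
rewrite ler_pdivrMr ?mulr_gt0// => zy.
have z0 : 0 <= z by rewrite mulr_ge0 ?sqr_ge0// sqrtr_ge0.
have -> : b ^+ 4 * x = z ^+ 2 by rewrite /z exprMn sqr_sqrtr// -exprM.
have -> : G = y ^+ 2 by rewrite /y sqr_sqrtr// ltW.
apply: (@le_trans _ _ (((1 - g) * (2 * y)) ^+ 2)).
  by rewrite ler_sqr ?nnegrE// (le_trans z0).
have -> : ((1 - g) * (2 * y)) ^+ 2 = 4 * (1 - g) * y ^+ 2 * (1 - g) by ring.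
have g1' : 0 <= 1 - g by rewrite subr_ge0.
have y20 : 0 <= 4 * (1 - g) * y ^+ 2 by apply: mulr_ge0; rewrite ?sqr_ge0// mulr_ge0.
by rewrite ler_piMr// lerBlDr lerDl.
Qed.

(** Each of two comparable terms controls their sum: a^4 n is thereby at most a constant times log
    (1 / q), and a^4 m at most a constant times log (1 / p). *)
Lemma share_le (s x z u w c : R) : 0 < z -> s * (x * z) <= 4 * (u + z * w) ->
  u <= c * (z * w) -> x * s <= 4 * (1 + c) * w.
Proof. by move=> z0 h1 h2; rewrite -(ler_pM2r z0); lra. Qed.

Lemma exp_half_le (K l : R) : 1 <= K -> 1 <= l ->
  expR (- (l / 4)) <= 1 / (16 * K) -> K * expR (- l / 2) <= 1 / 8.
Proof.
move=> K1 l1 el; apply: (@le_trans _ _ (K * (1 / (16 * K)))).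
  rewrite ler_wpM2l ?(le_trans _ K1)// (le_trans _ el)// ler_expR; lra.
have -> : K * (1 / (16 * K)) = 1 / 16 by field; rewrite gt_eqF//; lra.
lra.
Qed.

(** With exp (- l) as density, the left-hand side is at most K exp (l / 4) exp (- l), a negative
    power of exp l. *)
Lemma mass_le (K l l' b x : R) : 1 <= K -> 1 <= l -> l' <= expR (l / 4) ->
  expR (- (l / 4)) <= 1 / (16 * K) -> x * b <= K * l' -> x * expR (- l) * b <= 1 / 4.
Proof.
move=> K1 l1 ll el xb; rewrite mulrAC.
have K0 : 0 <= K by lra.
apply: (@le_trans _ _ (K * expR (l / 4) * expR (- l))).
  by rewrite ler_wpM2r ?expR_ge0// (le_trans xb)// ler_wpM2l.
rewrite -mulrA -expRD.
apply: (@le_trans _ _ (K * (1 / (16 * K)))).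
  rewrite ler_wpM2l// (le_trans _ el)// ler_expR; lra.
have -> : K * (1 / (16 * K)) = 1 / 16 by field; rewrite gt_eqF//; lra.
lra.
Qed.

Lemma risk_ge_rates {N M n m : nat} (a lnp lnq g K K1 al e d : R)
    (psi : obs R N M -> R) :
  (0 < n <= N)%N -> (0 < m <= M)%N -> 0 < a -> is_test psi ->
  n%:R / N%:R = expR (- lnp) :> R -> m%:R / M%:R = expR (- lnq) :> R ->
  1 <= lnp -> 1 <= lnq -> 0 < g <= 1 / 2 -> 1 <= K -> 1 <= K1 ->
  0 <= al -> al * K <= 1 / 2 -> 0 < e -> 6 * d <= 4 * e ^+ 2 ->
  expR (2 * a ^+ 2) <= 1 + g / 8 ->
  a ^+ 4 * (n%:R * m%:R) <= 4 * (1 - g) * (n%:R * lnp + m%:R * lnq) ->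
  n%:R * a ^+ 4 <= K * lnq -> m%:R * a ^+ 4 <= K * lnp ->
  n%:R * lnp <= K1 * (m%:R * lnq) -> m%:R * lnq <= K1 * (n%:R * lnp) ->
  lnq <= expR (lnp / 4) -> lnp <= expR (lnq / 4) ->
  expR (- (lnp / 4)) <= 1 / (16 * K) -> expR (- (lnq / 4)) <= 1 / (16 * K) ->
  2 <= (g / 8) ^+ 2 * al * lnp -> 2 <= (g / 8) ^+ 2 * al * lnq ->
  expR (- n%:R) <= d ->
  expR (- (n%:R / (16 * K * K1))) <= d -> expR (- (m%:R / (16 * K * K1))) <= d ->
  n%:R * (n%:R / N%:R) * (m%:R * (m%:R / M%:R)) * a ^+ 4 <= 1 / 8 ->
  n%:R * (n%:R / N%:R) * (m%:R * (m%:R / M%:R)) * a ^+ 4 <= d / 16 ->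
  ((1 - 2 * e)%:E <= alpha psi + beta n m a psi)%E.
Proof.
move=> /andP[n0 nN] /andP[m0 mM] a0 tpsi pE qE lnp1 lnq1 /andP[g0 g2] K_1 K11 al0 alK e0 de ea
  a4 nK mK nm mn lnqk lnpk ep4 eq4 tp tq dn dn' dm' W2 Wd.
have nk0 : 0 < n%:R :> R by rewrite ltr0n.
have mk0 : 0 < m%:R :> R by rewrite ltr0n.
have s0 : 0 < a ^+ 4 by rewrite exprn_gt0.
have lp0 : 0 <= lnp by exact: le_trans lnp1.
have lq0 : 0 <= lnq by exact: le_trans lnq1.
have gg : (g / 8) ^+ 2 <= g / 4 by rewrite expr2; nra.
(* The order is 1 + [g / 8] and the cutoff level [1 - g / 4]. As (1 + g / 8)^2 (1 - g) + g / 8 <= 1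
   - g / 4, a slack of [g / 8] is left, whence the square of [g / 8] in the overflow exponent. *)
apply: (@risk_ge R N M n m a (@cutoff R (1 - g / 4) lnp lnq) (@large R n m al) nN mM
  psi (g / 8) d (4 * d) e) => //.
- exact: ltW.
- by rewrite divr_gt0//=; lra.
- move=> A B An Bm.
  have t1 : 0 <= 1 - g by lra.
  have t0 : 0 < g / 8 by rewrite divr_gt0.
  apply: le_trans (sum_overflow_le n0 m0 An Bm lp0 lq0 t0 (ltW t0) t1 a4 _) _.
    have : (1 + g / 8) * expR (2 * a ^+ 2) * (1 - g) <= (1 + g / 8) * (1 + g / 8) * (1 - g).
      by rewrite ler_wpM2r// ler_wpM2l// addr_ge0// ltW.
    clear -g0 g2; nra.
  apply: le_trans dn; rewrite ler_expR.
  have h1 : 2 * n%:R <= (g / 8) ^+ 2 * al * lnp * n%:R by rewrite ler_wpM2r.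
  have h2 : 2 * m%:R <= (g / 8) ^+ 2 * al * lnq * m%:R by rewrite ler_wpM2r.
  move: h1 h2 mk0; clear; lra.
- move=> A B An Bm.
  have ta1 : 1 - (1 - g / 4) = g / 4 by ring.
  apply: le_trans (@avg_overlap_bound_le R N M n m a al (1 - g / 4) lnp lnq
    A B n0 m0 An Bm lp0 lq0 K nN mM a0 _ al0 _ pE qE _ _ mK nK alK _ _ _ _) _.
  + apply: (@le_trans _ _ (expR (2 * a ^+ 2))).
      by rewrite ler_expR ler_peMl ?sqr_ge0// ler1n.
    by apply: (le_trans ea); move: g2; clear; lra.
  + by move: g0; clear; lra.
  + by rewrite ta1 (le_trans tp)// ler_wpM2r// ler_wpM2r.
  + by rewrite ta1 (le_trans tq)// ler_wpM2r// ler_wpM2r.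
  + exact: exp_half_le.
  + exact: exp_half_le.
  + by rewrite pE; exact: (@mass_le K _ lnq).
  + by rewrite qE; exact: (@mass_le K _ lnp).
  (* The budget [4 * d] gives one [d] to each of the linear part (at most 16 W), the two
     exponentials of thin overlaps, and exp (- n). *)
  rewrite lerD2l.
  have E1 : expR (n%:R * (n%:R / N%:R) * expR (lnp / 2) - lnp / (8 * a ^+ 4)) <= d.
    by apply: le_trans dm'; rewrite ler_expR pE; apply: (@small_exponent_le _ _ _ _ _ _ lnq).
  have E2 : expR (m%:R * (m%:R / M%:R) * expR (lnq / 2) - lnq / (8 * a ^+ 4)) <= d.
    by apply: le_trans dn'; rewrite ler_expR qE; apply: (@small_exponent_le _ _ _ _ _ _ lnp).
  have W0 : 0 <= n%:R * (n%:R / N%:R) * (m%:R * (m%:R / M%:R)) * a ^+ 4.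
    by rewrite !mulr_ge0 ?invr_ge0// ltW.
  move: W0 W2 Wd E1 E2 dn; set W := _ * (m%:R * _) * a ^+ 4 => W0 W2 Wd.
  have : expR (4 * W) - 1 <= 2 * (4 * W) by rewrite expR_sub1_le// mulr_ge0//=; move: W2; clear; lra.
  move: Wd; clear; lra.
by move: de; clear; lra.
Qed.

End risk_rates.

(** * Asymptotics of the lower bounds *)

Section lower_rates.
Context {R : realType} {F : set_system (nat * nat)} {FF : ProperFilter F}
  {n m : nat * nat -> nat}.
Let p := fun k => (n k)%:R / k.1%:R : R.
Let q := fun k => (m k)%:R / k.2%:R : R.
Let lnp := fun k => ln (p k)^-1.
Let lnq := fun k => ln (q k)^-1.
Context (nN : forall k, (n k <= k.1)%N) (mM : forall k, (m k <= k.2)%N)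
  (n_oo : n @ F --> \oo) (m_oo : m @ F --> \oo)
  (p0 : p @ F --> (0 : R)) (q0 : q @ F --> (0 : R))
  (pq0 : (fun k => lnp k / (m k)%:R + lnq k / (n k)%:R) @ F --> (0 : R))
  (llp0 : (fun k => ln (lnp k) / lnq k) @ F --> (0 : R))
  (llq0 : (fun k => ln (lnq k) / lnp k) @ F --> (0 : R))
  (pq_asymp : asymp F (fun k => (n k)%:R * lnp k) (fun k => (m k)%:R * lnq k)).

Let near_lnp A : \forall k \near F, A <= lnp k := near_lnp nN n_oo p0 A.
Let near_lnq A : \forall k \near F, A <= lnq k := near_lnq mM m_oo q0 A.

Local Notation log_nm := (@log_count R n m).

Lemma asymp_near (u v : nat * nat -> R) : (\forall k \near F, 0 < v k) ->
  asymp F u v -> exists2 K : R, 1 <= K & \forall k \near F, u k <= K * v k /\ v k <= K * u k.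
Proof.
move=> v0 [lo hi].
have [e e0 /limf_einf_gt_near le] := ereal_between lo.
have [K K1 /limf_esup_lt_near hK] : exists2 K : R, 1 <= K &
    (limf_esup (fun k => (u k / v k)%:E) F < K%:E)%E.
  case: (limf_esup _ _) hi => [r _| |_]//; last by exists 1; rewrite ?ltNyr.
  exists (1 + `|r|); first by rewrite lerDl.
  by rewrite lte_fin (le_lt_trans (ler_norm _))// ltrDr.
exists (K + e^-1); first by rewrite (le_trans K1)// lerDl invr_ge0 ltW.
move: v0 le hK; apply: filterS3 => k vk; rewrite !lte_fin add0r => le hK.
have uv : u k = u k / v k * v k by rewrite divfK// gt_eqF.
have u0 : 0 < u k / v k by exact: lt_trans le.
split.
  rewrite {1}uv ler_wpM2r ?(ltW vk)// (le_trans (ltW hK))// lerDl invr_ge0 ltW//.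
have : e * v k <= u k by rewrite uv ler_wpM2r// ltW.
rewrite -ler_pdivlMl// => /le_trans; apply; rewrite ler_wpM2r//.
  by rewrite uv mulr_ge0// ltW.
by rewrite lerDr (le_trans _ K1).
Qed.

(** The form in which the log-log conditions enter: log (1 / q) is eventually at most p^(-1/4), and
    conversely. *)
Lemma near_le_expR (u v : nat * nat -> R) : (\forall k \near F, 1 <= u k) ->
  (\forall k \near F, 1 <= v k) ->
  (fun k => ln (u k) / v k) @ F --> (0 : R) ->
  \forall k \near F, u k <= expR (v k / 4).
Proof.
move=> u1 v1 /cvgr0Pnorm_lt /(_ (1 / 4)).
rewrite divr_gt0// => /(_ isT); move: u1 v1; apply: filterS3 => k u1 v1 h.
have u0 : 0 < u k by exact: lt_le_trans u1.
have v0 : 0 < v k by exact: lt_le_trans v1.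
rewrite -[leLHS]lnK// ler_expR.
have := le_lt_trans (ler_norm _) h.
by rewrite ltr_pdivrMr// => /ltW; rewrite mulrAC mul1r.
Qed.

Lemma near_risk_ge (a : nat * nat -> R) (e : R) : (forall k, 0 < a k) ->
  (fun k => a k ^+ 2 * Num.sqrt ((n k)%:R * (m k)%:R * p k * q k)) @ F --> (0 : R) ->
  (limf_esup (fun k => (a k ^+ 2 * Num.sqrt ((n k)%:R * (m k)%:R) /
    (2 * Num.sqrt ((n k)%:R * lnp k + (m k)%:R * lnq k)))%:E) F < 1)%E ->
  0 < e ->
  \forall k \near F, forall psi : obs R k.1 k.2 -> R, is_test psi ->
    ((1 - 2 * e)%:E <= alpha psi + beta (n k) (m k) (a k) psi)%E.
Proof.
move=> a0 S0 scan1 e0.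
have nmlnq0 : \forall k \near F, 0 < (m k)%:R * lnq k.
  have mk : \forall k \near F, (0 < m k)%N by exact: near_m_gt0.
  by apply: filterS2 mk (near_lnq 1) => k mk l1; rewrite mulr_gt0 ?ltr0n// (lt_le_trans _ l1).
have [K1 K11 nK1] := asymp_near nmlnq0 pq_asymp.
have [e1 e10 /limf_esup_lt_near nsc] := ereal_between_lt scan1.
have [g [g0 g2 ge1]] : exists g, [/\ 0 < g, g <= 1 / 2 & g <= e1].
  exists (Num.min e1 (1 / 2)); split; last by rewrite ge_min lexx.
    by rewrite lt_min e10/= divr_gt0.
  by rewrite ge_min lexx orbT.
(* The constant that [share_le] yields for a ratio [K1]; [al] is then the largest value with
   [al * K <= 1 / 2]. *)
have [K KE] : exists K, K = 4 * (1 + K1) by exists (4 * (1 + K1)).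
have K_1 : 1 <= K by move: K11; rewrite KE; lra.
have K0 : 0 < K by exact: lt_le_trans K_1.
have [al [al0 alK]] : exists al, 0 < al /\ al * K = 1 / 2.
  exists (2 * K)^-1; split; first by rewrite invr_gt0 mulr_gt0.
  by rewrite invfM mulfVK ?gt_eqF// div1r.
have tta0 : 0 < (g / 8) ^+ 2 * al by rewrite mulr_gt0// exprn_gt0// divr_gt0.
(* Half the logarithm, so that a^2 <= [de] gives exp (2 a^2) <= 1 + g / 8. *)
have [de deE] : exists de, de = ln (1 + g / 8) / 2 by exists (ln (1 + g / 8) / 2).
have de0 : 0 < de by rewrite deE divr_gt0// ln_gt0// ltrDl divr_gt0.
have K16 : 0 < 16 * K * K1 by rewrite !mulr_gt0// (lt_le_trans _ K11).
have [d [d0 d6]] : exists d, 0 < d /\ 6 * d <= 4 * e ^+ 2.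
  exists (e ^+ 2 / 2); split; first by rewrite divr_gt0// exprn_gt0.
  have := sqr_ge0 e; lra.
have sig2 : \forall k \near F, `|a k ^+ 2 * Num.sqrt ((n k)%:R * (m k)%:R * p k * q k)| < Num.min (1 / 8) (d / 16).
  have eta0 : 0 < Num.min (1 / 8) (d / 16) by rewrite lt_min !divr_gt0.
  by move/cvgr0Pnorm_lt: S0 => /(_ _ eta0).
have lnq_le := near_le_expR (near_lnq 1) (near_lnp 1) llq0.
have lnp_le := near_le_expR (near_lnp 1) (near_lnq 1) llp0.
near=> k => psi tpsi.
have n0 : (0 < n k)%N by near: k; exact: near_n_gt0.
have m0 : (0 < m k)%N by near: k; exact: near_m_gt0.
have p_gt0 : 0 < p k by near: k; exact: near_p_gt0.
have q_gt0 : 0 < q k by near: k; exact: near_q_gt0.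
have lnp1 : 1 <= lnp k by near: k; exact: near_lnp.
have lnq1 : 1 <= lnq k by near: k; exact: near_lnq.
have lnp_t : 2 / ((g / 8) ^+ 2 * al) <= lnp k by near: k; exact: near_lnp.
have lnq_t : 2 / ((g / 8) ^+ 2 * al) <= lnq k by near: k; exact: near_lnq.
have lnp_K : - ln (1 / (16 * K)) * 4 <= lnp k by near: k; exact: near_lnp.
have lnq_K : - ln (1 / (16 * K)) * 4 <= lnq k by near: k; exact: near_lnq.
have n_d : - ln d <= (n k)%:R by near: k; exact: near_natr.
have n_d' : - ln d * (16 * K * K1) <= (n k)%:R by near: k; exact: near_natr.
have m_d' : - ln d * (16 * K * K1) <= (m k)%:R by near: k; exact: near_natr.
have Gd : log_nm k <= (de ^+ 2 / 4) * ((n k)%:R * (m k)%:R).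
  by near: k; apply: near_ratio; rewrite ?divr_gt0 ?exprn_gt0.
have [nm1 mn1] : (n k)%:R * lnp k <= K1 * ((m k)%:R * lnq k) /\
   (m k)%:R * lnq k <= K1 * ((n k)%:R * lnp k) by near: k.
have sck : a k ^+ 2 * Num.sqrt ((n k)%:R * (m k)%:R) /
    (2 * Num.sqrt (log_nm k)) < 1 - e1 by rewrite -lte_fin; near: k.
have sgk : `|a k ^+ 2 * Num.sqrt ((n k)%:R * (m k)%:R * p k * q k)| < Num.min (1 / 8) (d / 16).
  by near: k.
have lnqk : lnq k <= expR (lnp k / 4) by near: k.
have lnpk : lnp k <= expR (lnq k / 4) by near: k.
have nk0 : 0 < (n k)%:R :> R by rewrite ltr0n.
have mk0 : 0 < (m k)%:R :> R by rewrite ltr0n.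
have lp0 : 0 < lnp k by exact: lt_le_trans lnp1.
have lq0 : 0 < lnq k by exact: lt_le_trans lnq1.
have GE : log_nm k = (n k)%:R * lnp k + (m k)%:R * lnq k by [].
have G0 : 0 < log_nm k by rewrite GE addr_gt0 ?mulr_gt0.
have g01 : 0 <= g <= 1 by rewrite (ltW g0)/= (le_trans g2)// ler_pdivrMr// mul1r ler1n.
have nm0 : 0 < (n k)%:R * (m k)%:R :> R by rewrite mulr_gt0.
have a4 : a k ^+ 4 * ((n k)%:R * (m k)%:R) <= 4 * (1 - g) * log_nm k.
  apply: scan_ratio_le => //.
  by rewrite (le_trans (ltW sck))// lerB.
have a4' : a k ^+ 4 * ((n k)%:R * (m k)%:R) <= 4 * log_nm k.
  by rewrite (le_trans a4)// ler_wpM2r ?(ltW G0)// ler_piMr// gerBl ltW.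
have nK : (n k)%:R * a k ^+ 4 <= K * lnq k.
  by rewrite KE; apply: share_le nm1 => //; rewrite -GE.
have mK : (m k)%:R * a k ^+ 4 <= K * lnp k.
  by rewrite KE; apply: share_le mn1 => //; rewrite [_ + _]addrC -GE [_ * (n k)%:R]mulrC.
(* The scan condition makes a^4 n m at most 4 [log_count], which is negligible compared with n m:
   the amplitude tends to 0. *)
have a2 : a k ^+ 2 <= de.
  rewrite -ler_sqr ?nnegrE ?sqr_ge0 ?(ltW de0)// -exprM.
  rewrite -(ler_pM2r nm0) (le_trans a4')//.
  apply: (@le_trans _ _ (4 * (de ^+ 2 / 4 * ((n k)%:R * (m k)%:R)))); first by rewrite ler_wpM2l.
  by rewrite mulrA [4 * (_ / _)]mulrC divfK// pnatr_eq0.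
have eK : expR (ln (1 / (16 * K))) = 1 / (16 * K) by rewrite lnK// posrE divr_gt0// mulr_gt0.
have two (l x : R) : 0 < x -> 2 / x <= l -> 2 <= x * l.
  by move=> x0; rewrite ler_pdivrMr// mulrC.
have dE (x : R) : - ln d <= x -> expR (- x) <= d.
  by move=> dx; rewrite -[leRHS]lnK ?posrE// ler_expR lerNl.
pose sg := a k ^+ 2 * Num.sqrt ((n k)%:R * (m k)%:R * p k * q k).
(* The quantity that governs small overlaps is the square of the signal of the linear test, which is
   where its convergence to 0 enters. *)
have W : (n k)%:R * ((n k)%:R / k.1%:R) * ((m k)%:R * ((m k)%:R / k.2%:R)) * a k ^+ 4 = `|sg| ^+ 2.
  rewrite real_normK ?num_real// /sg exprMn sqr_sqrtr -?exprM /p /q; first by ring.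
  by rewrite !mulr_ge0 ?invr_ge0.
have sg0 : 0 <= `|sg| by [].
have sg1 : `|sg| <= 1 / 8.
  by rewrite (le_trans (ltW sgk))// ge_min lexx.
have sg2 : `|sg| <= d / 16.
  by rewrite (le_trans (ltW sgk))// ge_min lexx orbT.
have sgs : `|sg| ^+ 2 <= `|sg|.
  by rewrite expr2 ler_piMr// (le_trans sg1)// ler_pdivrMr// mul1r ler1n.
apply: (@risk_ge_rates R k.1 k.2 (n k) (m k) (a k) (lnp k) (lnq k) g K K1 al e d) => //.
- by rewrite n0 nN.
- by rewrite m0 mM.
- by rewrite /lnp lnV ?posrE// opprK lnK.
- by rewrite /lnq lnV ?posrE// opprK lnK.
- by rewrite g0.
- exact: ltW.
- by rewrite alK.
- rewrite -[leRHS]lnK ?posrE ?addr_gt0 ?divr_gt0// ler_expR.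
  by rewrite mulrC -ler_pdivlMr// -deE.
- by rewrite -eK ler_expR lerNl ler_pdivlMr.
- by rewrite -eK ler_expR lerNl ler_pdivlMr.
- exact: two.
- exact: two.
- exact: dE.
- by apply: dE; rewrite ler_pdivlMr.
- by apply: dE; rewrite ler_pdivlMr.
- by rewrite W (le_trans sgs).
- by rewrite W (le_trans sgs).
Unshelve. all: by end_near. Qed.

End lower_rates.

(** * Limits of the minimax risks *)

Lemma expect_cst {R : realType} {N M : nat} (S : 'M[R]_(N, M)) (c : R) :
  expect S (fun=> c) = c%:E.
Proof.
by rewrite /expect integral_cst// [X in (_ * X)%E](@probability_setT _ _ _ (noise_law R N M)) mule1.
Qed.

Lemma is_test_cst {R : realType} {N M : nat} (c : R) : 0 <= c <= 1 ->
  @is_test R N M (fun=> c).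
Proof. by move=> c01; split. Qed.

Lemma beta_cst_le {R : realType} {N M : nat} n m (a c : R) :
  (beta n m a (fun _ : obs R N M => c) <= (1 - c)%:E)%E.
Proof. by apply: le_beta => S _; rewrite expect_cst. Qed.

Section lower_limits.
Context {R : realType} {F : set_system (nat * nat)} {FF : ProperFilter F}
  {n m : nat * nat -> nat} {a : nat * nat -> R}.
Context (risk : forall e : R, 0 < e ->
  \forall k \near F, forall psi : obs R k.1 k.2 -> R, is_test psi ->
    ((1 - 2 * e)%:E <= alpha psi + beta (n k) (m k) (a k) psi)%E).

Lemma gamma_min_cvg1 :
  (fun k => gamma_min k.1 k.2 (n k) (m k) (a k)) @ F --> 1%E.
Proof.
apply: cvg_EFin_near => e e0; have e20 : 0 < e / 2 by rewrite divr_gt0.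
apply: filterS (risk e20) => k rk; apply/andP; split.
  apply: le_ereal_inf_tmp => _ [psi tpsi <-]; have := rk psi tpsi.
  by rewrite mulrC divfK.
apply: (@le_trans _ _ 1%E); last by rewrite lee_fin lerDl ltW.
(* The test that never rejects has risk at most 1. *)
apply: ge_ereal_inf; exists (gamma (n k) (m k) (a k) (fun _ : obs R k.1 k.2 => 0)).
  by exists (fun=> 0) => //; apply: is_test_cst; rewrite lexx ler01.
rewrite /gamma /alpha expect_cst add0e (le_trans (beta_cst_le _ _ _ _))// subr0//.
Qed.

Lemma beta_min_cvg (al : R) : 0 < al < 1 ->
  (fun k => beta_min k.1 k.2 (n k) (m k) (a k) al) @ F --> (1 - al)%:E.
Proof.
move=> /andP[al0 al1].
apply: cvg_EFin_near => e e0; have e20 : 0 < e / 2 by rewrite divr_gt0.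
apply: filterS (risk e20) => k rk; apply/andP; split.
  apply: le_ereal_inf_tmp => _ [psi [tpsi apsi] <-]; have := rk psi tpsi.
  rewrite mulrC divfK// => h.
  rewrite addrAC EFinB leeBlDl//; exact: le_trans h (leeD2r _ apsi).
apply: (@le_trans _ _ (1 - al)%:E); last by rewrite lee_fin lerDl ltW.
(* Rejecting with probability [al] whatever the data has level [al] and second error at most 1 -
   [al]. *)
apply: ge_ereal_inf; exists (beta (n k) (m k) (a k) (fun _ : obs R k.1 k.2 => al)).
  exists (fun=> al) => //; split; first by apply: is_test_cst; rewrite !ltW.
  by rewrite /alpha expect_cst.
exact: beta_cst_le.
Qed.

End lower_limits.

(* All quantities are indexed by the pair k = (N, M), and N, M tend to infinity
   along a filter F, which may be the product filter \oo * \oo or a finer one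
   (for example the one given by a sequence of pairs).  The product filter alone
   would not do: the relation between n and m in the lower bounds ties the growth
   of N to that of M. *)
Theorem theorem4p3 (R : realType) (F : set_system (nat * nat))
    (FF : ProperFilter F) (n m : nat * nat -> nat) :
  let p := fun k => (n k)%:R / k.1%:R : R in
  let q := fun k => (m k)%:R / k.2%:R : R in
  let lp := fun k => ln (p k)^-1 in
  let lq := fun k => ln (q k)^-1 in
  let signal := fun (a : nat * nat -> R) k =>
    a k ^+ 2 * Num.sqrt ((n k)%:R * (m k)%:R * p k * q k) in
  let scan_ratio := fun (a : nat * nat -> R) k =>
    a k ^+ 2 * Num.sqrt ((n k)%:R * (m k)%:R) /
    (2 * Num.sqrt ((n k)%:R * lp k + (m k)%:R * lq k)) in
  (forall k, n k <= k.1)%N -> (forall k, m k <= k.2)%N ->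
  fst @ F --> \oo -> snd @ F --> \oo ->
  n @ F --> \oo -> m @ F --> \oo ->
  p @ F --> (0 : R) -> q @ F --> (0 : R) ->
  (fun k => lp k / (m k)%:R + lq k / (n k)%:R) @ F --> (0 : R) ->
  (forall a : nat * nat -> R, (forall k, 0 < a k) ->
     signal a @ F --> +oo \/
     (1 < limf_einf (fun k => (scan_ratio a k)%:E) F)%E ->
     exists2 delta0 : R, 0 < delta0 &
       forall delta : R, 0 < delta < delta0 ->
       forall H : nat * nat -> R, H @ F --> +oo ->
         (signal a @ F --> +oo ->
            exists2 c : R, 0 < c < 1 &
              \forall k \near F, H k <= c * (signal a k / 2)) ->
         (fun k => gamma (n k) (m k) (a k)
            (@psi_z R k.1 k.2 (n k) (m k) (H k) delta)) @ F --> 0%E) /\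
  ((fun k => ln (lp k) / lq k) @ F --> (0 : R) ->
   (fun k => ln (lq k) / lp k) @ F --> (0 : R) ->
   asymp F (fun k => (n k)%:R * lp k) (fun k => (m k)%:R * lq k) ->
   forall a : nat * nat -> R, (forall k, 0 < a k) ->
     signal a @ F --> (0 : R) ->
     (limf_esup (fun k => (scan_ratio a k)%:E) F < 1)%E ->
     (fun k => gamma_min k.1 k.2 (n k) (m k) (a k)) @ F --> 1%E /\
     (forall al : R, 0 < al < 1 ->
        (fun k => beta_min k.1 k.2 (n k) (m k) (a k) al) @ F
          --> (1 - al)%:E)).
Proof.
move=> p q lp lq signal scan_ratio nN mM N_oo M_oo n_oo m_oo p0 q0 pq0; split.
  by move=> a a0 h; exact: (upper_bound nN mM N_oo n_oo m_oo p0 q0 pq0 a0 h).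
move=> llp llq pq_asymp a a0 S0 scan1.
have risk e (e0 : 0 < e) := near_risk_ge nN mM n_oo m_oo p0 q0 pq0 llp llq pq_asymp a0 S0 scan1 e0.
by split=> [|al al01]; [exact: gamma_min_cvg1 (risk FF)|exact: beta_min_cvg (risk FF) _ al01].
Qed.
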